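(* Let $\Gamma$ be a finitely generated abelian group and let $\Gamma\curvearrowright (X,\mu)$ be a free Borel probability-measure-preserving action on a standard Borel probability space. Suppose $A,B\subseteq X$ are two $\mu$-measurable $\Gamma$-equidistributed sets with $\mu(A)=\mu(B)>0$. Then the following are equivalent: (1) the pair $A,B$ satisfies the Hall condition with respect to $\Gamma$ $\mu$-a.e.; (2) $A$ and $B$ are $\Gamma$-equidecomposable $\mu$-a.e. using $\mu$-measurable pieces; (3) $A$ and $B$ are $\Gamma$-equidecomposable $\mu$-a.e.
   Context: Schreier graph: given a finite symmetric generating set $S$ of $\Gamma$, the Schreier graph $G_S$ of the action connects $x$ and $y$ iff $y=\gamma x$ for some $\gamma\in S$; $\mathrm{ball}_k(F)$ denotes the set of points at graph distance at most $k$ from the set $F$ (so $\mathrm{ball}_1(F)=N(F)$ is the $1$-ball around $F$, containing $F$). Hall condition $\mu$-a.e.: there is a finite symmetric generating set $S$ such that for $\mu$-a.e. $x\in X$ and every finite $F\subseteq\Gamma\cdot x$ we have $|F\cap A|\le |N(F)\cap B|$ and $|F\cap B|\le|N(F)\cap A|$, where $N(F)$ is the $1$-ball around $F$ in $G_S$. Equidistributed: write $\Gamma\cong\mathbb Z^d\times\Delta$ with $d\ge0$ and $\Delta$ finite. A measurable set $A$ is $\Gamma$-equidistributed if there is a constant $c$ such that for every $n\ge1$ and $\mu$-a.e. $x$, the discrepancy $\left|\frac{|A\cap F|}{|F|}-\mu(A)\right|\le \frac{c}{n}$, where $F=([0,n]^d\times\Delta)\cdot x$ and $[0,n]=\{0,1,\dots,n\}$.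 $\Gamma$-equidecomposable $\mu$-a.e. (using $\mu$-measurable pieces): there exist $n$, pairwise disjoint sets $A_1,\dots,A_n\subseteq A$, pairwise disjoint sets $B_1,\dots,B_n\subseteq B$ (which are $\mu$-measurable, in the measurable version), and $\gamma_1,\dots,\gamma_n\in\Gamma$ with $\gamma_iA_i=B_i$ for all $i$, $\mu(A\setminus\bigcup_iA_i)=0$ and $\mu(B\setminus\bigcup_iB_i)=0$. *)

(* Defs.v *)
From HB Require Import structures.
From mathcomp Require Import all_boot all_order all_algebra.
From mathcomp Require Import all_classical all_reals all_analysis.
From mathcomp Require Import finmap.
Set Implicit Arguments. Unset Strict Implicit. Unset Printing Implicit Defensive.
Import Order.TTheory GRing.Theory Num.Theory.
Local Open Scope classical_set_scope.
Local Open Scope ring_scope.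

Definition Grp (d : nat) (Delta : finZmodType) : Type := ('rV[int]_d * Delta)%type.

Section Defs.
Context {dX : measure_display} {X : measurableType dX} {R : realType}.

(* standard Borel space: Borel isomorphic to a Borel subset of R *)
Definition standard_borel : Prop :=
  exists f : X -> R, injective f /\ measurable_fun setT f /\
    measurable (range f) /\ (forall A : set X, measurable A -> measurable (f @` A)).

Variables (d : nat) (Delta : finZmodType) (mu : probability X R)
  (act : Grp d Delta -> X -> X).

Definition free_pmp_action : Prop :=
  [/\ forall x, act 0 x = x,
      forall g h x, act (g + h) x = act g (act h x),
      forall g, measurable_fun setT (act g),
      forall g (B : set X), measurable B -> mu (act g @^-1` B) = mu B &
      forall g x, act g x = x -> g = 0].

(* mu-measurable = measurable for the completion of mu *)
Definition mu_measurable (A : set X) : Prop :=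
  exists B : set X, measurable B /\ mu.-negligible ((A `\` B) `|` (B `\` A)).

(* value of the completed measure (= outer measure) *)
Definition mu_c (A : set X) : \bar R :=
  ereal_inf [set mu B | B in [set B | measurable B /\ A `<=` B]].

Definition orbit (x : X) : set X := [set act g x | g in [set: Grp d Delta]].

(* 1-ball around F in the Schreier graph G_S *)
Definition ball1 (S : seq (Grp d Delta)) (F : set X) : set X :=
  [set y | exists2 x, F x & (y = x \/ exists2 s, s \in S & y = act s x)].

Definition sym_gen_set (S : seq (Grp d Delta)) : Prop :=
  (forall s, s \in S -> - s \in S) /\
  (forall g : Grp d Delta, exists l : seq (Grp d Delta),
      all (fun s => s \in S) l /\ g = \sum_(s <- l) s).

Definition hall_ae (A B : set X) : Prop :=
  exists S : seq (Grp d Delta), sym_gen_set S /\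
    {ae mu, forall x, forall F : set X, finite_set F -> F `<=` orbit x ->
       ((F `&` A) #<= (ball1 S F `&` B))%card /\
       ((F `&` B) #<= (ball1 S F `&` A))%card}.

Definition box (n : nat) : set (Grp d Delta) :=
  [set g : Grp d Delta | forall i : 'I_d, (0 <= (g.1 : 'rV[int]_d) ord0 i <= n%:Z)].

Definition boxorb (n : nat) (x : X) : set X := [set act g x | g in box n].

Definition equidistributed (A : set X) : Prop :=
  mu_measurable A /\
  exists c : R, forall n : nat, (0 < n)%N ->
    {ae mu, forall x,
      (`| ((#|` fset_set (A `&` boxorb n x)|)%:R
            / (#|` fset_set (boxorb n x)|)%:R)%:E - mu_c A | <= (c / n%:R)%:E)%E}.

Definition equidecomposable_ae (meas : bool) (A B : set X) : Prop :=
  exists (n : nat) (As Bs : nat -> set X) (gam : nat -> Grp d Delta),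
    [/\ forall i, (i < n)%N ->
          [/\ As i `<=` A, Bs i `<=` B, act (gam i) @` As i = Bs i &
              (meas -> mu_measurable (As i) /\ mu_measurable (Bs i))],
        forall i j, (i < n)%N -> (j < n)%N -> i <> j ->
          As i `&` As j = set0 /\ Bs i `&` Bs j = set0,
        mu.-negligible (A `\` \bigcup_(i in [set i | (i < n)%N]) As i) &
        mu.-negligible (B `\` \bigcup_(i in [set i | (i < n)%N]) Bs i)].

End Defs.

(* Main.v *)
(* Only the implication from the Hall condition to measurable equidecomposability
   is hard. Hall's theorem on large cubes, averaged over their translates, yields
   measurable fractional matchings that are almost perfect; near-minimisers of the
   L2 energy converge a.e. and give a perfect one of bounded displacement. Since
   g - g o T_v is a coboundary, the matching becomes a bounded Delta-invariant real
   flow along the edges of Z^d whose divergence is the difference of the numbers of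
   points of A and of B in a Delta-orbit. Almost every Z^d-orbit is split into finite
   classes by nested, well separated boxes. For d >= 2 the boundary of a box is
   connected, so the flow can be altered around the boundaries to be integral on
   every edge joining two classes. Each class is tiled by boxes of side between m
   and 3m; by equidistribution these contain of the order of m^d points of A and of
   B, while the flow through their sides is O(m^(d-1)), so for m large the points of
   a class and the units of flow through its boundary have a fractional, hence an
   integral, matching of displacement O(m). Finite classes admit measurable choices
   of such matchings. Composing matchings along the units of flow between adjacent
   classes matches A with B by finitely many group elements. *)
Require Import Defs.
From HB Require Import structures.
From mathcomp Require Import all_boot all_order all_algebra.
From mathcomp Require Import all_classical all_reals all_analysis.
From mathcomp Require Import finmap measurable_realfun.
From mathcomp Require Import zify ring lra.
Import Order.TTheory GRing.Theory Num.Theory numFieldNormedType.Exports.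
Local Open Scope classical_set_scope.
Local Open Scope ring_scope.
Set Implicit Arguments. Unset Strict Implicit. Unset Printing Implicit Defensive.

(** * Bipartite matchings *)

(** The bound [M] on the flow is fixed before [m] is chosen, so that volume beats surface in every
    tile. The rounded flow stays bounded because the correcting chain on squares is reduced modulo 1
    and because the corrections of different boxes never meet. In a tile the points of [A] supply
    all outgoing flow and the points of [B] absorb all incoming flow; hence a unit entering a class
    is never passed on, every displacement crosses at most one class boundary, and finitely many
    group elements suffice. The finite factor [Delta] is divided out by keeping [X] and shrinking
    its sigma-algebra to the invariant sets. All choices range over countable types of finite codes,
    named relative to the point that carries them, so that first witnesses are measurable; null sets
    are absorbed by invariant conull sets. *)

Section Hall.
Import mathcomp.boot.finset.
Context {L K : finType} (r : L -> K -> bool) (y0 : K).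

Let nbr (X : {set L}) (T : {set K}) := [set y in T | [exists x in X, r x y]].

(** Halmos-Vaughan induction on the size of [D]. A nonempty proper subset with exactly as many
    neighbours as elements is matched first and its neighbours are deleted from [T]; if there is
    none, one pair is removed and every remaining set loses at most the one neighbour it has to
    spare. [T] is a parameter because it shrinks along the induction. *)
Lemma hall_on n (D : {set L}) (T : {set K}) : (#|D| <= n)%N ->
  (forall X : {set L}, X \subset D -> (#|X| <= #|nbr X T|)%N) ->
  exists m : L -> K, {in D &, injective m} /\
    forall x, x \in D -> m x \in T /\ r x (m x).
Proof.
elim: n D T => [|n IH] D T.
  rewrite leqn0 cards_eq0 => /eqP-> _; exists (fun=> y0).
  by split=> [x y|x]; rewrite in_set0.
move=> Dn hD.
have [->|[x0 x0D]] := set_0Vmem D.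
  by exists (fun=> y0); split=> [x y|x]; rewrite in_set0.
case: (boolP [exists X : {set L}, [&& X \proper D, X != set0 & #|nbr X T| == #|X|]]).
  move=> /existsP[X /and3P[XD X0 /eqP NX]].
  have cX : (#|X| < #|D|)%N by exact: proper_card.
  have X0' : (0 < #|X|)%N by rewrite card_gt0.
  have [|Z ZX|m1 [m1i m1T]] := IH X T; first by lia.
    by apply: hD; apply: fintype.subset_trans ZX (proper_sub XD).
  have cDX : #|D :\: X| = (#|D| - #|X|)%N.
    by rewrite cardsD (setIidPr (proper_sub XD)).
  have [|Z ZX|m2 [m2i m2T]] := IH (D :\: X) (T :\: nbr X T); first by lia.
    have ZD : Z \subset D by apply: fintype.subset_trans ZX (subsetDl _ _).
    have dZX : fintype.disjoint (mem Z) (mem X).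
      by apply/pred0P => y /=; apply/negbTE/negP=> /andP[/(fintype.subsetP ZX)];
        rewrite !inE => /andP[/negP].
    (* Hall's condition passes to the remainder: apply it to [Z :|: X] and cancel the neighbours of
       [X], which are exactly as many as its elements. *)
    have := hD (Z :|: X); rewrite subUset ZD (proper_sub XD) => /(_ isT).
    have -> : nbr (Z :|: X) T = nbr X T :|: nbr Z (T :\: nbr X T).
      apply/setP => y; rewrite !inE; case: (y \in T) => //=.
      rewrite andbT -[[exists x in Z :|: X, r x y]]/_.
      have -> : [exists x in Z :|: X, r x y] = [exists x in X, r x y] || [exists x in Z, r x y].
        apply/existsP/orP => [[x]|[/existsP[x /andP[xX rx]]|/existsP[x /andP[xX rx]]]].
        - rewrite inE => /andP[/orP[xZ|xX] rx]; [right|left];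
            by apply/existsP; exists x; rewrite ?xZ ?xX.
        - by exists x; rewrite inE xX orbT.
        - by exists x; rewrite inE xX.
      by case: [exists x in X, r x y].
    rewrite cardsU (eqP (_ : #|Z :&: X| == 0%N)); last by rewrite cards_eq0 setI_eq0.
    rewrite subn0 => h.
    have := leq_trans h (leq_card_setU _ _); rewrite NX; lia.
  exists (fun x => if x \in X then m1 x else m2 x); split.
    move=> x y xD yD.
    case: ifPn => xX; case: ifPn => yX; first exact: m1i.
    - move=> e; have [] := m2T y; first by rewrite inE yX.
      rewrite -e inE => /andP[/negP[]].
      have [? ?] := m1T _ xX.
      by rewrite inE; apply/andP; split=> //; apply/existsP; exists x; rewrite xX.
    - move=> e; have [] := m2T x; first by rewrite inE xX.
      rewrite e inE => /andP[/negP[]].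
      have [? ?] := m1T _ yX.
      by rewrite inE; apply/andP; split=> //; apply/existsP; exists y; rewrite yX.
    - by apply: m2i; rewrite inE ?xX ?yX.
  move=> x xD; case: ifPn => xX; first exact: m1T.
  by have [|] := m2T x; rewrite inE ?xX // => /andP[].
move=> /existsPn hs.
have := hD [set x0]; rewrite sub1set x0D cards1 => /(_ isT).
move=> /card_gt0P[y]; rewrite inE => /andP[yT /existsP[x /andP[]]].
rewrite inE => /eqP -> r0.
have c0 : #|D :\ x0| = #|D|.-1 by rewrite (cardsD1 x0 D) x0D.
have [|Z ZD|m [mi mT]] := IH (D :\ x0) (T :\ y); first by lia.
  have [->|Z0] := eqVneq Z set0; first by rewrite cards0.
  have ZpD : Z \proper D.
    apply/properP; split; first by apply: fintype.subset_trans ZD (subsetDl _ _).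
    by exists x0 => //; apply/negP => /(fintype.subsetP ZD); rewrite !inE eqxx.
  have := hs Z; rewrite ZpD Z0 /= => nE.
  have lZ := hD _ (proper_sub ZpD).
  have -> : nbr Z (T :\ y) = nbr Z T :\ y.
    by apply/setP=> z; rewrite !inE; case: (z == y).
  by have := cardsD1 y (nbr Z T); case: (y \in _) => /=; lia.
exists (fun x => if x == x0 then y else m x); split.
  move=> a b aD bD; case: eqP => [->|/eqP ax]; case: eqP => [->//|/eqP bx] e.
  - by have [] := mT b; rewrite ?inE ?bx // -e eqxx.
  - by have [] := mT a; rewrite ?inE ?ax // e eqxx.
  - by apply: mi; rewrite ?inE ?ax ?bx.
move=> a aD; case: eqP => [->//|/eqP ax].
by have [] := mT a; rewrite ?inE ?ax // => /andP[].
Qed.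

End Hall.

(** Sequences are replaced by their index ordinals, so that Hall's theorem applies to finite pieces
    of infinite orbits. The value [y0] is taken outside [l]. *)
Lemma hall_seq (L K : eqType) (r : L -> K -> bool) (l : seq L) (k : seq K) (y0 : K) :
  uniq l -> uniq k ->
  (forall X : seq L, uniq X -> {subset X <= l} ->
     (size X <= count (fun y => has (r^~ y) X) k)%N) ->
  exists m : L -> K, {in l &, injective m} /\
    forall x, x \in l -> m x \in k /\ r x (m x).
Proof.
move=> ul uk hl.
have [l0|[x0 x0l]] : l = [::] \/ exists x0, x0 \in l.
  by case: (l) => [|x l1]; [left|right; exists x; rewrite mem_head].
- by exists (fun=> y0); rewrite l0; split.
have k0 : (0 < size k)%N.
  have := hl [:: x0] isT; move=> /(_ _)/leq_trans; apply.
    by move=> x; rewrite inE => /eqP ->.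
  exact: count_size.
pose rr (i : 'I_(size l)) (j : 'I_(size k)) := r (nth x0 l i) (nth y0 k j).
have [|X _|m [mi mT]] := @hall_on _ _ rr (Ordinal k0) (size l) [set: 'I_(size l)] [set: 'I_(size k)].
- by rewrite cardsT card_ord.
- have uX : uniq [seq nth x0 l i | i : 'I_(size l) <- enum X].
    rewrite map_inj_in_uniq ?enum_uniq // => i j _ _ /eqP.
    by rewrite nth_uniq // => /eqP/val_inj.
  have := hl _ uX; rewrite size_map -cardE => /(_ _)/leq_trans; apply.
    by move=> x /mapP[i _ ->]; rewrite mem_nth.
  rewrite -sum1_count (big_nth y0) big_mkord sum1_card.
  apply: subset_leq_card; apply/fintype.subsetP => j; rewrite !inE /= unfold_in /= => /hasP[x /mapP[i iX ->] ri].
  by apply/existsP; exists i; rewrite -mem_enum iX.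
have h x (xl : x \in l) : (index x l < size l)%N by rewrite index_mem.
pose mm x := if insub (index x l) is Some i then nth y0 k (m i) else y0.
have mmE x (xl : x \in l) : mm x = nth y0 k (m (Ordinal (h x xl))).
  by rewrite /mm (insubT (fun i => i < size l)%N (h x xl)).
exists mm; split.
  move=> x y xl yl; rewrite !mmE => /eqP; rewrite nth_uniq // => /eqP/val_inj/mi.
  rewrite !inE => /(_ isT isT)[] e.
  by rewrite -(nth_index x0 xl) -(nth_index x0 yl) e.
move=> x xl; rewrite mmE mem_nth //; split=> //.
by have [|_] := mT (Ordinal (h x xl)); rewrite ?inE // /rr /= nth_index.
Qed.

(* A fractional perfect matching satisfies Hall's condition. *)
Lemma fractional_matching (R : realDomainType) (L K : eqType) (r : L -> K -> bool)
    (w : L -> K -> R) (l : seq L) (k : seq K) (y0 : K) :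
  uniq l -> uniq k ->
  {in l & k, forall x y, 0 <= w x y} ->
  {in l & k, forall x y, ~~ r x y -> w x y = 0} ->
  {in l, forall x, \sum_(y <- k) w x y = 1} ->
  {in k, forall y, \sum_(x <- l) w x y = 1} ->
  exists m : L -> K, [/\ {in l &, injective m},
    forall x, x \in l -> m x \in k /\ r x (m x) &
    forall y, y \in k -> exists2 x, x \in l & m x = y].
Proof.
move=> ul uk w0 wr w1 w2.
have [X uX Xl|m [mi mk]] := @hall_seq _ _ r l k y0 ul uk.
  set P := fun y => _.
  rewrite -(ler_nat R).
  have -> : (size X)%:R = \sum_(y <- k | P y) \sum_(x <- X) w x y.
    rewrite -sum1_size natr_sum.
    transitivity (\sum_(x <- X) \sum_(y <- k) w x y).
      by apply: eq_big_seq => x xX; rewrite w1 // Xl.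
    rewrite exchange_big /= [RHS]big_mkcond /=; apply: eq_big_seq => y yk.
    case: ifPn => // /hasPn hP; rewrite big_seq big1 // => x xX.
    by apply: wr (hP _ xX) => //; apply: Xl.
  rewrite -sum1_count natr_sum [leLHS]big_seq_cond [leRHS]big_seq_cond.
  apply: ler_sum => y /andP[yk _]; rewrite -(w2 y yk).
  have -> : \sum_(x <- X) w x y = \sum_(x <- l | x \in X) w x y.
    rewrite -[RHS]big_filter; apply: perm_big; apply: uniq_perm => //; first exact: filter_uniq.
    by move=> x; rewrite mem_filter; case: (boolP (x \in X)) => // /Xl ->.
  rewrite [leRHS](bigID (mem X)) /= lerDl big_seq_cond sumr_ge0 // => x /andP[xl _].
  exact: w0.
exists m; split=> // y yk.
(* Both sizes equal the total weight, so the injection is onto. *)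
have sz : size l = size k.
  apply/eqP; rewrite -(eqr_nat R) -!sum1_size !natr_sum.
  rewrite -(eq_big_seq _ w1) exchange_big /=; apply/eqP; exact: eq_big_seq.
have um : uniq (map m l) by rewrite map_inj_in_uniq.
have sub : {subset map m l <= k} by move=> z /mapP[x xl ->]; have [] := mk x xl.
have [|_ e] := uniq_min_size um sub; first by rewrite size_map sz.
by move: yk; rewrite -e => /mapP[x xl ->]; exists x.
Qed.

(** * Measurable choice *)

Section DiscreteMeasurability.
Context {d : measure_display} {X : measurableType d}.
Implicit Types P Q : X -> Prop.

(** Measurability is put on predicates, so that it can be proved along the logical structure of a
    formula, quantifiers over countable types included. *)
Definition mp P := measurable [set x | P x].

Lemma mp_ext P Q : (forall x, P x <-> Q x) -> mp P -> mp Q.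
Proof. by move=> h; rewrite /mp (_ : [set x | P x] = [set x | Q x]) //; apply/seteqP; split=> x /h. Qed.

Lemma mp_cst (P : Prop) : mp (fun=> P).
Proof.
have [h|h] := pselect P.
  by apply: (@mp_ext (fun=> True)) => //; exact: measurableT.
by apply: (@mp_ext (fun=> False)) => //; exact: measurable0.
Qed.

Lemma mp_not P : mp P -> mp (fun x => ~ P x).
Proof. exact: measurableC. Qed.

Lemma mp_and P Q : mp P -> mp Q -> mp (fun x => P x /\ Q x).
Proof. exact: measurableI. Qed.

Lemma mp_or P Q : mp P -> mp Q -> mp (fun x => P x \/ Q x).
Proof. exact: measurableU. Qed.

Lemma mp_imp P Q : mp P -> mp Q -> mp (fun x => P x -> Q x).
Proof.
move=> mP mQ; apply: (@mp_ext (fun x => ~ P x \/ Q x)); last by apply: mp_or => //; exact: mp_not.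
by move=> x; split=> [[]//|h]; have [/h|] := pselect (P x); [right|left].
Qed.

Lemma mp_exists (T : countType) (P : T -> X -> Prop) :
  (forall t, mp (P t)) -> mp (fun x => exists t, P t x).
Proof.
move=> mP; apply: (@mp_ext (\bigcup_t [set x | P t x])).
  by move=> x; split=> [[t _ Pt]|[t Pt]]; exists t.
by apply: countable_bigcupT_measurable.
Qed.

Lemma mp_forall (T : countType) (P : T -> X -> Prop) :
  (forall t, mp (P t)) -> mp (fun x => forall t, P t x).
Proof.
move=> mP; apply: (@mp_ext (fun x => ~ exists t, ~ P t x)).
  move=> x; split=> [h t|h [t]]; last by apply.
  by apply: contrapT => nP; apply: h; exists t.
by apply/mp_not/mp_exists => t; exact: mp_not.
Qed.

Lemma mp_comp (g : X -> X) P : measurable_fun setT g -> mp P -> mp (fun x => P (g x)).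
Proof.
by move=> mg mP; rewrite /mp -[X in measurable X]setTI; exact: (mg measurableT _ mP).
Qed.

Lemma mp_le (R : realType) (f g : X -> R) :
  measurable_fun setT f -> measurable_fun setT g -> mp (fun x => f x <= g x).
Proof.
move=> mf mg; rewrite /mp -[X in measurable X]setTI.
by have := @measurable_fun_ler _ _ _ _ _ _ mf mg measurableT [set true] I; rewrite preimage_true.
Qed.

Lemma mp_lt (R : realType) (f g : X -> R) :
  measurable_fun setT f -> measurable_fun setT g -> mp (fun x => f x < g x).
Proof.
move=> mf mg; apply: (@mp_ext (fun x => ~ g x <= f x)); last exact/mp_not/mp_le.
by move=> x; rewrite ltNge; split=> /negP.
Qed.

(** Measurability for the discrete sigma-algebra on [T]. *)
Definition dmeas {T : Type} (h : X -> T) := forall P : T -> Prop, mp (fun x => P (h x)).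

Lemma dmeas_fiber (T : countType) (h : X -> T) : (forall t, mp (fun x => h x = t)) -> dmeas h.
Proof.
move=> mh P; apply: (@mp_ext (fun x => exists t, P t /\ h x = t)).
  by move=> x; split=> [[t [Pt ->]]|]//; exists (h x).
by apply: mp_exists => t; apply: mp_and => //; exact: mp_cst.
Qed.

(* Countable uniformization: the first witness in an enumeration. *)
Lemma dmeas_select (T : countType) (P : T -> X -> Prop) :
  (forall t, mp (P t)) -> (forall x, exists t, P t x) ->
  exists h : X -> T, dmeas h /\ forall x, P (h x) x.
Proof.
move=> mP exP.
pose code n x := exists t, choice.unpickle n = Some t /\ P t x.
have exn x : exists n, `[< code n x >].
  by have [t Pt] := exP x; exists (choice.pickle t); apply/asboolP; exists t; rewrite choice.pickleK.
pose first x := ex_minn (exn x).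
have firstP x : exists t : T, choice.unpickle (first x) == Some t.
  rewrite /first; case: ex_minnP => n /asboolP[t [e _]] _.
  by exists t; rewrite e.
exists (fun x => xchoose (firstP x)); split; last first.
  move=> x; have /eqP := xchooseP (firstP x); move: (xchoose _) => t.
  rewrite /first; case: ex_minnP => n /asboolP[t' [-> Pt]] _ [] <-.
  exact: Pt.
apply: dmeas_fiber => t.
apply: (@mp_ext (fun x => exists n : nat, (choice.unpickle n = Some t /\ code n x) /\
    forall m : nat, (m < n)%N -> ~ code m x)).
  move=> x; split=> [[n [[nt cn] hn]]|e].
    have /eqP := xchooseP (firstP x); move: (xchoose _) => t1.
    rewrite /first; case: ex_minnP => m /asboolP cm /(_ n) hm.
    case: (ltngtP m n) => mn.
    - by case: (hn m mn).
    - by have := hm (asboolT cn); rewrite leqNgt mn.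
    - by rewrite mn nt => -[].
  exists (first x); split.
    split; last by rewrite /first; case: ex_minnP => n /asboolP.
    by have /eqP := xchooseP (firstP x); rewrite e.
  move=> m; rewrite /first; case: ex_minnP => n _ hn mn cm.
  by have := hn m (asboolT cm); rewrite leqNgt mn.
have mcode n : mp (code n).
  by apply: mp_exists => t1; apply: mp_and; [exact: mp_cst|exact: mP].
apply: mp_exists => n; apply: mp_and; first by apply: mp_and => //; exact: mp_cst.
by apply: mp_forall => m; apply: mp_imp; [exact: mp_cst|exact: mp_not].
Qed.

Lemma dmeas_comp (T S : Type) (g : T -> S) (h : X -> T) : dmeas h -> dmeas (fun x => g (h x)).
Proof. by move=> mh P; exact: (mh (fun t => P (g t))). Qed.

Lemma measurable_glue (R : realType) (T : countType) (h : X -> T) (g : T -> X -> R) :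
  dmeas h -> (forall t, measurable_fun setT (g t)) -> measurable_fun setT (fun x => g (h x) x).
Proof.
move=> mh mg _ Y mY; rewrite setTI.
apply: (@mp_ext (fun x => exists t, h x = t /\ Y (g t x))).
  by move=> x; split=> [[t [<-]]|]//; exists (h x).
apply: mp_exists => t; apply: mp_and; first exact: (mh (fun s => s = t)).
by rewrite /mp -[X in measurable X]setTI; exact: mg.
Qed.

Lemma measurable_dmeas (R : realType) (T : countType) (h : X -> T) (g : T -> R) :
  dmeas h -> measurable_fun setT (fun x => g (h x)).
Proof. by move=> mh; apply: (@measurable_glue _ _ _ (fun t=> cst (g t)) mh) => t; exact: measurable_cst. Qed.

Lemma measurable_pred (R : realType) P : mp P ->
  measurable_fun setT (fun x => (`[< P x >])%:R : R).
Proof.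
move=> mP; apply: (@measurable_dmeas _ _ (fun x => `[< P x >]) (fun b : bool => b%:R)).
apply: dmeas_fiber => -[].
  by apply: (@mp_ext P) => // x; split=> [/asboolT|/asboolW].
apply: (@mp_ext (fun x => ~ P x)); last exact: mp_not.
by move=> x; split=> [/asboolPn/negbTE|/negbT/asboolPn].
Qed.

Lemma dmeas_floor (R : realType) (f : X -> R) :
  measurable_fun setT f -> dmeas (fun x => Num.floor (f x)).
Proof.
move=> mf; apply: dmeas_fiber => z.
apply: (@mp_ext (fun x => z%:~R <= f x /\ f x < (z + 1)%:~R)).
  by move=> x; split=> [[h1 h2]|<-]; [apply: floor_def; rewrite h1|exact/andP/floor_itv].
by apply: mp_and; [apply: mp_le|apply: mp_lt] => //; exact: measurable_cst.
Qed.

End DiscreteMeasurability.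

(** * Measurable labellings of finite equivalence classes *)

Section FiniteClasses.
Context {d : measure_display} {X : measurableType d} {R : realType} {G : countZmodType}.
Variables (act : G -> X -> X) (f : X -> R) (E : G -> X -> Prop) (Y : X -> Prop).
Hypotheses (act0 : forall x, act 0 x = x)
  (actD : forall g h x, act (g + h) x = act g (act h x))
  (mact : forall g, measurable_fun setT (act g))
  (mf : measurable_fun setT f)
  (f_sep : forall g x, f (act g x) = f x -> g = 0)
  (mE : forall g, mp (E g))
  (E0 : forall x, E 0 x)
  (E_trans : forall g h x, E g x -> E h (act g x) -> E (h + g) x)
  (E_sym : forall g x, E g x -> E (- g) (act g x))
  (mY : mp Y) (Yact : forall g x, Y x -> Y (act g x))
  (E_fin : forall x, Y x -> exists s : seq G, forall g, E g x -> g \in s).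

Section Labels.
Context {L : countType} (l0 : L).

(** Measurable selection needs countably many candidates, but functions [G -> L] are uncountably
    many. On a finite class an association list, with default [l0], codes any labelling. *)
Definition decode_label (c : seq (G * L)) (g : G) : L :=
  head l0 [seq p.2 | p <- c & p.1 == g].

Lemma decode_labelE (s : seq G) (lam : G -> L) g :
  g \in s -> decode_label [seq (k, lam k) | k <- s] g = lam g.
Proof.
rewrite /decode_label; elim: s => //= k s IH; rewrite inE.
by case: (eqVneq k g) => [->//|kg] /= /IH.
Qed.

Variable P : X -> (G -> L) -> Prop.
Hypotheses (mP : forall c, mp (fun x => P x (decode_label c)))
  (P_local : forall x lam lam', (forall g, E g x -> lam g = lam' g) -> P x lam -> P x lam')
  (P_ex : forall x, Y x -> exists lam, P x lam).

(* Finite classes are labelled as seen from their [f]-minimal point. *)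
Lemma class_labelling : exists h : X -> L, dmeas h /\
  forall x, Y x -> exists v, E v x /\ P (act v x) (fun g => h (act (g + v) x)).
Proof.
(* [rep x] leads from [x] to the point of its class where [f] is minimal; finiteness gives
   existence, and [f_sep] uniqueness. *)
pose Q g x := Y x -> E g x /\ forall k, E k x -> f (act g x) <= f (act k x).
have [||rep [mrep repP]] := @dmeas_select _ _ _ Q.
- move=> g; apply: mp_imp => //; apply: mp_and => //; apply: mp_forall => k.
  by apply: mp_imp => //; apply: mp_le; apply: measurableT_comp.
- move=> x; have [Yx|nY] := pselect (Y x); last by exists 0.
  have [s hs] := E_fin Yx.
  have [g gs hg] : exists2 g, g \in [seq g <- s | `[< E g x >]] &
      forall k, k \in [seq g <- s | `[< E g x >]] -> f (act g x) <= f (act k x).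
    have : [seq g <- s | `[< E g x >]] != [::].
      have := E0 x => e0.
      have : 0 \in [seq g <- s | `[< E g x >]] by rewrite mem_filter (hs _ e0) andbT; apply/asboolP.
      by case: [seq _ <- _ | _].
    elim: [seq _ <- _ | _] => //= a t IH _.
    case: t IH => [|b t] IH; first by exists a; rewrite ?mem_head // => k; rewrite inE => /eqP->.
    have [//|g gt hg] := IH.
    case: (leP (f (act a x)) (f (act g x))) => ag.
      exists a; rewrite ?mem_head // => k; rewrite inE => /orP[/eqP->//|kt].
      exact: le_trans ag (hg _ kt).
    exists g; first by rewrite inE gt orbT.
    by move=> k; rewrite inE => /orP[/eqP->|/hg//]; exact: ltW.
  exists g => _; move: gs; rewrite mem_filter => /andP[/asboolP Eg _]; split=> // k Ek.
  by apply: hg; rewrite mem_filter (hs _ Ek) andbT; apply/asboolP.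
(* A code is selected at every point, but only the one at the representative of a class will be
   read. *)
have [||sel [msel selP]] := @dmeas_select _ _ _ (fun c x => Y x -> P x (decode_label c)).
- by move=> c; apply: mp_imp.
- move=> x; have [Yx|nY] := pselect (Y x); last by exists [::].
  have [s hs] := E_fin Yx; have [lam Plam] := P_ex Yx.
  exists [seq (k, lam k) | k <- s] => _; apply: P_local Plam => g /hs gs.
  by rewrite decode_labelE.
exists (fun x => decode_label (sel (act (rep x) x)) (- rep x)); split.
  apply: dmeas_fiber => l.
  apply: (@mp_ext _ _ (fun x => exists g, rep x = g /\ decode_label (sel (act g x)) (- g) = l)).
    by move=> x; split=> [[g [-> ->]]//|e]; exists (rep x).
  apply: mp_exists => g; apply: mp_and; first exact: (mrep (fun k => k = g)).
  exact: (@mp_comp _ _ (act g) (fun x => decode_label (sel x) (- g) = l) (mact g) (msel (fun c => decode_label c (- g) = l))).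
move=> x Yx; have [Ev vmin] := repP x Yx; set v := rep x in Ev vmin.
exists v; split=> //; set r := act v x.
have Yr : Y r by exact: Yact.
apply: P_local (selP r Yr) => g Eg.
rewrite actD -/r.
have [Ek kmin] := repP (act g r) (Yact g Yr); set k := rep _ in Ek kmin *.
have kg : act k (act g r) = act (k + g) r by rewrite actD.
(* The representative of [act g r] is [r] again: minimality from both sides gives equal values of
   [f], and [f_sep] concludes. *)
suff e : k + g = 0 by rewrite kg e act0 -(addr0_eq e).
apply: (@f_sep _ r); rewrite -kg.
apply/eqP; rewrite eq_le; apply/andP; split.
  by have := kmin _ (E_sym Eg); rewrite -(actD (- g)) addNr act0.
have := vmin (k + g + v); rewrite actD -/r actD; apply.
by rewrite -addrA; apply: E_trans => //; [exact: E_trans|rewrite actD].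
Qed.

End Labels.
End FiniteClasses.

(** * Markers and nested boxes *)

Section Cubes.
Variable d : nat.
Local Notation V := 'rV[int]_d.

Definition cube (a : int) (N : nat) : seq V :=
  [seq \row_i (a + (f i)%:Z) | f : {ffun 'I_d -> 'I_N}].

Lemma mem_cube a N (v : V) : (v \in cube a N) = [forall i, a <= v 0 i < a + N%:Z].
Proof.
apply/fintype.imageP/forallP => [[f _ ->] i|h]; first by rewrite mxE; move: (ltn_ord (f i)); move: (nat_of_ord (f i)) => k; lia.
have hi i : (absz (v 0 i - a)%R < N)%N by have := h i; move: (v 0 i) => k; lia.
exists [ffun i => Ordinal (hi i)] => //.
by apply/rowP => i; rewrite mxE ffunE /=; have := h i; move: (v 0 i) => k; lia.
Qed.

Lemma cubeP a N (v : V) : reflect (forall i, a <= v 0 i < a + N%:Z) (v \in cube a N).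
Proof. by rewrite mem_cube; apply: forallP. Qed.

Lemma row_ffun_inj a N :
  injective (fun f : {ffun 'I_d -> 'I_N} => \row_i (a + (f i)%:Z) : V).
Proof.
move=> f g /rowP h; apply/ffunP => i; apply/val_inj => /=.
by have := h i; rewrite !mxE => /addrI [].
Qed.

Lemma uniq_cube a N : uniq (cube a N).
Proof. by rewrite map_inj_in_uniq ?enum_uniq // => f g _ _; exact: row_ffun_inj. Qed.

Lemma size_cube a N : size (cube a N) = (N ^ d)%N.
Proof. by rewrite size_map -cardE card_ffun !card_ord. Qed.

Lemma card_ord_itv N (c : int) (a : nat) :
  (#|[pred t : 'I_N | (c <= (t : nat)%:Z < c + a%:Z)%R]| <= a)%N.
Proof.
case: a => [|a]; first by rewrite leqn0; apply/eqP/eq_card0 => t; rewrite !inE; move: (nat_of_ord t) => k; lia.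
pose g (t : 'I_N) : 'I_a.+1 := inord (absz (t%:Z - c)).
rewrite -(card_in_imset (f := g)); last first.
  move=> s t; rewrite !inE => hs ht /(congr1 val) /=; rewrite !inordK; last 2 first.
  - by move: hs; move: (nat_of_ord s) => k; lia.
  - by move: ht; move: (nat_of_ord t) => k; lia.
  move=> e; apply/val_inj => /=; move: hs ht e.
  by move: (nat_of_ord s) (nat_of_ord t) => k k'; lia.
by rewrite -[X in (_ <= X)%N](card_ord a.+1); exact: max_card.
Qed.

(** The order N^(d-1) of this bound makes the straddling positions of two boxes rare. *)
Lemma count_slab b N (c : int) (a : nat) (i : 'I_d) :
  (count (fun v : V => c <= v 0 i < c + a%:Z)%R (cube b N) <= a * N ^ d.-1)%N.
Proof.
rewrite count_map.
pose F (j : 'I_d) : {pred 'I_N} :=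
  if j == i then [pred t : 'I_N | (c - b <= (t : nat)%:Z < c - b + a%:Z)%R] else predT.
have -> : count (preim (fun f : {ffun 'I_d -> 'I_N} => \row_k (b + (f k)%:Z))
   (fun v => (c <= v 0 i < c + a%:Z)%R)) (enum {ffun 'I_d -> 'I_N}) =
   #|(family F : simpl_pred {ffun 'I_d -> 'I_N})|.
  rewrite cardE enumT -size_filter /enum_mem; congr size; apply: eq_filter => f /=.
  rewrite mxE; apply/idP/familyP => [h j|/(_ i)]; rewrite /F ?eqxx ?inE.
    case: eqP => [->|_]; rewrite ?inE //.
    by move: h; move: (nat_of_ord (f i)) => k; lia.
  by move: (nat_of_ord (f i)) => k; lia.
rewrite card_family foldrE big_map big_enum /= (bigD1 i) //= /F eqxx.
apply: leq_mul; first exact: card_ord_itv.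
rewrite (eq_bigr (fun=> N)) => [|j /negbTE ->]; last by rewrite eq_cardT // -cardE card_ord.
by rewrite prod_nat_const (cardC1 i) card_ord.
Qed.

End Cubes.

Lemma rat_between (R : realType) (x y : R) : x < y -> exists q : rat, x < ratr q < y.
Proof. by move=> /rat_in_itvoo[q]; rewrite in_itv => h; exists q. Qed.

(** Rational end points leave only countably many intervals, which then serve as colours in
    [marker_set]. *)
Lemma itv_separation (R : realType) (r : R) (s : seq R) : r \notin s ->
  exists q : rat * rat, ratr q.1 < r < ratr q.2 /\
    forall t, t \in s -> ~~ (ratr q.1 < t < ratr q.2).
Proof.
elim: s => [_|t s IH].
  have [|q1 /andP[_ h1]] := @rat_between R (r - 1) r; first by rewrite ltrBlDr ltrDl.
  have [|q2 /andP[h2 _]] := @rat_between R r (r + 1); first by rewrite ltrDl.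
  by exists (q1, q2); rewrite h1 h2.
rewrite inE negb_or => /andP[rt /IH[[q1 q2] /= [/andP[h1 h2] hs]]].
have shrink p1 p2 : ratr q1 <= ratr p1 :> R -> ratr p2 <= ratr q2 :> R ->
    forall u, u \in s -> ~~ (ratr p1 < u < ratr p2).
  move=> l1 l2 u /hs; apply: contra => /andP[u1 u2].
  by rewrite (le_lt_trans l1 u1) (lt_le_trans u2 l2).
case: (ltgtP r t) rt => // rt _.
  have [|p /andP[p1 p2]] := @rat_between R r (Num.min t (ratr q2)).
    by rewrite lt_min rt h2.
  move: p2; rewrite lt_min => /andP[pt p2].
  exists (q1, p); rewrite /= h1 p1; split=> // u; rewrite inE => /orP[/eqP->|us].
    by rewrite negb_and -leNgt -leNgt (ltW pt) orbT.
  by apply: shrink us => //; exact: ltW.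
have [|p /andP[p1 p2]] := @rat_between R (Num.max t (ratr q1)) r.
  by rewrite gt_max rt h1.
move: p1; rewrite gt_max => /andP[pt p1].
exists (p, q2); rewrite /= h2 p2; split=> // u; rewrite inE => /orP[/eqP->|us].
  by rewrite negb_and -leNgt (ltW pt).
by apply: shrink us => //; exact: ltW.
Qed.

Section Markers.
Context {d : measure_display} {X : measurableType d} {R : realType} {G : countZmodType}.
Variables (act : G -> X -> X) (f : X -> R).
Hypotheses (act0 : forall x, act 0 x = x)
  (actD : forall g h x, act (g + h) x = act g (act h x))
  (mact : forall g, measurable_fun setT (act g))
  (mf : measurable_fun setT f)
  (f_sep : forall g x, f (act g x) = f x -> g = 0).

(** [S] is a maximal [W]-independent set. A rational interval containing [f x] and missing [f] at
    the [W]-neighbours of [x] gives a proper colouring with countably many colours; the greedy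
    algorithm then treats the colours one after the other. *)
Lemma marker_set (W : seq G) : (forall g, g \in W -> - g \in W) ->
  exists S : X -> Prop, [/\ mp S,
    forall x g, g \in W -> g <> 0 -> S x -> ~ S (act g x) &
    forall x, S x \/ exists g, [/\ g \in W, g <> 0 & S (act g x)]].
Proof.
move=> WN.
pose I (q : rat * rat) y := ratr q.1 < f y < ratr q.2.
have mI q : mp (fun x => I q x).
  apply: (@mp_ext _ _ (fun x => ratr q.1 < f x /\ f x < ratr q.2)).
    by move=> x; split=> [[h1 h2]|/andP//]; apply/andP.
  by apply: mp_and; apply: mp_lt => //; exact: measurable_cst.
have [||c [mc cP]] := @dmeas_select _ _ _
    (fun q x => I q x /\ forall g, g \in W -> g <> 0 -> ~ I q (act g x)).
- move=> q; apply: mp_and => //; apply: mp_forall => g.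
  apply: mp_imp; first exact: mp_cst.
  apply: mp_imp; first exact: mp_cst.
  by apply: mp_not; apply: (mp_comp (mact g) (mI q)).
- move=> x; have [|q [qx qs]] := @itv_separation R (f x) [seq f (act g x) | g <- W & g != 0].
    apply/mapP => -[g]; rewrite mem_filter => /andP[g0 _] e.
    by move/eqP: g0; apply; apply: (@f_sep _ x).
  exists q; split=> // g gW /eqP g0 hI.
  have := qs (f (act g x)); rewrite (map_f (fun g => f (act g x))) ?mem_filter ?g0 // => /(_ isT).
  by rewrite -/(I q (act g x)) hI.
pose col x := choice.pickle (c x).
have mcol : dmeas col by apply: dmeas_comp.
have colN x g : g \in W -> g <> 0 -> col (act g x) <> col x.
  move=> gW g0 /(pcan_inj choice.pickleK) e.
  by have [_ /(_ g gW g0)] := cP x; apply; rewrite -e; case: (cP (act g x)).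
clearbody col.
(* [St n] is the greedy set after the colours below [n]: a point joins at its own colour unless a
   neighbour has joined before. *)
pose fix St (n : nat) (x : X) {struct n} : Prop := if n is n'.+1 then
  St n' x \/ (col x = n' /\ forall g, g \in W -> g <> 0 -> ~ St n' (act g x)) else False.
have mSt n : mp (St n).
  elim: n => [|n IH]; first exact: mp_cst.
  apply: mp_or => //; apply: mp_and; first exact: (mcol (fun k => k = n)).
  apply: mp_forall => g; do 2 (apply: mp_imp; first exact: mp_cst).
  by apply: mp_not; exact: (mp_comp (mact g) IH).
have St_mono n m x : (n <= m)%N -> St n x -> St m x.
  move=> nm; rewrite -(subnK nm); elim: (m - n)%N => //= k IH h.
  by left; exact: IH.
have StP n x : St n x -> (col x < n)%N /\
    forall g, g \in W -> g <> 0 -> ~ St (col x) (act g x).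
  elim: n => //= n IH [/IH[h1 h2]|[e h]]; first by split=> //; exact: leqW.
  by rewrite e; split=> //; exact: leqnn.
have Stc n x : St n x -> St (col x).+1 x.
  by move=> /StP[_ h] /=; right.
exists (fun x => exists n, St n x); split.
- exact: mp_exists.
- move=> x g gW g0 [n Sx] [m Sg].
  have Nx : act (- g) (act g x) = x by rewrite -actD addNr act0.
  have N0 : - g <> 0 by move/eqP; rewrite oppr_eq0 => /eqP.
  have [_ hx] := StP _ _ Sx; have [_ hg] := StP _ _ Sg.
  (* Of two selected neighbours the one with the larger colour would have been refused, and equal
     colours are excluded. *)
  case: (ltngtP (col x) (col (act g x))) => cc.
  + apply: (hg (- g)) => //; first exact: WN.
    by rewrite Nx; apply: St_mono cc _; exact: Stc Sx.
  + by apply: (hx g) => //; apply: St_mono cc _; exact: Stc Sg.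
  + by case: (colN x g).
- move=> x; have [|h] := pselect (exists g, [/\ g \in W, g <> 0 & exists n, St n (act g x)]).
    by right.
  left; exists (col x).+1 => /=; right; split=> // g gW g0 Sg.
  by apply: h; exists g; split=> //; exists (col x).
Qed.

End Markers.

(** * Probability estimates for a measure-preserving action *)

Section Prob.
Context {d : measure_display} {X : measurableType d} {R : realType}.
Variable mu : probability X R.
Implicit Types P Q : X -> Prop.

Definition pr P : R := fine (mu [set x | P x]).

Lemma prE P : mp P -> mu [set x | P x] = (pr P)%:E.
Proof. by move=> mP; rewrite /pr fineK // fin_num_measure. Qed.

Lemma pr_ge0 P : 0 <= pr P.
Proof. by rewrite fine_ge0. Qed.

Lemma pr_ext P Q : (forall x, P x <-> Q x) -> pr P = pr Q.
Proof. by move=> h; rewrite /pr (_ : [set x | P x] = [set x | Q x]) //; apply/seteqP; split=> x /h. Qed.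

Lemma pr_le P Q : mp P -> mp Q -> (forall x, P x -> Q x) -> pr P <= pr Q.
Proof. by move=> mP mQ h; rewrite -lee_fin -!prE //; apply: le_measure => //; apply/mem_set. Qed.

Lemma pr_or P Q : mp P -> mp Q -> pr (fun x => P x \/ Q x) <= pr P + pr Q.
Proof.
move=> mP mQ; rewrite -lee_fin EFinD -!prE //; last exact: mp_or.
exact: measureU2.
Qed.

Lemma pr_disj P Q : mp P -> mp Q -> (forall x, P x -> ~ Q x) ->
  pr (fun x => P x \/ Q x) = pr P + pr Q.
Proof.
move=> mP mQ h; apply/EFin_inj; rewrite EFinD -!prE //; last exact: mp_or.
apply: measureU => //.
by apply/seteqP; split=> // x [/h].
Qed.

Lemma pr_false P : (forall x, ~ P x) -> pr P = 0.
Proof.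
move=> h; rewrite /pr (_ : [set x | P x] = set0) ?measure0 //.
by apply/seteqP; split=> // x /h.
Qed.

Lemma pr_split P Q : mp P -> mp Q -> pr P = pr (fun x => P x /\ Q x) + pr (fun x => P x /\ ~ Q x).
Proof.
move=> mP mQ; rewrite -pr_disj.
- by apply: pr_ext => x; split=> [Px|[[]|[]]//]; have [|] := pselect (Q x); [left|right].
- exact: mp_and.
- by apply: mp_and => //; exact: mp_not.
- by move=> x [_ Qx] [_].
Qed.

(** Continuity of the measure along increasing finite unions. *)
Lemma pr_exists_le (P : nat -> X -> Prop) (b : R) : (forall n, mp (P n)) ->
  (forall n, pr (fun x => exists2 k, (k < n)%N & P k x) <= b) -> pr (fun x => exists n, P n x) <= b.
Proof.
move=> mP h; rewrite -lee_fin -prE; last exact: mp_exists.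
pose F n := [set x | exists2 k, (k < n)%N & P k x].
have mF n : mp (fun x => exists2 k, (k < n)%N & P k x).
  apply: (@mp_ext _ _ (fun x => exists k, (k < n)%N /\ P k x)).
    by move=> x; split=> [[k [? ?]]|[k]]; exists k.
  by apply: mp_exists => k; apply: mp_and => //; exact: mp_cst.
have -> : [set x | exists n, P n x] = \bigcup_n F n.
  apply/seteqP; split=> [x [n Pn]|x [n _ [k _ ?]]]; last by exists k.
  by exists n.+1 => //; exists n.
have cv : (mu \o F) x @[x --> \oo] --> mu (\bigcup_n F n).
  apply: nondecreasing_cvg_mu => [n||n m nm]; first exact: mF.
    by apply: bigcup_measurable => n _; exact: mF.
  by apply/subsetPset => x [k kn Pk]; exists k => //; exact: leq_trans kn nm.
rewrite -(cvg_lim _ cv) //; apply: lime_le; first by apply/cvg_ex; eexists; exact: cv.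
by apply: nearW => n /=; rewrite prE // lee_fin.
Qed.

Lemma pr_forall_ge (P : nat -> X -> Prop) (b : R) : (forall n, mp (P n)) ->
  (forall n m x, (n <= m)%N -> P m x -> P n x) ->
  (forall n, b <= pr (P n)) -> b <= pr (fun x => forall n, P n x).
Proof.
move=> mP Pmono h; rewrite -lee_fin -prE; last exact: mp_forall.
have -> : [set x | forall n, P n x] = \bigcap_n [set x | P n x].
  by apply/seteqP; split=> [x h' n _|x h' n]; [exact: h'|exact: (h' n I)].
have cv : (mu \o (fun n => [set x | P n x])) x @[x --> \oo] --> mu (\bigcap_n [set x | P n x]).
  apply: nonincreasing_cvg_mu => [|n||n m nm]; first by rewrite /= prE // ltry.
  - exact: mP.
  - by apply: bigcapT_measurable => n; exact: mP.
  - by apply/subsetPset => x; apply: Pmono.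
rewrite -(cvg_lim _ cv) //; apply: lime_ge; first by apply/cvg_ex; eexists; exact: cv.
by apply: nearW => n /=; rewrite prE // lee_fin.
Qed.

Context {G : countZmodType}.
Variable act : G -> X -> X.
Hypotheses (mact : forall g, measurable_fun setT (act g))
  (pact : forall g (B : set X), measurable B -> mu (act g @^-1` B) = mu B).

Lemma mp_act g P : mp P -> mp (fun x => P (act g x)).
Proof. exact: mp_comp. Qed.

Lemma pr_act g P : mp P -> pr (fun x => P (act g x)) = pr P.
Proof. by move=> mP; rewrite /pr -(pact g mP). Qed.

Lemma mp_seq_act (s : seq G) P : mp P -> mp (fun x => exists2 g, g \in s & P (act g x)).
Proof.
move=> mP; apply: (@mp_ext _ _ (fun x => exists g, g \in s /\ P (act g x))).
  by move=> x; split=> [[g [? ?]]|[g]]; exists g.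
by apply: mp_exists => g; apply: mp_and; [exact: mp_cst|exact: mp_act].
Qed.

Let ex_cons g (s : seq G) P x : (exists2 h, h \in g :: s & P (act h x)) <->
  P (act g x) \/ exists2 h, h \in s & P (act h x).
Proof.
split=> [[h]|[Pg|[h hs Ph]]].
- by rewrite inE => /orP[/eqP->|hs] Ph; [left|right; exists h].
- by exists g; rewrite ?mem_head.
- by exists h; rewrite // inE hs orbT.
Qed.

(** Union bound. It bounds from below the density of a set whose translates cover, as [pr_seq_eq]
    bounds from above the density of a set whose translates are disjoint. *)
Lemma pr_seq_le (s : seq G) P : mp P ->
  pr (fun x => exists2 g, g \in s & P (act g x)) <= (size s)%:R * pr P.
Proof.
move=> mP; elim: s => [|g s IH]; first by rewrite mul0r pr_false // => x [].
rewrite (pr_ext (ex_cons g s P)) /= mulrS mulrDl mul1r.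
apply: le_trans (pr_or (mp_act g mP) (mp_seq_act s mP)) _.
by rewrite pr_act // lerD2l.
Qed.

Lemma pr_seq_eq (s : seq G) P : mp P -> uniq s ->
  (forall x g h, g \in s -> h \in s -> P (act g x) -> P (act h x) -> g = h) ->
  pr (fun x => exists2 g, g \in s & P (act g x)) = (size s)%:R * pr P.
Proof.
move=> mP; elim: s => [|g s IH]; first by rewrite mul0r pr_false // => x [].
rewrite cons_uniq => /andP[gs us] dj.
rewrite (pr_ext (ex_cons g s P)) /= mulrS mulrDl mul1r pr_disj //.
- rewrite pr_act // IH // => x h k hs ks; apply: dj; by rewrite inE ?hs ?ks orbT.
- exact: mp_act.
- exact: mp_seq_act.
- move=> x Pg [h hs Ph]; move/negP: gs; apply.
  by rewrite (dj x g h) ?mem_head // inE hs orbT.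
Qed.

End Prob.

(** * Nested boxes covering almost every orbit *)

Section ToastStructure.
Context {dX : measure_display} {X : measurableType dX} {R : realType} {d : nat}.
Local Notation V := 'rV[int]_d.
Variables (mu : probability X R) (act : V -> X -> X) (f : X -> R).
Hypotheses (act0 : forall x, act 0 x = x)
  (actD : forall g h x, act (g + h) x = act g (act h x))
  (mact : forall g, measurable_fun setT (act g))
  (pact : forall g (B : set X), measurable B -> mu (act g @^-1` B) = mu B)
  (mf : measurable_fun setT f)
  (f_sep : forall g x, f (act g x) = f x -> g = 0).
Variables (D m0 : nat).

(** The power [(2 * (a + 2 * D)).+1 ^ d] is the number of points of the window of a box of side [a],
    hence an inverse lower density of its markers. The factor after it bounds, up to
    [side k ^ d.-1], the number of positions where such a box straddles one of side [side k]. *)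
Let Phi (a : nat) : nat :=
  ((2 * (a + 2 * D)).+1 ^ d * (4 * d * 2 ^ d * (a + 3 * D)) + a + 4 * D + 4)%N.

(** The powers of two make the proportions of markers lost to higher levels summable, with sum at
    most one half. *)
Fixpoint side (k : nat) : nat :=
  if k is k'.+1 then (Phi (side k') * 2 ^ k'.+2)%N else (m0 + 4 * D + 4)%N.

Let Phi_mono a b : (a <= b)%N -> (Phi a <= Phi b)%N.
Proof.
move=> ab; rewrite /Phi; do 2 (apply: leq_add => //); apply: leq_add => //.
apply: leq_mul; last by rewrite leq_mul2l leq_add2r ab orbT.
by case: (posnP d) => [->//|d0]; rewrite leq_exp2r // ltnS leq_mul2l leq_add2r ab orbT.
Qed.

Let side_step k : (Phi (side k) * 2 ^ k.+2 = side k.+1)%N.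
Proof. by []. Qed.

Lemma side_ge k : (m0 + 4 * D + 4 * k + 4 <= side k)%N.
Proof.
elim: k => [|k IH]; first by rewrite muln0 addn0.
rewrite -side_step; apply: leq_trans (leq_pmulr _ (expn_gt0 2 _)).
by rewrite /Phi; move: IH; lia.
Qed.

Let side_mono j k : (j <= k)%N -> (side j <= side k)%N.
Proof.
move=> jk; rewrite -(subnK jk); elim: (k - j)%N => // i IH.
apply: leq_trans IH _; rewrite addSn -side_step; apply: leq_trans (leq_pmulr _ (expn_gt0 2 _)).
by rewrite /Phi; lia.
Qed.

Let side_grow j k : (j < k)%N -> (Phi (side j) * 2 ^ k.+1 <= side k)%N.
Proof.
case: k => // k jk; rewrite -side_step leq_mul2r; apply/orP; right.
exact/Phi_mono/side_mono.
Qed.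

Let rad k : nat := (side k + 2 * D)%N.
(** Markers outside each other's window carry boxes whose fattenings by [D] are disjoint. *)
Let win k : seq V := cube d (- (rad k)%:Z) (2 * rad k).+1.

Let win_opp k v : v \in win k -> - v \in win k.
Proof. by move=> /cubeP h; apply/cubeP => i; rewrite mxE; have := h i; move: (v 0 i) => z; lia. Qed.

Let win0 k : 0 \in win k.
Proof. by apply/cubeP => i; rewrite mxE; lia. Qed.

(* A box of side [side j] at the origin straddles the box of side [side k] at
   [v] when, fattened by [D], it neither lies inside it nor avoids its fattening. *)
Let straddles j k (v : V) : bool :=
  [exists i, (- D%:Z < v 0 i) || (v 0 i < (side j + D)%N%:Z - (side k)%:Z)].
Let strad j k : seq V :=
  [seq v <- cube d (- (side k + 2 * D)%N%:Z) (side k + side j + 4 * D) | straddles j k v].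

(** In some coordinate a straddling position lies in one of two slabs of width [side j + 3 * D], and
    the cube of all positions has side at most [2 * side k]. *)
Let size_strad j k : (j < k)%N ->
  ((2 * rad j).+1 ^ d * size (strad j k) * 2 ^ k.+1 <= side k ^ d)%N.
Proof.
move=> jk; rewrite size_filter.
set N := (side k + side j + 4 * D)%N; set C := cube _ _ _.
have jkD : (side j + 4 * D <= side k)%N.
  have := side_grow jk; apply: leq_trans; apply: leq_trans (leq_pmulr _ (expn_gt0 2 _)).
  by rewrite /Phi; lia.
have : (count (straddles j k) C <= \sum_(i < d)
   (count (fun v : V => - D%:Z <= v 0 i < - D%:Z + (side j + 3 * D)%N%:Z)%R C +
    count (fun v : V => - (side k + 2 * D)%N%:Z <= v 0 i <
      - (side k + 2 * D)%N%:Z + (side j + 3 * D)%N%:Z)%R C))%N.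
  rewrite -sum1_count.
  under [leqRHS]eq_bigr => i _ do rewrite -!sum1_count big_mkcond [X in (_ + X)%N]big_mkcond -big_split /=.
  rewrite exchange_big /= big_mkcond /= big_seq [leqRHS]big_seq; apply: leq_sum => v /cubeP vC.
  case: ifP => // /existsP[i hi]; rewrite (bigD1 i) //=; apply: leq_trans (leq_addr _ _).
  have := vC i; move: hi; move: (v 0 i) => z hi hz; rewrite /N in hz.
  by do 2 case: ifP; lia.
move=> h; have {}h : (count (straddles j k) C <= d * (2 * ((side j + 3 * D) * N ^ d.-1)))%N.
  apply: leq_trans h _; rewrite -[X in (_ <= X * _)%N]card_ord -sum_nat_const.
  by apply: leq_sum => i _; rewrite (mul2n (_ * N ^ _)) -addnn; apply: leq_add; exact: count_slab.
case: (posnP d) => [d0|d0]; first by move: h; move: (count _ _) => c; rewrite d0 mul0n leqn0 => /eqP ->; rewrite muln0.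
have hN : (N ^ d.-1 <= (2 * side k) ^ d.-1)%N.
  case: (posnP d.-1) => [->//|d1]; rewrite leq_exp2r // /N; lia.
have hP : ((2 * rad j).+1 ^ d * (4 * d * 2 ^ d * (side j + 3 * D)) * 2 ^ k.+1 <= side k)%N.
  have := side_grow jk; apply: leq_trans; rewrite leq_mul2r; apply/orP; right.
  by rewrite /Phi /rad; lia.
rewrite -[in leqRHS](prednK d0) (expnS (side k)).
apply: leq_trans (leq_mul hP (leqnn (side k ^ d.-1))).
move: h hN; rewrite expnMn.
have -> : (2 ^ d = 2 * 2 ^ d.-1)%N by rewrite -expnS prednK.
move: ((2 * rad j).+1 ^ d)%N (side j + 3 * D)%N (2 ^ k.+1)%N (count _ _) (N ^ d.-1)%N (2 ^ d.-1)%N (side k ^ d.-1)%N.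
move=> a b c e g p q h1 h2.
have h3 : (e <= d * (2 * (b * (p * q))))%N.
  by apply: leq_trans h1 _; rewrite !leq_mul2l h2 !orbT.
apply: (@leq_trans (a * (d * (2 * (b * (p * q)))) * c)%N).
  by rewrite leq_mul2r leq_mul2l h3 !orbT.
by nia.
Qed.

Let markers : exists S : nat -> X -> Prop, forall k, [/\ mp (S k),
    forall x v, v \in win k -> v <> 0 -> S k x -> ~ S k (act v x) &
    forall x, exists2 v, v \in win k & S k (act v x)].
Proof.
have h k := marker_set act0 actD mact mf f_sep (@win_opp k).
exists (fun k => sval (cid (h k))) => k.
case: (cid _) => S /= [mS sepS maxS]; split=> // x.
case: (maxS x) => [Sx|[v [vW _ Sv]]]; last by exists v.
by exists 0; rewrite ?act0.
Qed.

(* Boxes are the sets [act u z], [0 <= u < side k], based at points [z] of [U k].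
   Any two of them are nested or disjoint, with margin [D] in both cases. *)
Lemma toast : exists (U : nat -> X -> Prop) (Y : X -> Prop),
  [/\ forall k, mp (U k),
      forall j k x v, (j <= k)%N -> U j x -> U k (act v x) ->
        [\/ j = k /\ v = 0,
            (j < k)%N /\ forall i, v 0 i <= - D%:Z /\ (side j + D)%N%:Z <= v 0 i + (side k)%:Z |
            exists i, (side j + D)%N%:Z <= v 0 i - D%:Z \/ v 0 i + (side k + D)%N%:Z <= - D%:Z],
      mp Y /\ (forall g x, Y x -> Y (act g x)),
      mu [set x | ~ Y x] = 0 &
      forall x, Y x -> exists k u, U k (act (- u) x) /\ u \in cube d 0 (side k)].
Proof.
have [S hS] := markers.
have mS k : mp (S k) by have [] := hS k.
have mSv k v : mp (fun x => S k (act v x)) by exact: (mp_comp (mact v) (mS k)).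
have Ssep k x v : S k x -> S k (act v x) -> v = 0 \/
    exists i, (rad k)%:Z < v 0 i \/ v 0 i < - (rad k)%:Z.
  move=> Sx Sv; have [|v0] := eqVneq v 0; [by left|right].
  apply: contrapT => h; have [_ /(_ x v) hs _] := hS k; case: hs => //; last exact/eqP.
  apply/cubeP => i; have := h; rewrite -forallNE => /(_ i)/not_orP[].
  by move: (v 0 i) => z; lia.
(* A marker is deleted when its box straddles the box of any higher marker, whether or not the
   latter survives. This avoids a recursion through infinitely many levels. *)
pose U k x := S k x /\ forall k' : nat, (k < k')%N -> forall v, v \in strad k k' -> ~ S k' (act v x).
have mU k : mp (U k).
  apply: mp_and => //; apply: mp_forall => k'; apply: mp_imp; first exact: mp_cst.
  apply: mp_forall => v; apply: mp_imp; first exact: mp_cst.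
  exact: mp_not.
(* Lying in some box is not preserved by the action; lying in boxes at arbitrary depth is, because a
   translation costs only a bounded amount of depth. *)
pose deep x := forall r : nat, exists k, exists u : V, U k (act (- u) x) /\
  forall i, r%:Z <= u 0 i < (side k)%:Z - r%:Z.
have mdeep : mp deep.
  apply: mp_forall => r; apply: mp_exists => k; apply: mp_exists => u; apply: mp_and.
    exact: (mp_comp (mact (- u)) (mU k)).
  exact: mp_cst.
have deep_act g x : deep x -> deep (act g x).
  move=> hx r.
  have [N hN] : exists N : nat, forall i, (absz (g 0%R i) <= N)%N.
    exists (\max_(i < d) absz (g 0%R i))%N => i; exact: (@leq_bigmax _ (fun i => absz (g 0 i))).
  have [k [u [Uu hu]]] := hx (r + N)%N; exists k, (u + g); split.
    by rewrite opprD actD -(actD (- g)) addNr act0.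
  move=> i; rewrite mxE; have := hu i; have := hN i.
  by move: (u 0 i) (g 0 i) => a b; lia.
exists U, deep; split=> //.
- move=> j k x v jk [Sx hx] [Sv hv].
  move: jk; rewrite leq_eqVlt => /orP[/eqP jk|jk].
    subst k; have [->|[i hi]] := Ssep _ _ _ Sx Sv; first by apply: Or31.
    apply: Or33; exists i; move: hi; rewrite /rad; move: (v 0 i) => z; lia.
  have := hx k jk v; rewrite mem_filter => h.
  have {h}/negP : ~ (straddles j k v && (v \in cube d (- (side k + 2 * D)%N%:Z) (side k + side j + 4 * D))).
    by move=> /h; apply.
  rewrite negb_and => /orP[/existsPn h|/cubeP h].
    apply: Or32; split=> // i; have := h i; move: (v 0 i) => z; lia.
  apply: Or33; apply: contrapT => h'; apply: h => i.
  have := h'; rewrite -forallNE => /(_ i)/not_orP[].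
  by move: (v 0 i) => z; lia.
(* The density estimates are made inside the invariant set [Y] of bad points itself: surviving boxes
   capture a fixed proportion of it at unbounded depth, so it must be null. *)
- pose Y x := ~ deep x.
  have mY : mp Y by exact: mp_not.
  have Y_act g x : Y (act g x) <-> Y x.
    split=> h hd; apply: h; first exact: deep_act.
    by have := deep_act (- g) _ hd; rewrite -actD addNr act0.
  have mSY k : mp (fun x => S k x /\ Y x) by exact: mp_and.
  pose p := pr mu Y.
  have side0 k : (0 < side k)%N by have := side_ge k; lia.
  have up k : (side k ^ d)%:R * pr mu (fun x => S k x /\ Y x) <= p.
    rewrite -(size_cube d 0) -(pr_seq_eq mact pact (mSY k)) ?uniq_cube //; last first.
    - move=> x g h /cubeP hg /cubeP hh [Sg _] [Sh _].
      have e : act h x = act (h - g) (act g x) by rewrite -actD subrK.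
      move: Sh; rewrite e => /(Ssep _ _ _ Sg)[/eqP|[i]].
        by rewrite subr_eq0 => /eqP.
      rewrite !mxE; have := hg i; have := hh i; rewrite /rad.
      by move: (h 0 i) (g 0 i) => a b; lia.
    apply: pr_le => //; first by exact: (mp_seq_act mact _ (mSY k)).
    by move=> x [g _ [_]] /Y_act.
  have lo k : p <= ((2 * rad k).+1 ^ d)%:R * pr mu (fun x => S k x /\ Y x).
    rewrite -(size_cube d (- (rad k)%:Z)); apply: le_trans (pr_seq_le mact pact _ (mSY k)).
    apply: pr_le => //; first by exact: (mp_seq_act mact _ (mSY k)).
    move=> x Yx; have [_ _ /(_ x)[v vW Sv]] := hS k.
    by exists v => //; split=> //; apply/Y_act.
  (* The lower bound [lo] gives density [p / a] of markers. Level [k + i.+1] deletes at most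
     [p / a * (2^-1) ^+ i.+2], and these losses sum to half of it. *)
  have U_ge k : p / 2 <= ((2 * rad k).+1 ^ d)%:R * pr mu (fun x => U k x /\ Y x).
    set a : R := ((2 * rad k).+1 ^ d)%:R.
    have a0 : 0 < a by rewrite ltr0n expn_gt0.
    pose B i x := (exists2 v, v \in strad k (k + i.+1)%N & S (k + i.+1)%N (act v x) /\ Y (act v x)).
    have mB i : mp (B i) by exact: (mp_seq_act mact _ (mSY _)).
    have p0 : 0 <= p by exact: pr_ge0.
    have B_le i : pr mu (B i) <= p / a * (2^-1) ^+ i.+2.
      have sz : ((2 * rad k).+1 ^ d * size (strad k (k + i.+1)) * 2 ^ i.+2 <= side (k + i.+1) ^ d)%N.
        have := @size_strad k (k + i.+1)%N; rewrite -addSnnS leq_addr => /(_ isT).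
        by apply: leq_trans; rewrite leq_mul2l leq_exp2l //; apply/orP; right; lia.
      apply: le_trans (pr_seq_le mact pact _ (mSY _)) _.
      rewrite exprVn -(mulrA p) -invfM.
      have := up (k + i.+1)%N; move: sz; rewrite -(ler_nat R) 2!natrM [(2 ^ i.+2)%:R]natrX -/a.
      have h2 : 0 < (2 : R) ^+ i.+2 by rewrite exprn_gt0.
      rewrite ler_pdivlMr; last exact: mulr_gt0.
      have := pr_ge0 mu (fun x => S (k + i.+1)%N x /\ Y x).
      move: (pr _ _) ((side _ ^ d)%:R) (2 ^+ _) h2 ((size _)%:R) => q c e e0 s q0 h1 h3.
      apply: le_trans h3; apply: le_trans (ler_wpM2r q0 h1).
      by rewrite le_eqVlt; apply/orP; left; apply/eqP; ring.
    have Bn n : pr mu (fun x => exists2 i, (i < n)%N & B i x) <= p / a * (2^-1 - (2^-1) ^+ n.+1).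
      elim: n => [|n IH]; first by rewrite expr1 subrr mulr0 pr_false // => x [].
      have mBn : mp (fun x => exists2 i, (i < n)%N & B i x).
        apply: (@mp_ext _ _ (fun x => exists i, (i < n)%N /\ B i x)).
          by move=> x; split=> [[i1 [? ?]]|[i2 ? ?]]; [exists i1|exists i2].
        by apply: mp_exists => i3; apply: mp_and => //; exact: mp_cst.
      rewrite (@pr_ext _ _ _ _ _ (fun x => (exists2 i, (i < n)%N & B i x) \/ B n x)); last first.
        move=> x; split=> [[i1]|[[i1 lin Bi]|Bn]].
        - by rewrite ltnS leq_eqVlt => /orP[/eqP->|lin] Bi; [right|left; exists i1].
        - by exists i1 => //; exact: leqW.
        - by exists n.
      apply: le_trans (pr_or mu mBn (mB n)) _.
      apply: le_trans (lerD IH (B_le n)) _.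
      rewrite -mulrDr ler_wpM2l ?divr_ge0 ?(ltW a0) // !exprS.
      by rewrite le_eqVlt; apply/orP; left; apply/eqP; field.
    have BE : pr mu (fun x => exists i, B i x) <= p / a / 2.
      apply: pr_exists_le => // n; apply: le_trans (Bn n) _.
      by rewrite ler_wpM2l ?divr_ge0 ?(ltW a0) // gerBl exprn_ge0 // invr_ge0.
    have := lo k; rewrite -/a (pr_split mu (mSY k) (mU k)) => h.
    have e1 : pr mu (fun x => (S k x /\ Y x) /\ U k x) = pr mu (fun x => U k x /\ Y x).
      apply: pr_ext => x; split=> [[[_ ?] ?]|[Ux ?]]; first by split.
      by split=> //; split=> //; case: Ux.
    have e2 : pr mu (fun x => (S k x /\ Y x) /\ ~ U k x) <= p / a / 2.
      apply: le_trans BE; apply: pr_le.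
      - by apply: mp_and => //; exact: mp_not.
      - exact: mp_exists.
      move=> x [[Sx Yx] nU]; apply: contrapT => nB; apply: nU; split=> // k' kk' v vs Sv.
      apply: nB; exists (k' - k).-1; have ek : (k + (k' - k).-1.+1 = k')%N by lia.
      by exists v; rewrite ek //; split=> //; apply/Y_act.
    rewrite e1 in h; move: h e2; rewrite mulrDr.
    move: (pr _ _) (pr _ _) => w u h e2.
    have : a * w <= p / 2.
      apply: le_trans (ler_wpM2l (ltW a0) e2) _.
      by rewrite le_eqVlt; apply/orP; left; apply/eqP; field; rewrite gt_eqF.
    by lra.
  (* The part of [Y] at depth [k] in a surviving box of level [k]. By [side_ge] the core of the box
     keeps at least the fraction [8 ^- d] of the volume of the window. *)
  pose C k x := exists2 g, g \in [seq - u | u <- cube d k%:Z (side k - 2 * k)] &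
    U k (act g x) /\ Y (act g x).
  have mUY k : mp (fun x => U k x /\ Y x) by exact: mp_and.
  have mC k : mp (C k) by exact: (mp_seq_act mact _ (mUY k)).
  have C_ge k : p / 2 / 8 ^+ d <= pr mu (C k).
    rewrite (pr_seq_eq mact pact (mUY k)); last 2 first.
    - by rewrite map_inj_uniq ?uniq_cube //; exact: oppr_inj.
    - move=> x g h /mapP[u /cubeP hu ->] /mapP[w /cubeP hw ->] [[Su _] _] [[Sw _] _].
      have e : act (- w) x = act (u - w) (act (- u) x) by rewrite -actD addrC addKr.
      move: Sw; rewrite e => /(Ssep _ _ _ Su)[/eqP|[i]].
        by rewrite subr_eq0 => /eqP ->.
      rewrite !mxE; have := hu i; have := hw i; rewrite /rad.
      by move: (u 0 i) (w 0 i) => a b; lia.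
    rewrite size_map size_cube.
    have hs : ((2 * rad k).+1 <= 8 * (side k - 2 * k))%N by have := side_ge k; rewrite /rad; lia.
    rewrite ler_pdivrMr ?exprn_gt0 //; apply: le_trans (U_ge k) _.
    have hd : ((2 * rad k).+1 ^ d <= (side k - 2 * k) ^ d * 8 ^ d)%N.
      rewrite -expnMn (mulnC _ 8); move: hs; move: (2 * rad k).+1 (8 * _)%N => a b ab.
      by elim: (d) => // e IH; rewrite !expnS leq_mul.
    by rewrite mulrAC ler_wpM2r ?pr_ge0 // -natrX -natrM ler_nat.
  (* Reverse Fatou: the sets [C k] have probability bounded below, so with at least this probability
     infinitely many of them occur; but a point of infinitely many [C k] is deep. *)
  have : p / 2 / 8 ^+ d <= pr mu (fun x => forall K, exists k, (K <= k)%N /\ C k x).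
    apply: pr_forall_ge => [K|n m x nm [k [mk Ck]]|K].
    - by apply: mp_exists => k; apply: mp_and => //; exact: mp_cst.
    - by exists k; split=> //; exact: leq_trans mk.
    - apply: le_trans (C_ge K) _; apply: pr_le => //; last by move=> x Cx; exists K.
      by apply: mp_exists => k; apply: mp_and => //; exact: mp_cst.
  rewrite pr_false; last first.
    move=> x hx; have [k [_ [g _ [_ /Y_act Yx]]]] := hx 0%N; apply: Yx => r.
    have [k' [rk [g' /mapP[u /cubeP hu ->] [Uu _]]]] := hx r.
    exists k', u; split=> // i; have := hu i; move: (u 0 i) => z.
    by move: (side_ge k'); lia.
  rewrite -mulrA pmulr_lle0; last by rewrite mulr_gt0 // invr_gt0 // exprn_gt0.
  move=> p0; have {}p0 : p = 0 by apply/eqP; rewrite eq_le p0 pr_ge0.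
  by rewrite [LHS](prE mu mY) -/p p0.
- move=> x /(_ 0%N)[k [u [Uu hu]]]; exists k, u; split=> //.
  by apply/cubeP => i; have := hu i; move: (u 0 i) => z; lia.
Qed.
End ToastStructure.

(** * Tilings of the box classes *)

Lemma interval_partition (m : nat) (a b : int) : (0 < m)%N -> m%:Z <= b - a ->
  exists J : int -> int * int, forall p, a <= p < b ->
    [/\ a <= (J p).1 <= p, p < (J p).2 <= b, m%:Z <= (J p).2 - (J p).1 < (2 * m)%N%:Z &
      forall q, (J p).1 <= q < (J p).2 -> J q = J p].
Proof.
move=> m0; have [N] : exists N : nat, b - a <= N%:Z by exists (absz (b - a)); lia.
elim: N a => [|N IH] a hN hab; first by lia.
have [h2|h2] := ltP (b - a) (2 * m)%N%:Z.
  by exists (fun=> (a, b)) => p hp /=; split=> //; lia.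
have [||J hJ] := IH (a + m%:Z); [by lia|by lia|].
exists (fun p => if p < a + m%:Z then (a, a + m%:Z) else J p) => p hp.
case: ifP => pm /=; first by split=> [|||q hq]; [lia|lia|lia|]; case: ifP => //; lia.
have [|h1 h3 h4 h5] := hJ p; first by lia.
split=> // [|q hq]; first by lia.
by rewrite ifF; [exact: h5|lia].
Qed.

(* Refines a partition of [b, c) so that [a, e) becomes a union of cells. *)
Lemma framed_partition (m : nat) (b a e c : int) : (0 < m)%N ->
  m%:Z <= a - b <= (3 * m)%N%:Z -> m%:Z <= e - a -> m%:Z <= c - e <= (3 * m)%N%:Z ->
  exists J : int -> int * int, forall p, b <= p < c ->
    [/\ b <= (J p).1 <= p, p < (J p).2 <= c, m%:Z <= (J p).2 - (J p).1 <= (3 * m)%N%:Z,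
      forall q, (J p).1 <= q < (J p).2 -> J q = J p &
      forall q, (J p).1 <= q < (J p).2 -> a <= q < e -> a <= p < e].
Proof.
move=> m0 hab hae hec; have [J hJ] := interval_partition m0 hae.
exists (fun p => if p < a then (b, a) else if p < e then J p else (e, c)) => p hp.
case: ifP => pa /=.
  by split=> [|||q hq|q hq hq']; [lia|lia|lia| |lia]; case: ifP => //; lia.
case: ifP => pe /=; last first.
  by split=> [|||q hq|q hq hq']; [lia|lia|lia| |lia]; case: ifP => [|_]; [lia|case: ifP => //; lia].
have [|h1 h3 h4 h5] := hJ p; first by lia.
split=> [|||q hq|q hq hq']; try lia.
by rewrite ifF; [rewrite ifT; [exact: h5|lia]|lia].
Qed.

Section BoxTiling.
Variables (d m D N : nat).
Local Notation V := 'rV[int]_d.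
Variable SB : nat -> V -> Prop.
Hypotheses (m0 : (0 < m)%N) (mN : (m <= N)%N) (mD : (3 * m <= D)%N)
  (SB_size : forall s a, SB s a -> (m <= s)%N)
  (SB_box : forall s a, SB s a ->
     (forall i, D%:Z <= a 0 i /\ a 0 i + (s + D)%N%:Z <= N%:Z) \/
     exists i, a 0 i + (s + D)%N%:Z <= 0 \/ (N + D)%N%:Z <= a 0 i)
  (SB_sep : forall s a s' a', SB s a -> SB s' a' ->
     [\/ s = s' /\ a = a',
         forall i, a' 0 i + D%:Z <= a 0 i /\ a 0 i + (s + D)%N%:Z <= a' 0 i + s'%:Z,
         forall i, a 0 i + D%:Z <= a' 0 i /\ a' 0 i + (s' + D)%N%:Z <= a 0 i + s%:Z |
         exists i, a 0 i + (s + 2 * D)%N%:Z <= a' 0 i \/ a' 0 i + (s' + 2 * D)%N%:Z <= a 0 i]).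

Let cls (p : V) := (forall i, 0 <= p 0 i < N%:Z) /\
  forall s a, SB s a -> ~ (forall i, a 0 i <= p 0 i < a 0 i + s%:Z).

(** One product grid of the large box is used away from the sub-boxes. Each sub-box has a frame, a
    union of grid cells reaching [m] to [3 * m] beyond it, and inside the frame the grid is replaced
    by one for which the sub-box is a union of cells. As [3 * m <= D], no point of the class lies in
    two frames. *)
Lemma box_tiling : exists K : V -> V * V, forall p, cls p ->
  [/\ forall i, (K p).1 0 i <= p 0 i < (K p).2 0 i,
      forall i, m%:Z <= (K p).2 0 i - (K p).1 0 i <= (3 * m)%N%:Z &
      forall q : V, (forall i, (K p).1 0 i <= q 0 i < (K p).2 0 i) -> cls q /\ K q = K p].
Proof.
have [|J0 hJ0] := @interval_partition m 0 N%:Z m0; first by lia.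
(* The grid cells through [t - m] and [t + m - 1] are shorter than [2 * m], so the frame ends
   between [m] and [3 * m] away from the sub-box. The [- 1] is there because upper ends are
   excluded. *)
pose lo (t : int) := (J0 (t - m%:Z)).1.
pose hi (t : int) := (J0 (t + m%:Z - 1)).2.
have loP t : m%:Z <= t <= N%:Z -> [/\ 0 <= lo t, m%:Z <= t - lo t <= (3 * m)%N%:Z &
    forall p, 0 <= p < N%:Z -> lo t <= p -> lo t <= (J0 p).1].
  move=> ht; have [|h1 h2 h3 h4] := hJ0 (t - m%:Z); first by lia.
  rewrite /lo; split; [lia|lia|move=> p hp lp].
  have [k1 k2 k3 k4] := hJ0 p hp.
  rewrite leNgt; apply/negP => lt.
  have e1 : J0 (J0 (t - m%:Z)).1 = J0 (t - m%:Z) by apply: h4; lia.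
  have e2 : J0 (J0 (t - m%:Z)).1 = J0 p by apply: k4; move: lp; rewrite /lo; lia.
  by move: lt; rewrite -e2 e1 ltxx.
have hiP t : 0 <= t <= N%:Z - m%:Z -> [/\ hi t <= N%:Z, m%:Z <= hi t - t <= (3 * m)%N%:Z &
    forall p, 0 <= p < N%:Z -> p < hi t -> (J0 p).2 <= hi t].
  move=> ht; rewrite /hi; have [u eu] : exists u, u = t + m%:Z - 1 by exists (t + m%:Z - 1).
  rewrite -eu; have [|h1 h2 h3 h4] := hJ0 u; first by lia.
  split; [lia|lia|move=> p hp lp].
  have [k1 k2 k3 k4] := hJ0 p hp.
  rewrite leNgt; apply/negP => lt.
  have e1 : J0 ((J0 u).2 - 1) = J0 u by apply: h4; lia.
  have e2 : J0 ((J0 u).2 - 1) = J0 p by apply: k4; lia.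
  by move: lt; rewrite -e2 e1 ltxx.
(* Sub-boxes inside the large box; by [SB_box] all others are disjoint from it. *)
pose rel (sa : nat * V) := SB sa.1 sa.2 /\
  forall i, D%:Z <= sa.2 0 i /\ sa.2 0 i + (sa.1 + D)%N%:Z <= N%:Z.
have relP sa i : rel sa -> [/\ m%:Z <= sa.2 0 i <= N%:Z, 0 <= sa.2 0 i + sa.1%:Z <= N%:Z - m%:Z & m%:Z <= sa.1%:Z].
  move=> [/SB_size hs /(_ i)]; move: (sa.2 0 i) => z; split; lia.
have exJ (sa : nat * V) i : exists J : int -> int * int, rel sa ->
    forall p, lo (sa.2 0 i) <= p < hi (sa.2 0 i + sa.1%:Z) ->
    [/\ lo (sa.2 0 i) <= (J p).1 <= p, p < (J p).2 <= hi (sa.2 0 i + sa.1%:Z),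
      m%:Z <= (J p).2 - (J p).1 <= (3 * m)%N%:Z,
      forall q, (J p).1 <= q < (J p).2 -> J q = J p &
      forall q, (J p).1 <= q < (J p).2 -> sa.2 0 i <= q < sa.2 0 i + sa.1%:Z ->
         sa.2 0 i <= p < sa.2 0 i + sa.1%:Z].
  have [h|h] := pselect (rel sa); last by exists (fun=> (0, 0)).
  have [h1 h2 h3] := relP _ i h; have [l1 l2 l3] := loP _ h1; have [k1 k2 k3] := hiP _ h2.
  have [|J hJ] := framed_partition m0 l2 _ k2; first by lia.
  by exists J.
pose JJ sa i := sval (cid (exJ sa i)).
have JJP sa i := svalP (cid (exJ sa i)).
pose fr (sa : nat * V) (p : V) := rel sa /\
  forall i, lo (sa.2 0 i) <= p 0 i < hi (sa.2 0 i + sa.1%:Z).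
pose K (p : V) : V * V := match pselect (exists sa, fr sa p) with
  | left h => let sa := sval (cid h) in (\row_i (JJ sa i (p 0 i)).1, \row_i (JJ sa i (p 0 i)).2)
  | right _ => (\row_i (J0 (p 0 i)).1, \row_i (J0 (p 0 i)).2) end.
have fr_near sa p i : fr sa p ->
    sa.2 0 i - (3 * m)%N%:Z <= p 0 i < sa.2 0 i + sa.1%:Z + (3 * m)%N%:Z.
  move=> [h /(_ i)]; have [h1 h2 h3] := relP _ i h; have [_ l2 _] := loP _ h1; have [_ k2 _] := hiP _ h2.
  by move: l2 k2; move: (lo _) (hi _) => x y; move: (p 0 i) (sa.2 0 i) => z t; lia.
have fr_box sa p i : fr sa p -> 0 <= p 0 i < N%:Z.
  move=> [h /(_ i)]; have [h1 h2 h3] := relP _ i h; have [l2 _ _] := loP _ h1; have [k2 _ _] := hiP _ h2.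
  by move: l2 k2; move: (lo _) (hi _) => x y; move: (p 0 i) (sa.2 0 i) => z t; lia.
have notin sa p : rel sa -> cls p -> exists i, ~ (sa.2 0 i <= p 0 i < sa.2 0 i + sa.1%:Z).
  by move=> [h _] [_ /(_ _ _ h)] h'; apply: contrapT => h2; apply: h' => i; apply: contrapT => h3; apply: h2; exists i.
(* For nested sub-boxes the frame of the inner one lies within the outer one, which contains no
   point of the class. *)
have fr_uniq sa sa' p : cls p -> fr sa p -> fr sa' p -> sa = sa'.
  move=> cp hs hs'; have [h _] := hs; have [h' _] := hs'.
  have [i0 hi0] := notin _ _ h cp; have [i1 hi1] := notin _ _ h' cp.
  case: (SB_sep h.1 h'.1) => [[e1 e2]|hh|hh|[i hh]].
  - by case: sa sa' e1 e2 {h h' hs hs' hi0 hi1} => ? ? [? ?] /= -> ->.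
  - have := hh i1; have := fr_near _ _ i1 hs; move: hi1.
    by move: (p 0 i1) (sa.2 0 i1) (sa'.2 0 i1) => x y z; lia.
  - have := hh i0; have := fr_near _ _ i0 hs'; move: hi0.
    by move: (p 0 i0) (sa.2 0 i0) (sa'.2 0 i0) => x y z; lia.
  - have := fr_near _ _ i hs; have := fr_near _ _ i hs'; move: hh.
    by move: (p 0 i) (sa.2 0 i) (sa'.2 0 i) => x y z; lia.
have KE sa p : cls p -> fr sa p -> K p = (\row_i (JJ sa i (p 0 i)).1, \row_i (JJ sa i (p 0 i)).2).
  move=> cp hs; rewrite /K; case: pselect => [h|[]]; last by exists sa.
  by case: (cid h) => sa' hs' /=; rewrite (fr_uniq _ _ _ cp hs' hs).
have KN p : (forall sa, ~ fr sa p) -> K p = (\row_i (J0 (p 0 i)).1, \row_i (J0 (p 0 i)).2).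
  by move=> h; rewrite /K; case: pselect => // ex; exfalso; case: ex => sa; exact: h.
exists K => p cp.
have [[sa hs]|nfr] := pselect (exists sa, fr sa p).
  have [h hp] := hs; rewrite (KE _ _ cp hs) /=.
  have hJ i := JJP sa i h (p 0 i) (hp i).
  split=> [i|i|q hq].
  - by rewrite !mxE; have [/andP[_ h1] /andP[h2 _] _ _ _] := hJ i; rewrite h1.
  - by rewrite !mxE; have [_ _ ? _ _] := hJ i.
  have {}hq i : (JJ sa i (p 0 i)).1 <= q 0 i < (JJ sa i (p 0 i)).2 by have := hq i; rewrite !mxE.
  have fq : fr sa q.
    split=> // i; have [h1 h2 _ _ _] := hJ i; have := hq i; rewrite -/(JJ sa i) in h1 h2 *.
    by move: (JJ _ _ _) h1 h2 => [x y] /=; move: (lo _) (hi _) (q 0 i) (p 0 i) => a b t u; lia.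
  have cq : cls q.
    split=> [i|s a hsa hin]; first exact: fr_box fq.
    have [i0 hi0] := notin _ _ h cp.
    have nq : ~ (sa.2 0 i0 <= q 0 i0 < sa.2 0 i0 + sa.1%:Z).
      by move=> hh; apply: hi0; have [_ _ _ _ h5] := hJ i0; exact: (h5 _ (hq i0) hh).
    case: (SB_sep h.1 hsa) => [[e1 e2]|hh|hh|[i hh]].
    + by apply: nq; have := hin i0; rewrite -e1 -e2.
    + case: cp => _ /(_ _ _ hsa); apply => i.
      have := hh i; have := fr_near _ _ i hs.
      by move: (p 0 i) (sa.2 0 i) (a 0 i) => x y z; lia.
    + apply: nq; have := hh i0; have := hin i0.
      by move: (q 0 i0) (sa.2 0 i0) (a 0 i0) => x y z; lia.
    + have := hin i; have := fr_near _ _ i fq; move: hh.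
      by move: (q 0 i) (sa.2 0 i) (a 0 i) => x y z; lia.
  split=> //; rewrite (KE _ _ cq fq).
  have e i : JJ sa i (q 0 i) = JJ sa i (p 0 i) by have [_ _ _ h4 _] := hJ i; exact: (h4 _ (hq i)).
  by congr pair; apply/rowP => i; rewrite !mxE e.
have {}nfr sa : ~ fr sa p by move=> h; apply: nfr; exists sa.
rewrite (KN _ nfr) /=; have hJ i := hJ0 (p 0 i) (cp.1 i).
split=> [i|i|q hq].
- by rewrite !mxE; have [/andP[_ h1] /andP[h2 _] _ _] := hJ i; rewrite h1.
- by rewrite !mxE; have [_ _ ? _] := hJ i; lia.
have {}hq i : (J0 (p 0 i)).1 <= q 0 i < (J0 (p 0 i)).2 by have := hq i; rewrite !mxE.
have e i : J0 (q 0 i) = J0 (p 0 i) by have [_ _ _ h4] := hJ i; exact: (h4 _ (hq i)).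
have q_box i : 0 <= q 0 i < N%:Z.
  have [h1 h2 _ _] := hJ i; have := hq i.
  by move: (J0 _) h1 h2 => [x y] /=; move: (q 0 i) (p 0 i) => t u; lia.
have nfrq sa : ~ fr sa q.
  move=> [h hf]; apply: (nfr sa); split=> // i.
  have [h1 h2 h3] := relP _ i h; have [_ _ l3] := loP _ h1; have [_ _ k3] := hiP _ h2.
  have /andP[f1 f2] := hf i.
  have := l3 _ (q_box i) f1; have := k3 _ (q_box i) f2; rewrite e.
  have [j1 j2 _ _] := hJ i.
  by move: j1 j2 f1 f2; move: (J0 _) => [x y] /=; move: (lo _) (hi _) => a b; move: (p 0 i) (q 0 i) => t u; lia.
split; last by rewrite (KN _ nfrq); congr pair; apply/rowP => i; rewrite !mxE e.
split=> // s a hsa hin; apply: (nfrq (s, a)).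
have h : rel (s, a).
  split=> //=; case: (SB_box hsa) => // -[i hh].
  by have := hin i; have := q_box i; move: hh; move: (q 0 i) (a 0 i) => x y; lia.
split=> // i /=; have [h1 h2 h3] := relP _ i h; have [_ l2 _] := loP _ h1; have [_ k2 _] := hiP _ h2.
have := hin i; move: l2 k2; rewrite /=.
by move: (lo _) (hi _) => x y; move: (q 0 i) (a 0 i) => z t; lia.
Qed.

End BoxTiling.

(** * The classes cut out by nested boxes *)

Section BoxClasses.
Context {dX : measure_display} {X : measurableType dX} {d : nat}.
Local Notation V := 'rV[int]_d.
Variables (act : V -> X -> X) (n : nat -> nat) (D : nat) (U : nat -> X -> Prop).
Hypotheses (act0 : forall x, act 0 x = x)
  (actD : forall g h x, act (g + h) x = act g (act h x))
  (mact : forall g, measurable_fun setT (act g))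
  (mU : forall k, mp (U k))
  (Usep : forall j k x v, (j <= k)%N -> U j x -> U k (act v x) ->
        [\/ j = k /\ v = 0,
            (j < k)%N /\ forall i, v 0 i <= - D%:Z /\ (n j + D)%N%:Z <= v 0 i + (n k)%:Z |
            exists i, (n j + D)%N%:Z <= v 0 i - D%:Z \/ v 0 i + (n k + D)%N%:Z <= - D%:Z]).

(** Here [u] is the position of [x] relative to the corner [act (- u) x] of a box, and [u + v] that
    of [act v x]. *)
Definition same_boxes (v : V) (x : X) := forall k u, U k (act (- u) x) ->
  (u \in cube d 0 (n k)) = (u + v \in cube d 0 (n k)).

Lemma act_rebase u v x : act (- (u + v)) (act v x) = act (- u) x.
Proof. by rewrite -actD opprD subrK. Qed.

Lemma same_boxes0 x : same_boxes 0 x.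
Proof. by move=> k u _; rewrite addr0. Qed.

Lemma same_boxes_trans g h x : same_boxes g x -> same_boxes h (act g x) -> same_boxes (h + g) x.
Proof.
move=> hg hh k u Uu; rewrite (hg k u Uu) (hh k (u + g)) ?act_rebase //.
by rewrite -addrA (addrC g).
Qed.

Lemma same_boxes_sym g x : same_boxes g x -> same_boxes (- g) (act g x).
Proof.
move=> hg k u Uu; rewrite (hg k (u - g)) ?subrK //.
by move: Uu; rewrite -{1}(subrK g u) act_rebase.
Qed.

Lemma mp_same_boxes v : mp (same_boxes v).
Proof.
apply: mp_forall => k; apply: mp_forall => u; apply: mp_imp; last exact: mp_cst.
exact: (mp_comp (mact _) (mU k)).
Qed.

Definition covered (x : X) := exists k u, U k (act (- u) x) /\ u \in cube d 0 (n k).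

Lemma same_boxes_fin x : covered x -> exists s : seq V, forall v, same_boxes v x -> v \in s.
Proof.
move=> [k [u [Uu hu]]]; exists [seq w - u | w <- cube d 0 (n k)] => v /(_ k u Uu).
by rewrite hu => /esym h; apply/mapP; exists (u + v) => //; rewrite addrC addKr.
Qed.

(* The class of a covered point: its smallest box minus the boxes of lower level. *)
Lemma class_box x : covered x -> exists k u, [/\ U k (act (- u) x), u \in cube d 0 (n k) &
  forall v, same_boxes v x <-> (u + v \in cube d 0 (n k)) /\
    forall j a, (j < k)%N -> U j (act a (act (- u) x)) -> u + v - a \notin cube d 0 (n j)].
Proof.
move=> [k0 [u0 h0]].
have exk : exists k, `[< exists u, U k (act (- u) x) /\ u \in cube d 0 (n k) >].
  by exists k0; apply/asboolP; exists u0.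
case: (ex_minnP exk) => k /asboolP[u [Uu hu]] kmin.
exists k, u; split=> // v.
have base a : act a (act (- u) x) = act (- (u - a)) x by rewrite -actD opprB.
have low j w : (j < k)%N -> U j (act (- w) x) -> w \notin cube d 0 (n j).
  move=> jk Uw; apply/negP => hw; have := kmin j (asboolT (ex_intro _ w (conj Uw hw))).
  by rewrite leqNgt jk.
split=> [Ev|[hv hlow] j w Uw].
  rewrite -(Ev k u Uu) hu; split=> // j a jk; rewrite base => Ua.
  by rewrite addrAC -(Ev j _ Ua) low.
case: (ltnP j k) => jk.
  rewrite (negbTE (low _ _ jk Uw)); 
  have := hlow j (u - w) jk; rewrite base subKr => /(_ Uw).
  by rewrite opprB addrC -addrA addKr => /negbTE ->.
have e : act (u - w) (act (- u) x) = act (- w) x by rewrite -actD addrC addKr.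
case: (Usep jk Uu (v := u - w)); rewrite ?e //.
- move=> [kj /eqP]; rewrite subr_eq0 => /eqP uw; move: hu hv.
  by rewrite -kj -uw => -> ->.
- move=> [_ hn]; transitivity true; last apply/esym; apply/cubeP => i.
    by have := hn i; move/cubeP: hu => /(_ i); rewrite !mxE; move: (u 0 i) (w 0 i) => a b; lia.
  have := hn i; move/cubeP: hv => /(_ i); rewrite !mxE.
  by move: (u 0 i) (w 0 i) (v 0 i) => a b c; lia.
- move=> [i hd]; transitivity false; last apply/esym; apply/negbTE/negP => /cubeP/(_ i).
    by move: hd; move/cubeP: hu => /(_ i); rewrite !mxE; move: (u 0 i) (w 0 i) => a b; lia.
  move: hd; move/cubeP: hv => /(_ i); rewrite !mxE.
  by move: (u 0 i) (w 0 i) (v 0 i) => a b c; lia.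
Qed.

(** In the coordinates of its smallest box a class is a box minus sub-boxes, as in [box_tiling]; the
    tiling found there is translated back by [u]. *)
Lemma class_tiling (m : nat) x : (0 < m)%N -> (3 * m <= D)%N -> (forall k, m <= n k)%N -> covered x ->
  exists K : V -> V * V, forall p, same_boxes p x ->
  [/\ forall i, (K p).1 0 i <= p 0 i < (K p).2 0 i,
      forall i, m%:Z <= (K p).2 0 i - (K p).1 0 i <= (3 * m)%N%:Z &
      forall q : V, (forall i, (K p).1 0 i <= q 0 i < (K p).2 0 i) -> same_boxes q x /\ K q = K p].
Proof.
move=> m0 mD mn /class_box[k [u [Uu hu hE]]].
set z := act (- u) x in Uu hE.
pose SB s (a : V) := exists j, [/\ (j < k)%N, s = n j & U j (act a z)].
have [|||K0 hK] := @box_tiling d m D (n k) SB m0 (mn k) mD.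
- by move=> s a [j [_ ->]].
- move=> s a [j [jk -> Ua]].
  have Uz : U k (act (- a) (act a z)) by rewrite -actD addNr act0.
  case: (Usep (ltnW jk) Ua Uz) => [[jk' _]|[_ h]|[i h]]; first by rewrite jk' ltnn in jk.
  + by left=> i; have := h i; rewrite mxE; move: (a 0 i) => b; lia.
  + by right; exists i; move: h; rewrite mxE; move: (a 0 i) => b; lia.
- suff h s a s' a' j j' : (j <= j')%N -> s = n j -> s' = n j' -> U j (act a z) -> U j' (act a' z) ->
     [\/ s = s' /\ a = a',
         forall i, a' 0 i + D%:Z <= a 0 i /\ a 0 i + (s + D)%N%:Z <= a' 0 i + s'%:Z |
         exists i, a 0 i + (s + 2 * D)%N%:Z <= a' 0 i \/ a' 0 i + (s' + 2 * D)%N%:Z <= a 0 i].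
    move=> s a s' a' [j [_ es Ua]] [j' [_ es' Ua']].
    case: (leqP j j') => jj.
      case: (h _ _ _ _ _ _ jj es es' Ua Ua') => [e|e|e]; [exact: Or41|exact: Or42|exact: Or44].
    case: (h _ _ _ _ _ _ (ltnW jj) es' es Ua' Ua) => [[-> ->]|e|[i e]]; [exact: Or41|exact: Or43|].
    by apply: Or44; exists i; case: e; [right|left].
  move=> jj -> -> Ua Ua'.
  have Uz : U j' (act (a' - a) (act a z)) by rewrite -actD subrK.
  case: (Usep jj Ua Uz) => [[-> /eqP]|[_ h]|[i h]].
  + by rewrite subr_eq0 => /eqP ->; apply: Or31.
  + by apply: Or32 => i; have := h i; rewrite !mxE; move: (a 0 i) (a' 0 i) => b c; lia.
  + by apply: Or33; exists i; move: h; rewrite !mxE; move: (a 0 i) (a' 0 i) => b c; lia.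
have hE' p : same_boxes p x <-> (forall i, 0 <= (u + p) 0 i < (n k)%:Z) /\
  forall s a, SB s a -> ~ (forall i, a 0 i <= (u + p) 0 i < a 0 i + s%:Z).
  rewrite hE; split=> -[h1 h2]; split.
  - by move=> i; move/cubeP: h1 => /(_ i); move: ((u + p) 0 i) => w; lia.
  - move=> s a [j [jk -> Ua]] hin; have /negP := h2 j a jk Ua; apply.
    by apply/cubeP => i; have := hin i; rewrite !mxE; move: (u 0 i) (p 0 i) (a 0 i) => b c e; lia.
  - by apply/cubeP => i; have := h1 i; move: ((u + p) 0 i) => w; lia.
  - move=> j a jk Ua; apply/negP => /cubeP hin; apply: (h2 (n j) a); first by exists j.
    by move=> i; have := hin i; rewrite !mxE; move: (u 0 i) (p 0 i) (a 0 i) => b c e; lia.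
exists (fun p => ((K0 (u + p)).1 - u, (K0 (u + p)).2 - u)) => p /hE' cp /=.
have [h1 h2 h3] := hK _ cp; split.
- by move=> i; have := h1 i; rewrite !mxE; move: (u 0 i) (p 0 i) ((K0 _).1 0 i) ((K0 _).2 0 i) => a b c e; lia.
- by move=> i; have := h2 i; rewrite !mxE; move: (u 0 i) ((K0 _).1 0 i) ((K0 _).2 0 i) => a c e; lia.
- move=> q hq; have [|c1 c2] := h3 (u + q).
    by move=> i; have := hq i; rewrite !mxE; move: (u 0 i) (q 0 i) ((K0 _).1 0 i) ((K0 _).2 0 i) => a b c e; lia.
  by split; [exact/hE'|rewrite c2].
Qed.

End BoxClasses.

(** * Integral rounding of flows *)

Section BoxBoundary.
Variable d : nat.
Local Notation V := 'rV[int]_d.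

Definition unitv (i : 'I_d) : V := delta_mx 0 i.

Lemma unitvE i j : unitv i 0 j = (j == i)%:R.
Proof. by rewrite /unitv mxE eqxx. Qed.

(* A 2-chain assigns to (q, i, j) the coefficient of the square at q spanned by
   the directions i and j; [bd] is its boundary along the edge (q, i). *)
Definition alternating (M : zmodType) (a : V -> 'I_d -> 'I_d -> M) :=
  forall q i j, a q j i = - a q i j.
Definition bd (M : zmodType) (a : V -> 'I_d -> 'I_d -> M) (q : V) (i : 'I_d) : M :=
  \sum_j (a q i j - a (q - unitv j) i j).

Variable n : nat.
Hypothesis n0 : (0 < n)%N.

(** The sign of a crossing: 1 outwards, -1 inwards, 0 for an edge that does not cross the
    boundary. *)
Definition exits (e : V * 'I_d) : int :=
  (e.1 \in cube d 0 n)%:R - (e.1 + unitv e.2 \in cube d 0 n)%:R.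

(** Homology of signed crossing edges relative to the edges that do not cross: the boundary of the
    chain is prescribed on crossing edges only. *)
Let linked (v w : V * 'I_d) := exists a : V -> 'I_d -> 'I_d -> int, alternating a /\
  forall e, exits e != 0 -> bd a e.1 e.2 = exits v * (e == v)%:R - exits w * (e == w)%:R.

Let linked_refl v : linked v v.
Proof.
exists (fun _ _ _ => 0); split; first by move=> *; rewrite oppr0.
by move=> e _; rewrite subrr /bd big1 // => j _; rewrite subrr.
Qed.

Let linked_trans v w u : linked v w -> linked w u -> linked v u.
Proof.
move=> [a [aa ha]] [b [bb hb]]; exists (fun q i j => a q i j + b q i j); split.
  by move=> q i j; rewrite aa bb opprD.
move=> e he; have := congr2 +%R (ha e he) (hb e he); rewrite addrA subrK => <-.
by rewrite /bd -big_split /=; apply: eq_bigr => j _; rewrite opprD addrACA.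
Qed.

(** The elementary chain of the unit square at [p] spanned by [i] and [j]. *)
Let sq (p : V) (i j : 'I_d) (q : V) (k l : 'I_d) : int :=
  (q == p)%:R * ((k == i)%:R * (l == j)%:R - (k == j)%:R * (l == i)%:R).

Let sumD (j : 'I_d) (F : 'I_d -> int) : \sum_l (l == j)%:R * F l = F j.
Proof.
rewrite (bigD1 j) //= eqxx mul1r big1 ?addr0 // => l /negbTE ->.
by rewrite mul0r.
Qed.

Let bd_sq p i j q k : bd (sq p i j) q k =
  ((q == p)%:R - (q == p + unitv j)%:R) * (k == i)%:R -
  ((q == p)%:R - (q == p + unitv i)%:R) * (k == j)%:R.
Proof.
rewrite /bd /sq.
transitivity (\sum_l ((l == j)%:R * ((k == i)%:R * ((q == p)%:R - (q - unitv l == p)%:R)) -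
  (l == i)%:R * ((k == j)%:R * ((q == p)%:R - (q - unitv l == p)%:R)) : int)).
  by apply: eq_bigr => l _; ring.
rewrite sumrB !sumD !subr_eq; ring.
Qed.

Let linked_sq p i j s v w :
  (forall e, exits e != 0 -> s * bd (sq p i j) e.1 e.2 = exits v * (e == v)%:R - exits w * (e == w)%:R) ->
  linked v w.
Proof.
move=> h; exists (fun q k l => s * sq p i j q k l); split.
  by move=> q k l; rewrite /sq; ring.
by move=> e he; rewrite -h // /bd mulr_sumr; apply: eq_bigr => l _; rewrite mulrBr.
Qed.

Let eq_edge (q p : V) (k i : 'I_d) : ((q, k) == (p, i))%:R = (q == p)%:R * (k == i)%:R :> int.
Proof. by rewrite xpair_eqE; case: (q == p); case: (k == i). Qed.

(* slides a crossing edge along a face *)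
Let linked_slide p i j :
  (p \in cube d 0 n) = (p + unitv j \in cube d 0 n) ->
  (p + unitv i \in cube d 0 n) = (p + unitv j + unitv i \in cube d 0 n) ->
  linked (p, i) (p + unitv j, i).
Proof.
move=> h1 h2; apply: (@linked_sq p i j (exits (p, i))) => -[q k] he.
have -> : exits (p + unitv j, i) = exits (p, i) by rewrite /exits /= h1 h2.
rewrite bd_sq !eq_edge.
suff -> : ((q == p)%:R - (q == p + unitv i)%:R) * (k == j)%:R = 0 :> int by ring.
case: (eqVneq k j) => [ek|_]; last by rewrite mulr0.
move: he; rewrite /exits /= ek.
case: (eqVneq q p) => [->|_]; first by rewrite h1 subrr eqxx.
case: (eqVneq q (p + unitv i)) => [->|_]; first by rewrite addrAC h2 addrAC subrr eqxx.
by rewrite subrr mul0r.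
Qed.

(* turns around an edge of the box from an upper face to an upper face *)
Let linked_corner p i j :
  p + unitv i \notin cube d 0 n -> p + unitv j \notin cube d 0 n ->
  p + unitv i + unitv j \notin cube d 0 n -> p \in cube d 0 n ->
  linked (p, i) (p, j).
Proof.
move=> /negbTE h1 /negbTE h2 /negbTE h3 h0; apply: (@linked_sq p i j 1) => -[q k] he.
have -> : exits (p, i) = 1 by rewrite /exits /= h0 h1.
have -> : exits (p, j) = 1 by rewrite /exits /= h0 h2.
rewrite bd_sq !eq_edge.
suff : (q == p + unitv j)%:R * (k == i)%:R = 0 :> int /\ (q == p + unitv i)%:R * (k == j)%:R = 0 :> int.
  by move=> [e1 e2]; rewrite !mulrBl e1 e2; ring.
split; case: eqP => [eq|_]; rewrite ?mul0r //; case: eqP => [ek|_]; rewrite ?mulr0 //; move: he; rewrite /exits /= eq ek.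
  by rewrite h2 addrAC h3 subrr eqxx.
by rewrite h1 h3 subrr eqxx.
Qed.

(* turns around an edge of the box from a lower face to an upper face *)
Let linked_turn p i j :
  p \notin cube d 0 n -> p + unitv j \notin cube d 0 n ->
  p + unitv i + unitv j \notin cube d 0 n -> p + unitv i \in cube d 0 n ->
  linked (p, i) (p + unitv i, j).
Proof.
move=> /negbTE h0 /negbTE h2 /negbTE h3 h1; apply: (@linked_sq p i j (-1)) => -[q k] he.
have -> : exits (p, i) = -1 by rewrite /exits /= h0 h1.
have -> : exits (p + unitv i, j) = 1 by rewrite /exits /= h1 h3.
rewrite bd_sq !eq_edge.
suff : (q == p + unitv j)%:R * (k == i)%:R = 0 :> int /\ (q == p)%:R * (k == j)%:R = 0 :> int.
  by move=> [e1 e2]; rewrite !mulrBl e1 e2; ring.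
split; case: eqP => [eq|_]; rewrite ?mul0r //; case: eqP => [ek|_]; rewrite ?mulr0 //; move: he; rewrite /exits /= eq ek.
  by rewrite h2 addrAC h3 subrr eqxx.
by rewrite h0 h2 subrr eqxx.
Qed.

Let apex : V := \row__ (n%:Z - 1).

Let mem_add (p : V) i t : (p + unitv i) 0 t = p 0 t + (t == i)%:R.
Proof. by rewrite mxE unitvE. Qed.

(** An edge through an upper face slides to the corner [apex], by induction on its l1 distance to
    it. *)
Let linked_upper p i : p \in cube d 0 n -> p 0 i = n%:Z - 1 -> linked (p, i) (apex, i).
Proof.
have [N] : exists N : nat, (\sum_j absz (n%:Z - 1 - p 0 j)%R <= N)%N by eexists.
elim: N p => [|N IH] p hN pb pi.
  have -> : p = apex; last exact: linked_refl.
  apply/rowP => j; rewrite mxE; move: hN; rewrite leqn0 sum_nat_eq0 => /forallP/(_ j)/implyP/(_ isT).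
  by rewrite absz_eq0 subr_eq0 => /eqP.
have [[j hj]|h] := pselect (exists j, p 0 j < n%:Z - 1); last first.
  have -> : p = apex; last exact: linked_refl.
  apply/rowP => j; rewrite mxE; have := h; rewrite -forallNE => /(_ j).
  by move/cubeP: pb => /(_ j); move: (p 0 j) => a; lia.
have ij : j != i by apply: contraTneq hj => ->; rewrite pi ltxx.
have pjb : p + unitv j \in cube d 0 n.
  apply/cubeP => t; rewrite mem_add; move/cubeP: pb => /(_ t).
  by case: eqP => [->|_]; move: hj; move: (p 0 _) (p 0 t) => a b; lia.
apply: (@linked_trans _ (p + unitv j, i)).
  apply: linked_slide; first by rewrite pb pjb.
  transitivity false; last apply/esym; apply/negbTE/negP => /cubeP/(_ i).
    by rewrite mem_add eqxx pi; lia.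
  by rewrite !mem_add eqxx pi eq_sym (negbTE ij); lia.
apply: IH => //; last by rewrite mem_add pi eq_sym (negbTE ij) addr0.
rewrite -ltnS; apply: leq_trans hN; rewrite (bigD1 j) //= [leqRHS](bigD1 j) //= -addSn.
apply: leq_add; first by rewrite mem_add eqxx; move: hj; move: (p 0 j) => a; lia.
by apply: leq_sum => t tj; rewrite mem_add (negbTE tj) addr0.
Qed.

(** An edge through a lower face slides in a second direction [j] up to the rim of the box, turns
    around it into the upper face of direction [j], and continues as in [linked_upper]. *)
Let linked_lower p i j : j != i -> p + unitv i \in cube d 0 n -> p 0 i = -1 -> linked (p, i) (apex, j).
Proof.
move=> ij pb pi.
have [N] : exists N : nat, (absz (n%:Z - 1 - p 0 j)%R <= N)%N by eexists.
have pNi (q : V) : q 0 i = -1 -> q \notin cube d 0 n.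
  by move=> qi; apply/negP => /cubeP/(_ i); rewrite qi.
elim: N p pb pi => [|N IH] p pb pi hN.
  have pj : p 0 j = n%:Z - 1 by move: hN; move: (p 0 j) => a; lia.
  apply: (linked_trans (w := (p + unitv i, j))).
    apply: linked_turn => //; first exact: pNi.
      by apply: pNi; rewrite mem_add pi eq_sym (negbTE ij).
    apply/negP => /cubeP/(_ j); rewrite !mem_add pj eqxx (negbTE ij); lia.
  by apply: linked_upper => //; rewrite mem_add pj (negbTE ij) addr0.
have [pj|pj] := eqVneq (p 0 j) (n%:Z - 1); first by apply: IH => //; rewrite pj subrr.
have hj : 0 <= p 0 j < n%:Z - 1.
  move/cubeP: pb => /(_ j); rewrite mem_add (negbTE ij) addr0.
  by move: pj; move: (p 0 j) => a; lia.
have pjb : p + unitv j + unitv i \in cube d 0 n.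
  apply/cubeP => t; rewrite 2!mem_add; move/cubeP: pb => /(_ t); rewrite mem_add.
  by case: (eqVneq t j) => [->|_]; rewrite ?(negbTE ij); move: hj; move: (p 0 _) (p 0 t) => a b; case: (t == i); lia.
have pji : (p + unitv j) 0 i = -1 by rewrite mem_add pi eq_sym (negbTE ij).
apply: (@linked_trans _ (p + unitv j, i)).
  apply: linked_slide; last by rewrite pb pjb.
  by rewrite (negbTE (pNi _ pi)) (negbTE (pNi _ pji)).
apply: IH => //; rewrite mem_add eqxx; move: hj hN; move: (p 0 j) => a; lia.
Qed.

(* For d >= 2 the boundary of the box is connected: differences of crossing edges bound. *)
Lemma crossing_linked : (1 < d)%N ->
  exists (A : V * 'I_d -> V -> 'I_d -> 'I_d -> int) (r : V * 'I_d),
  forall v, alternating (A v) /\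
    (exits v != 0 -> forall e, exits e != 0 ->
      bd (A v) e.1 e.2 = exits v * (e == v)%:R - exits r * (e == r)%:R).
Proof.
move=> d1; pose i0 : 'I_d := Ordinal (ltnW d1); pose i1 : 'I_d := Ordinal d1.
have apexb : apex \in cube d 0 n by apply/cubeP => t; rewrite mxE; move: n0; lia.
have apexN i : apex + unitv i \notin cube d 0 n.
  by apply/negP => /cubeP/(_ i); rewrite mem_add mxE eqxx; lia.
have apexL i : linked (apex, i) (apex, i0).
  have [->|ii] := eqVneq i i0; first exact: linked_refl.
  apply: linked_corner => //.
  by apply/negP => /cubeP/(_ i0); rewrite !mem_add mxE eqxx (negbTE (_ : i0 != i)) 1?eq_sym //; lia.
have all v : exits v != 0 -> linked v (apex, i0).
  case: v => p i; rewrite /exits /=.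
  case: (boolP (p \in _)) => [pb|pNb]; case: (boolP (p + unitv i \in _)) => [pib|piNb] // _.
    apply: linked_trans (apexL i); apply: linked_upper => //.
    apply: contrapT => h; move/negP: piNb; apply; apply/cubeP => t; rewrite mem_add.
    move/cubeP: pb => /(_ t); case: (eqVneq t i) => [->|_]; last by move: (p 0 t) => a; lia.
    by move: h; move: (p 0 i) => a; lia.
  (* A direction other than [i], which exists because [1 < d]. *)
  pose j := if i == i0 then i1 else i0.
  have ji : j != i by rewrite /j; case: (eqVneq i i0) => [->|]; rewrite // eq_sym.
  apply: linked_trans (apexL j); apply: linked_lower => //.
  apply: contrapT => h; move/negP: pNb; apply; apply/cubeP => t.
  move/cubeP: pib => /(_ t); rewrite mem_add; case: (eqVneq t i) => [->|_]; last by move: (p 0 t) => a; lia.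
  by move: h; move: (p 0 i) => a; lia.
have ex v : exists a : V -> 'I_d -> 'I_d -> int, alternating a /\ (exits v != 0 -> forall e, exits e != 0 ->
    bd a e.1 e.2 = exits v * (e == v)%:R - exits (apex, i0) * (e == (apex, i0))%:R).
  have [->|/all[a [aa ha]]] := eqVneq (exits v) 0; last by exists a.
  by exists (fun _ _ _ => 0); split=> // q i j; rewrite oppr0.
by exists (fun v => sval (cid (ex v))), (apex, i0) => v; exact: svalP (cid (ex v)).
Qed.

End BoxBoundary.

Lemma sum_mem_shift (R : pzRingType) (V : zmodType) (s t : seq V) (e : V) (F : V -> R) :
  uniq s -> uniq t -> (forall p, p \in t -> p - e \in s) ->
  \sum_(q <- s) (q + e \in t)%:R * F q = \sum_(p <- t) F (p - e).
Proof.
move=> us ut h.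
transitivity (\sum_(q <- [seq q <- s | q + e \in t]) F q).
  rewrite big_filter [RHS]big_mkcond; apply: eq_bigr => q _.
  by case: ifP; rewrite ?mul1r ?mul0r.
transitivity (\sum_(q <- [seq p - e | p <- t]) F q); last by rewrite big_map.
apply: perm_big; apply: uniq_perm.
- exact: filter_uniq.
- by rewrite map_inj_uniq // => p q /addIr.
move=> q; rewrite mem_filter; apply/andP/mapP => [[qt _]|[p pt ->]].
  by exists (q + e); rewrite ?addrK.
by rewrite subrK; split=> //; exact: h.
Qed.

(** * Rounding a flow on the edges between classes *)

Section FlowRounding.
Context {dX : measure_display} {X : measurableType dX} {R : realType} {d : nat}.
Local Notation V := 'rV[int]_d.
Variables (act : V -> X -> X) (n : nat -> nat) (D : nat) (U : nat -> X -> Prop).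
Hypotheses (act0 : forall x, act 0 x = x)
  (actD : forall g h x, act (g + h) x = act g (act h x))
  (mact : forall g, measurable_fun setT (act g))
  (n0 : forall k, (0 < n k)%N) (D0 : (0 < D)%N)
  (mU : forall k, mp (U k))
  (Usep : forall j k x v, (j <= k)%N -> U j x -> U k (act v x) ->
        [\/ j = k /\ v = 0,
            (j < k)%N /\ forall i, v 0 i <= - D%:Z /\ (n j + D)%N%:Z <= v 0 i + (n k)%:Z |
            exists i, (n j + D)%N%:Z <= v 0 i - D%:Z \/ v 0 i + (n k + D)%N%:Z <= - D%:Z]).

Definition divergence (phi : 'I_d -> X -> R) (x : X) : R :=
  \sum_i (phi i x - phi i (act (- unitv i) x)).

Let vert (u : V) (i j : 'I_d) (b : bool * bool) : V := u + unitv i *+ b.1 + unitv j *+ b.2.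
(** The squares with vertices on both sides of the boundary of a box; only these will carry a
    correction of the flow. *)
Let crosses (k : nat) (u : V) (i j : 'I_d) : bool :=
  [exists b, vert u i j b \in cube d 0 (n k)] && [exists b, vert u i j b \notin cube d 0 (n k)].

Let vertE (u : V) (i j : 'I_d) (b : bool * bool) (t : 'I_d) : i != j -> u 0 t <= vert u i j b 0 t <= u 0 t + 1.
Proof.
move=> ij; case: b => b1 b2; rewrite /vert 2!mxE.
have -> : (unitv i *+ (b1, b2).1) 0 t = (t == i)%:R *+ b1 by case: b1; rewrite ?mulr1n ?unitvE // mulr0n mxE.
have -> : (unitv j *+ (b1, b2).2) 0 t = (t == j)%:R *+ b2 by case: b2; rewrite ?mulr1n ?unitvE // mulr0n mxE.
move: (u 0 t) => a; case: (eqVneq t i) => [->|_]; first rewrite (negbTE ij).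
  by case: b1; case: b2; rewrite /= ?mulr1n ?mulr0n; lia.
by case: (t == j); case: b1; case: b2; rewrite /= ?mulr1n ?mulr0n; lia.
Qed.

(** The margin [D > 0] leaves no room for a square meeting the boundaries of two boxes. Hence the
    corrections of different boxes do not interact. *)
Let crosses_uniq_le x i j k u k' u' : i != j -> (k <= k')%N ->
  U k (act (- u) x) -> crosses k u i j -> U k' (act (- u') x) -> crosses k' u' i j ->
  (k, u) = (k', u').
Proof.
move=> ij kk Uu /andP[/existsP[b /cubeP hb] _] Uu' /andP[/existsP[c /cubeP hc] /existsP[e /negP he]].
have eq : act (u - u') (act (- u) x) = act (- u') x by rewrite -actD addrC addKr.
have shift w (f : bool * bool) t : vert w i j f 0 t = w 0 t + vert 0 i j f 0 t.
  by rewrite /vert !mxE add0r addrA.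
case: (Usep kk Uu (v := u - u')); rewrite ?eq //.
- by move=> [-> /eqP]; rewrite subr_eq0 => /eqP ->.
- move=> [_ h]; case: he; apply/cubeP => t; have ht := h t; rewrite !mxE in ht; move: ht.
  have := hb t; have := vertE 0 b t ij; have := vertE 0 e t ij.
  rewrite (shift u b) (shift u' e) [(0 : V) 0 t]mxE.
  by move: (vert 0 i j b 0 t) (vert 0 i j e 0 t) (u 0 t) (u' 0 t) => p q r s; lia.
- move=> [t ht]; exfalso; rewrite !mxE in ht; move: ht.
  have := hb t; have := hc t; have := vertE 0 b t ij; have := vertE 0 c t ij.
  rewrite (shift u b) (shift u' c) [(0 : V) 0 t]mxE.
  by move: (vert 0 i j b 0 t) (vert 0 i j c 0 t) (u 0 t) (u' 0 t) => p q r s; lia.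
Qed.

Let crosses_uniq x i j k u k' u' : i != j ->
  U k (act (- u) x) -> crosses k u i j -> U k' (act (- u') x) -> crosses k' u' i j ->
  (k, u) = (k', u').
Proof.
move=> ij h1 h2 h3 h4; case: (leqP k k') => kk.
  exact: (crosses_uniq_le ij kk h1 h2 h3 h4).
by apply/esym; exact: (crosses_uniq_le ij (ltnW kk) h3 h4 h1 h2).
Qed.

Let frac (r : R) : R := r - (Num.floor r)%:~R.

Let frac_int r : r - frac r \is a Num.int.
Proof. by rewrite /frac opprB addrC subrK. Qed.

Let frac_le r : 0 <= frac r <= 1.
Proof.
rewrite /frac; have /andP[h1 h2] := floor_itv r.
by rewrite subr_ge0 h1 /= lerBlDr addrC -[1]/(1%:~R) -intrD ltW.
Qed.

Variables (phi : 'I_d -> X -> R) (C : R).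
Hypotheses (mphi : forall i, measurable_fun setT (phi i))
  (phiC : forall i x, `|phi i x| <= C)
  (phi_div : forall x, divergence phi x \is a Num.int).

Let edges (k : nat) : seq (V * 'I_d) :=
  [seq (q, i) | q <- cube d (-1) (n k).+1, i <- enum 'I_d].

Let edges_uniq k : uniq (edges k).
Proof. by apply: allpairs_uniq; rewrite ?uniq_cube ?enum_uniq // => -[a b] [c e]. Qed.

Let exits_edges k (e : V * 'I_d) : exits (n k) e != 0 -> e \in edges k.
Proof.
case: e => q i he; apply/allpairsP; exists (q, i); split=> //=; last by rewrite mem_enum.
apply: contraNT he; rewrite /exits /= => hq.
suff [-> ->] : q \in cube d 0 (n k) = false /\ q + unitv i \in cube d 0 (n k) = false by rewrite subrr.
split; apply/negbTE; apply: contra hq => /cubeP h; apply/cubeP => t; have := h t.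
  by move: (q 0 t) => a; lia.
by rewrite mxE unitvE; move: (q 0 t) => a; case: (t == i); lia.
Qed.

(* discrete divergence theorem on a box *)
Let flux_int k z : \sum_(e <- edges k) (exits (n k) e)%:~R * phi e.2 (act e.1 z) \is a Num.int.
Proof.
have -> : \sum_(e <- edges k) (exits (n k) e)%:~R * phi e.2 (act e.1 z) =
    \sum_(p <- cube d 0 (n k)) divergence phi (act p z).
  rewrite big_allpairs /= exchange_big /= [RHS]exchange_big /= big_enum /=; apply: eq_bigr => i _.
  transitivity (\sum_(q <- cube d (-1) (n k).+1) (q \in cube d 0 (n k))%:R * phi i (act q z) -
     \sum_(q <- cube d (-1) (n k).+1) (q + unitv i \in cube d 0 (n k))%:R * phi i (act q z)).
    rewrite -sumrB; apply: eq_bigr => q _.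
    by rewrite /exits /= rmorphB /= !rmorph_nat mulrBl.
  rewrite sumrB; congr (_ - _).
    transitivity (\sum_(q <- cube d (-1) (n k).+1) (q + 0 \in cube d 0 (n k))%:R * phi i (act q z)).
      by apply: eq_bigr => q _; rewrite addr0.
    rewrite (sum_mem_shift (fun q => phi i (act q z))) ?uniq_cube // => [|p /cubeP h].
      by apply: eq_bigr => p _; rewrite subr0.
    by rewrite subr0; apply/cubeP => t; have := h t; move: (p 0 t) => a; lia.
  rewrite (sum_mem_shift (fun q => phi i (act q z))) ?uniq_cube // => [|p /cubeP h].
    by apply: eq_bigr => p _; rewrite -actD addrC.
  apply/cubeP => t; have := h t; rewrite 2!mxE unitvE; move: (p 0 t) => a.
  by case: (t == i); lia.
by apply: rpred_sum => p _; exact: phi_div.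
Qed.

Let frac_chain (a : V -> 'I_d -> 'I_d -> R) (q : V) (i j : 'I_d) : R :=
  if (i < j)%N then frac (a q i j) else if (j < i)%N then - frac (a q j i) else 0.

Section Connected.
Hypothesis d1 : (1 < d)%N.

Let exA : exists (A : nat -> V * 'I_d -> V -> 'I_d -> 'I_d -> int) (r : nat -> V * 'I_d),
  forall k v, alternating (A k v) /\
    (exits (n k) v != 0 -> forall e, exits (n k) e != 0 ->
      bd (A k v) e.1 e.2 = exits (n k) v * (e == v)%:R - exits (n k) (r k) * (e == r k)%:R).
Proof.
have h k := crossing_linked (n0 k) d1.
exists (fun k => sval (cid (h k))), (fun k => sval (cid (svalP (cid (h k))))) => k v.
exact: (svalP (cid (svalP (cid (h k))))).
Qed.

(* A real chain on the squares of the box at z whose boundary agrees modulo 1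
   with the flow on the edges leaving the box. *)
Let exchain : exists c : nat -> X -> V -> 'I_d -> 'I_d -> R,
  [/\ forall k q i j, measurable_fun setT (fun z => c k z q i j),
      forall k z, alternating (c k z) &
      forall k z q i, exits (n k) (q, i) != 0 -> phi i (act q z) - bd (c k z) q i \is a Num.int].
Proof.
have [A [r hA]] := exA.
pose c k z q i j := \sum_(v <- edges k) (exits (n k) v)%:~R * phi v.2 (act v.1 z) * (A k v q i j)%:~R.
exists c; split.
- move=> k q i j; apply: measurable_sum => v.
  apply: measurable_funM; last exact: measurable_cst.
  apply: measurable_funM; first exact: measurable_cst.
  exact: measurableT_comp.
- move=> k z q i j; rewrite /c -sumrN; apply: eq_bigr => v _.
  by have [-> _] := hA k v; rewrite rmorphN mulrN.
move=> k z q i he.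
have -> : bd (c k z) q i = \sum_(v <- edges k) (exits (n k) v)%:~R * phi v.2 (act v.1 z) * (bd (A k v) q i)%:~R.
  rewrite /bd; under [RHS]eq_bigr => v _ do rewrite rmorph_sum /= mulr_sumr.
  rewrite exchange_big; apply: eq_bigr => j _; rewrite /c -sumrB; apply: eq_bigr => v _.
  by rewrite -mulrBr -rmorphB.
(* Every crossing edge is moved to the reference edge [r k]. What accumulates there is the flux
   through the whole boundary, an integer by [flux_int], so the boundary of the chain agrees with
   [phi] modulo 1. *)
have -> : \sum_(v <- edges k) (exits (n k) v)%:~R * phi v.2 (act v.1 z) * (bd (A k v) q i)%:~R =
   \sum_(v <- edges k) (((q, i) == v)%:R * ((exits (n k) v)%:~R ^+ 2 * phi v.2 (act v.1 z))) -
   (exits (n k) (r k) * ((q, i) == r k)%:R)%:~R *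
     \sum_(v <- edges k) (exits (n k) v)%:~R * phi v.2 (act v.1 z).
  rewrite mulr_sumr -sumrB; apply: eq_bigr => v _.
  have [->|hv] := eqVneq (exits (n k) v) 0; first by rewrite !mulr0z expr0n /= !(mul0r, mulr0) subrr.
  have [_ /(_ hv _ he) ->] := hA k v.
  move: (exits (n k) v) (exits (n k) (r k)) => a b; rewrite rmorphB /= !rmorphM /= !rmorph_nat; ring.
have -> : \sum_(v <- edges k) (((q, i) == v)%:R * ((exits (n k) v)%:~R ^+ 2 * phi v.2 (act v.1 z))) =
    phi i (act q z).
  rewrite (bigD1_seq (q, i)) ?exits_edges //= eqxx mul1r big1 => [|v /negbTE vq]; last first.
    by rewrite eq_sym vq mul0r.
  rewrite addr0; suff -> : ((exits (n k) (q, i))%:~R ^+ 2 : R) = 1 by rewrite mul1r.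
  move: he; rewrite /exits /=.
  by case: (q \in _); case: (_ \in _) => //= _; rewrite ?subr0 ?sub0r ?rmorphN ?sqrrN expr1n.
rewrite opprB addrCA subrr addr0; apply: rpredM; [exact: intr_int|exact: flux_int].
Qed.

Let crossesC k u i j : crosses k u i j = crosses k u j i.
Proof.
have e b : vert u i j b = vert u j i (b.2, b.1) by rewrite /vert addrAC.
have e' b : vert u j i b = vert u i j (b.2, b.1) by rewrite /vert addrAC.
rewrite /crosses; congr (_ && _); apply/existsP/existsP => -[b hb]; exists (b.2, b.1);
  by rewrite -?e -?e'.
Qed.

Let exits_crosses k u i j : i != j -> exits (n k) (u, i) != 0 ->
  crosses k u i j /\ crosses k (u - unitv j) i j.
Proof.
move=> ij; rewrite /exits /=.
have v00 : vert u i j (false, false) = u by rewrite /vert !mulr0n !addr0.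
have v10 : vert u i j (true, false) = u + unitv i by rewrite /vert mulr0n mulr1n addr0.
have v01 : vert (u - unitv j) i j (false, true) = u by rewrite /vert mulr0n mulr1n addr0 subrK.
have v11 : vert (u - unitv j) i j (true, true) = u + unitv i.
  by rewrite /vert !mulr1n addrAC subrK.
case: (boolP (u \in _)) => h1; case: (boolP (u + _ \in _)) => h2 // _; split; apply/andP; split; apply/existsP.
- by exists (false, false); rewrite v00.
- by exists (true, false); rewrite v10.
- by exists (false, true); rewrite v01.
- by exists (true, true); rewrite v11.
- by exists (true, false); rewrite v10.
- by exists (false, false); rewrite v00.
- by exists (true, true); rewrite v11.
- by exists (false, true); rewrite v01.
Qed.

(** The boundary of a 2-chain with values in [-1, 1] is subtracted from [phi]. This preserves the
    divergence and changes each edge by at most [d * 2], and the chain is chosen so that on edges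
    leaving a class its boundary is [phi] modulo 1. *)
Lemma flow_rounding_connected : exists psi : 'I_d -> X -> R,
  [/\ forall i, measurable_fun setT (psi i),
      forall i x, `|psi i x| <= C + d%:R * 2,
      forall x, divergence psi x = divergence phi x &
      forall i x, ~ same_boxes act n U (unitv i) x -> psi i x \is a Num.int].
Proof.
have [c [mc altc hc]] := exchain.
pose P (i j : 'I_d) (o : option (nat * V)) (x : X) : Prop :=
  if o is Some ku then U ku.1 (act (- ku.2) x) /\ crosses ku.1 ku.2 i j
  else forall k u, U k (act (- u) x) -> ~ crosses k u i j.
have exsel i j : exists h : X -> option (nat * V), dmeas h /\ forall x, P i j (h x) x.
  apply: dmeas_select => [[[k u]|]|x] /=.
  - by apply: mp_and; [exact: (mp_comp (mact (- u)) (mU k))|exact: mp_cst].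
  - apply: mp_forall => k; apply: mp_forall => u; apply: mp_imp; last exact: mp_cst.
    exact: (mp_comp (mact (- u)) (mU k)).
  have [[[k u] h]|h] := pselect (exists ku : nat * V, U ku.1 (act (- ku.2) x) /\ crosses ku.1 ku.2 i j).
    by exists (Some (k, u)).
  by exists None => k u Uk ck; apply: h; exists (k, u).
pose sel i j := sval (cid (exsel i j)).
have [msel selP] : (forall i j, dmeas (sel i j)) /\ (forall i j x, P i j (sel i j x) x).
  by split=> i j; have [] := svalP (cid (exsel i j)).
(* The chain [c] sums over all crossing edges of a box and is not bounded uniformly in the level.
   Its fractional part is bounded, and an integral change of the chain does not affect its boundary
   modulo 1. *)
pose val i j (o : option (nat * V)) (x : X) : R :=
  if o is Some ku then frac (c ku.1 (act (- ku.2) x) ku.2 i j) else 0.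
pose tau x i j := val i j (sel i j x) x.
have mtau i j : measurable_fun setT (fun x => tau x i j).
  apply: (measurable_glue (msel i j)) => -[[k u]|]; last exact: measurable_cst.
  apply: measurable_funB.
    exact: (measurableT_comp (mc k u i j) (mact (- u))).
  apply: (@measurable_dmeas _ _ _ _ _ (fun z : int => z%:~R)); apply: dmeas_floor.
  exact: (measurableT_comp (mc k u i j) (mact (- u))).
pose t x (i j : 'I_d) := if (i < j)%N then tau x i j else if (j < i)%N then - tau x j i else 0.
have tC x i j : t x j i = - t x i j.
  by rewrite /t; case: (ltngtP i j) => //; rewrite ?opprK ?oppr0.
have mt i j : measurable_fun setT (fun x => t x i j).
  rewrite /t; case: (i < j)%N; first exact: mtau.
  by case: (j < i)%N; [exact: measurableT_comp|exact: measurable_cst].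
have tau_le x i j : 0 <= tau x i j <= 1.
  by rewrite /tau /val; case: (sel i j x) => [ku|]; rewrite ?frac_le // lexx ler01.
have t_le x i j : `|t x i j| <= 1.
  rewrite /t; case: ifP => _; first by have /andP[h1 h2] := tau_le x i j; rewrite ger0_norm.
  case: ifP => _; last by rewrite normr0.
  by have /andP[h1 h2] := tau_le x j i; rewrite normrN ger0_norm.
have tauE x i j k u : i != j -> U k (act (- u) x) -> crosses k u i j ->
    c k (act (- u) x) u i j - tau x i j \is a Num.int.
  move=> ij Uk ck; have := selP i j x; rewrite /tau.
  case: (sel i j x) => [[k' u'] [Uk' ck']|/(_ k u Uk)//] /=.
  have [-> ->] : (k', u') = (k, u) by exact: (@crosses_uniq x i j).
  exact: frac_int.
have tE x i j k u : i != j -> U k (act (- u) x) -> crosses k u i j ->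
    c k (act (- u) x) u i j - t x i j \is a Num.int.
  move=> ij Uk ck; rewrite /t; case: (ltngtP i j) => [_|_|/val_inj e]; first exact: tauE.
    rewrite (altc k _ u j i) -opprD rpredN; apply: tauE => //; first by rewrite eq_sym.
    by rewrite crossesC.
  by rewrite e eqxx in ij.
exists (fun i x => phi i x - \sum_j (t x i j - t (act (- unitv j) x) i j)); split.
- move=> i; apply: measurable_funB => //; apply: measurable_sum => j.
  by apply: measurable_funB => //; exact: (measurableT_comp (mt i j) (mact _)).
- move=> i x; apply: le_trans (ler_normB _ _) _; apply: lerD; first exact: phiC.
  apply: le_trans (ler_norm_sum _ _ _) _.
  rewrite -[X in X%:R * _](card_ord d) mulr_natl -sumr_const; apply: ler_sum => j _.
  by apply: le_trans (ler_normB _ _) _; exact: lerD.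
- move=> x; rewrite /divergence.
  transitivity (\sum_i (phi i x - phi i (act (- unitv i) x)) -
    \sum_i (\sum_j (t x i j - t (act (- unitv j) x) i j) -
            \sum_j (t (act (- unitv i) x) i j - t (act (- unitv j) (act (- unitv i) x)) i j))).
    by rewrite -sumrB; apply: eq_bigr => i _; ring.
  suff -> : \sum_i (\sum_j (t x i j - t (act (- unitv j) x) i j) -
      \sum_j (t (act (- unitv i) x) i j - t (act (- unitv j) (act (- unitv i) x)) i j)) = 0 by rewrite subr0.
  pose S := \sum_i \sum_j (t x i j - t (act (- unitv j) x) i j - t (act (- unitv i) x) i j +
     t (act (- unitv j - unitv i) x) i j).
  transitivity S.
    by apply: eq_bigr => i _; rewrite -sumrB; apply: eq_bigr => j _; rewrite opprB addrA -actD addrAC.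
  (* The boundary of a boundary vanishes: exchanging [i] and [j] reverses the sign. *)
  have : S = - S.
    rewrite {1}/S exchange_big -sumrN; apply: eq_bigr => i _; rewrite -sumrN; apply: eq_bigr => j _.
    by rewrite !(tC _ i j) (addrC (- unitv i)); ring.
  by move=> /eqP; rewrite -subr_eq0 opprK -mulr2n mulrn_eq0 => /eqP.
- move=> i x; rewrite /same_boxes => /existsNP[k] /existsNP[u] /not_implyP[Uk hu].
  have ex : exits (n k) (u, i) != 0.
    by move: hu; rewrite /exits /=; case: (u \in _); case: (u + _ \in _).
  set z := act (- u) x in Uk.
  have xz : x = act u z by rewrite -actD subrr act0.
  have -> : phi i x - \sum_j (t x i j - t (act (- unitv j) x) i j) =
    (phi i x - bd (c k z) u i) +
    \sum_j ((c k z u i j - t x i j) - (c k z (u - unitv j) i j - t (act (- unitv j) x) i j)).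
    transitivity (phi i x - bd (c k z) u i + (bd (c k z) u i -
      \sum_j (t x i j - t (act (- unitv j) x) i j))); first by ring.
    congr (_ + _); rewrite /bd -sumrB; apply: eq_bigr => j _; ring.
  apply: rpredD; first by rewrite {1}xz; exact: hc.
  apply: rpred_sum => j _; have [<-|ij] := eqVneq i j.
    have c0 q : c k z q i i = 0.
      by have /eqP := altc k z q i i; rewrite -subr_eq0 opprK -mulr2n mulrn_eq0 => /eqP.
    by rewrite !c0 /t !ltnn !subrr rpred0.
  have [c1 c2] := exits_crosses ij ex.
  have ez : act (- (u - unitv j)) (act (- unitv j) x) = z by rewrite -actD opprB addrAC subrr add0r.
  apply: rpredB; first exact: tE.
  by have := @tE (act (- unitv j) x) i j k (u - unitv j) ij; rewrite ez; apply.
Qed.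

End Connected.

(** For [d = 1] the divergence is a difference of two values of [phi]; being integral, it leaves the
    fractional part of [phi] constant along orbits, so rounding down preserves the divergence. This
    costs the extra [+ 1]. *)
Lemma flow_rounding : exists psi : 'I_d -> X -> R,
  [/\ forall i, measurable_fun setT (psi i),
      forall i x, `|psi i x| <= C + d%:R * 2 + 1,
      forall x, divergence psi x = divergence phi x &
      forall i x, ~ same_boxes act n U (unitv i) x -> psi i x \is a Num.int].
Proof.
case: (ltnP 1 d) => [/flow_rounding_connected[psi [h1 h2 h3 h4]]|d1].
  by exists psi; split=> // i x; apply: le_trans (h2 i x) _; rewrite lerDl.
have ij (i j : 'I_d) : j = i by apply/val_inj; have := ltn_ord i; have := ltn_ord j => /=; lia.
have divE (F : 'I_d -> X -> R) i x : divergence F x = F i x - F i (act (- unitv i) x).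
  by rewrite /divergence (bigD1 i) //= big1 ?addr0 // => j /eqP[]; exact: ij.
exists (fun i x => (Num.floor (phi i x))%:~R); split.
- move=> i; apply: (@measurable_dmeas _ _ _ _ _ (fun z : int => z%:~R)); exact: dmeas_floor.
- move=> i x; have : `|phi i x - frac (phi i x)| <= C + 1.
    apply: le_trans (ler_normB _ _) _; apply: lerD => //.
    by have /andP[? ?] := frac_le (phi i x); rewrite ger0_norm.
  rewrite /frac opprB addrC subrK => /le_trans; apply.
  by rewrite lerD2r lerDl mulr_ge0.
- move=> x; have [[i _]|h] := pselect (exists i : 'I_d, True); last first.
    by rewrite /divergence !big1 // => i; case: h; exists i.
  rewrite !(divE _ i); have := phi_div x; rewrite (divE _ i) => /intrP[z e].
  have -> : phi i x = phi i (act (- unitv i) x) + z%:~R by rewrite -e addrC subrK.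
  by rewrite floorDrz ?intr_int // intrKfloor rmorphD /=; ring.
- by move=> i x _; exact: intr_int.
Qed.

End FlowRounding.

(** * Measurable fractional matchings *)

Section BoundedExpectation.
Context {dX : measure_display} {X : measurableType dX} {R : realType}.
Variable mu : probability X R.
Implicit Types g h : X -> R.

(** On these functions [ev] is a genuine real number, and its additivity comes from the integral of
    nonnegative functions. *)
Definition bdd g := [/\ measurable_fun setT g, forall x, 0 <= g x & exists c, forall x, g x <= c].
Definition ev g : R := fine (\int[mu]_x (g x)%:E).

Lemma bddD g h : bdd g -> bdd h -> bdd (fun x => g x + h x).
Proof.
move=> [mg g0 [b hb]] [mh h0 [c hc]]; split; first exact: measurable_funD.
  by move=> x; rewrite addr_ge0.
by exists (b + c) => x; exact: lerD.
Qed.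

Lemma bddZ (k : R) g : 0 <= k -> bdd g -> bdd (fun x => k * g x).
Proof.
move=> k0 [mg g0 [b hb]]; split; first by apply: measurable_funM => //; exact: measurable_cst.
  by move=> x; rewrite mulr_ge0.
by exists (k * b) => x; exact: ler_wpM2l.
Qed.

Lemma bdd_cst (k : R) : 0 <= k -> bdd (fun=> k).
Proof. by move=> k0; split=> //; exists k. Qed.

Lemma bdd_sum (I : Type) (s : seq I) (G : I -> X -> R) :
  (forall i, bdd (G i)) -> bdd (fun x => \sum_(i <- s) G i x).
Proof.
move=> hG; elim: s => [|i s IH].
  by under eq_fun do [rewrite big_nil]; apply: bdd_cst.
by under eq_fun do [rewrite big_cons]; apply: bddD.
Qed.

Lemma bdd_pred (P : X -> Prop) : mp P -> bdd (fun x => (`[< P x >])%:R).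
Proof.
move=> mP; split; first exact: measurable_pred.
  by move=> x; rewrite ler0n.
by exists 1 => x; case: (`[< _ >]); rewrite ?lexx ?ler01.
Qed.

Let mE g : measurable_fun setT g -> measurable_fun setT (fun x => (g x)%:E).
Proof. by move=> mg; apply/measurable_EFinP. Qed.

Let int_cst (k : R) : (\int[mu]_x (cst k%:E x) = k%:E)%E.
Proof.
rewrite integral_cst // -[RHS]mule1; congr (_ * _)%E; exact: probability_setT.
Qed.

Lemma evE g : bdd g -> (\int[mu]_x (g x)%:E)%E = (ev g)%:E.
Proof.
move=> [mg g0 [c hc]]; rewrite /ev fineK // ge0_fin_numE; last first.
  by apply: integral_ge0 => x _; rewrite lee_fin.
apply: (@le_lt_trans _ _ (\int[mu]_x (cst c%:E) x)%E).
  apply: (@ge0_le_integral _ _ _ mu setT measurableT); [by move=> x _; rewrite lee_fin|exact: mE|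
    exact: measurable_cst|by move=> x _; rewrite lee_fin].
by rewrite int_cst ltry.
Qed.

Lemma ev_ge0 g : (forall x, 0 <= g x) -> 0 <= ev g.
Proof. by move=> g0; rewrite fine_ge0 // integral_ge0 // => x _; rewrite lee_fin. Qed.

Lemma evD g h : bdd g -> bdd h -> ev (fun x => g x + h x) = ev g + ev h.
Proof.
move=> bg bh; apply/EFin_inj; rewrite EFinD -!evE //; last exact: bddD.
have [mg g0 _] := bg; have [mh h0 _] := bh.
under eq_integral do rewrite EFinD.
by apply: (@ge0_integralD _ _ _ mu setT measurableT); [by move=> x _; rewrite lee_fin|exact: mE|
  by move=> x _; rewrite lee_fin|exact: mE].
Qed.

Lemma evZ (k : R) g : 0 <= k -> bdd g -> ev (fun x => k * g x) = k * ev g.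
Proof.
move=> k0 bg; apply/EFin_inj; rewrite EFinM -!evE //; last exact: bddZ.
have [mg g0 _] := bg.
under eq_integral do rewrite EFinM.
by apply: (@ge0_integralZl_EFin _ _ _ mu setT measurableT) => //; [by move=> x _; rewrite lee_fin|exact: mE].
Qed.

Lemma ev_le g h : bdd g -> bdd h -> (forall x, g x <= h x) -> ev g <= ev h.
Proof.
move=> bg bh gh; rewrite -lee_fin -!evE //.
have [mg g0 _] := bg; have [mh h0 _] := bh.
by apply: (@ge0_le_integral _ _ _ mu setT measurableT); [by move=> x _; rewrite lee_fin|exact: mE|exact: mE|
  by move=> x _; rewrite lee_fin].
Qed.

Lemma ev_cst (k : R) : 0 <= k -> ev (fun=> k) = k.
Proof.
move=> k0; apply/EFin_inj; rewrite -evE; last exact: bdd_cst.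
exact: int_cst.
Qed.

Lemma ev_sum (I : Type) (s : seq I) (G : I -> X -> R) :
  (forall i, bdd (G i)) -> ev (fun x => \sum_(i <- s) G i x) = \sum_(i <- s) ev (G i).
Proof.
move=> hG; elim: s => [|i s IH].
  by under eq_fun do [rewrite big_nil]; rewrite ev_cst // big_nil.
under eq_fun do [rewrite big_cons]; rewrite evD ?IH ?big_cons //; exact: bdd_sum.
Qed.

Lemma ev_pred (P : X -> Prop) : mp P -> ev (fun x => (`[< P x >])%:R) = pr mu P.
Proof.
move=> mP; rewrite /ev /pr; congr fine.
have := integral_indic mu measurableT mP; rewrite setIT => <-.
by apply: eq_integral => x _; rewrite /= indicE.
Qed.

Lemma ev_markov g (t : R) : bdd g -> 0 < t -> t * pr mu (fun x => t <= g x) <= ev g.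
Proof.
move=> bg t0; have [mg g0 _] := bg.
have mt : mp (fun x => t <= g x) by apply: mp_le => //; exact: measurable_cst.
rewrite -ev_pred // -evZ ?(ltW t0) //; last exact: bdd_pred.
apply: ev_le => //; first by apply: bddZ; [exact: ltW|exact: bdd_pred].
by move=> x; case: asboolP; rewrite ?mulr1 ?mulr0.
Qed.

Lemma ev_act (T : X -> X) g : measurable_fun setT T ->
  (forall B, measurable B -> mu (T @^-1` B) = mu B) -> bdd g -> ev (fun x => g (T x)) = ev g.
Proof.
move=> mT pT [mg g0 _]; rewrite /ev; congr fine.
rewrite -[LHS]/(\int[mu]_(x in T @^-1` setT) ((fun y => (g y)%:E) \o T) x)%E.
rewrite -(ge0_integral_pushforward mT mu) //; last 2 first.
- exact: mE.
- by move=> x _; rewrite lee_fin.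
by apply: eq_measure_integral => B mB _; exact: pT.
Qed.

End BoundedExpectation.

(** Adding [4 * 2^-1 ^+ j], the tail of the series of step bounds, makes the sequence nonincreasing
    and keeps it bounded below. *)
Lemma cvg_of_summable_steps (R : realType) (u : nat -> R) (K : nat) :
  (forall j, 0 <= u j) -> (forall j, (K <= j)%N -> `|u j - u j.+1| <= 2 * 2^-1 ^+ j) -> cvgn u.
Proof.
move=> u0 hu; pose v j := u (j + K)%N + 4 * 2^-1 ^+ (j + K).
have cv : cvgn v.
  apply: nonincreasing_is_cvgn; last first.
    by exists 0 => _ [j _ <-]; rewrite addr_ge0 // mulr_ge0 // exprn_ge0 // invr_ge0.
  apply/nonincreasing_seqP => j; rewrite /v addSn.
  have := hu (j + K)%N (leq_addl _ _); rewrite ler_norml => /andP[h _].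
  rewrite exprS; move: h; move: (u _) (u _) (2^-1 ^+ _) => a b c; lra.
have cg : (fun j => 4 * 2^-1 ^+ (j + K)) x @[x --> \oo] --> (0 : R).
  have -> : (0 : R) = 4 * 0 by rewrite mulr0.
  apply: cvgMr; have := @cvg_expr R 2^-1; rewrite -(cvg_shiftn K (fun j => (2^-1 : R) ^+ j)).
  by apply; rewrite ger0_norm ?invr_ge0 //; lra.
have cs : (fun j => u (j + K)%N) x @[x --> \oo] --> limn v.
  have -> : (fun j => u (j + K)%N) = (fun j => v j - 4 * 2^-1 ^+ (j + K)).
    by apply/funext => j; rewrite /v addrK.
  by rewrite -[limn v]subr0; apply: cvgB.
apply/cvg_ex; exists (limn v).
by rewrite -(cvg_shiftn K u).
Qed.

(** * Almost everywhere limits of near-minimisers *)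

Section QuadraticLimit.
Context {dX : measure_display} {X : measurableType dX} {R : realType}.
Variables (mu : probability X R) (I : finType) (F : nat -> (I -> X -> R) -> Prop).
Hypotheses (F_meas : forall n w, F n w -> forall i, measurable_fun setT (w i) /\ forall x, 0 <= w i x <= 1)
  (F_anti : forall n w, F n.+1 w -> F n w)
  (F_mid : forall n w w', F n w -> F n w' -> F n (fun i x => (w i x + w' i x) / 2))
  (F_ex : forall n, exists w, F n w).

Let q (w : I -> X -> R) x := \sum_i w i x ^+ 2.
Let bq (w : I -> X -> R) : (forall i, measurable_fun setT (w i)) -> (forall i x, `|w i x| <= 1) -> bdd (q w).
Proof.
move=> mw hw; apply: bdd_sum => i; split.
- by apply: measurable_funX.
- by move=> x; rewrite sqr_ge0.
- by exists 1 => x; rewrite -real_normK ?num_real // expr_le1.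
Qed.

Let bqF n w : F n w -> bdd (q w).
Proof.
move=> /F_meas h; apply: bq => [i|i x]; have [mw hw] := h i => //.
by have /andP[? ?] := hw x; rewrite ger0_norm.
Qed.

Let F_le m n w : (m <= n)%N -> F n w -> F m w.
Proof. by move=> mn; rewrite -(subnK mn); elim: (n - m)%N => // k IH /F_anti. Qed.

Let parallelogram n w w' : F n w -> F n w' ->
  ev mu (q (fun i x => (w i x - w' i x) / 2)) =
  (ev mu (q w) + ev mu (q w')) / 2 - ev mu (q (fun i x => (w i x + w' i x) / 2)).
Proof.
move=> hw hw'; have hm := F_mid hw hw'.
have bd : bdd (q (fun i x => (w i x - w' i x) / 2)).
  apply: bq => [i|i x]; have [m1 h1] := F_meas hw i; have [m2 h2] := F_meas hw' i.
    by apply: measurable_funM; [exact: measurable_funB|exact: measurable_cst].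
  have /andP[? ?] := h1 x; have /andP[? ?] := h2 x; rewrite ler_norml; apply/andP; split; lra.
apply/eqP; rewrite eq_sym subr_eq; apply/eqP.
rewrite -(evD mu bd (bqF hm)) -(evD mu (bqF hw) (bqF hw')) mulrC -evZ ?invr_ge0 //; last first.
  by apply: bddD; [exact: bqF hw|exact: bqF hw'].
congr (ev mu _); apply/funext => x; rewrite /q -!big_split mulr_sumr /=.
by apply: eq_bigr => i _; field.
Qed.

(* Near-minimisers of the quadratic energy over a decreasing sequence of convex
   sets are Cauchy, by the parallelogram law. *)
Lemma quadratic_limit : exists (W : nat -> I -> X -> R) (w : I -> X -> R) (Z : X -> Prop),
  [/\ forall n, F n (W n), forall i, measurable_fun setT (w i),
      mp Z, mu [set x | ~ Z x] = 0 &
      forall x, Z x -> forall i, (fun n => W n i x) @ \oo --> w i x].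
Proof.
pose En n := [set ev mu (q w) | w in F n].
have En0 n : En n !=set0 by have [w hw] := F_ex n; exists (ev mu (q w)); exists w.
have Elb n : has_lbound (En n).
  by exists 0 => _ [w _ <-]; apply: ev_ge0 => x; apply: sumr_ge0 => i _; exact: sqr_ge0.
have Eub n : inf (En n) <= #|I|%:R.
  have [w hw] := F_ex n; apply: (@le_trans _ _ (ev mu (q w))); first by apply: ge_inf => //; exists w.
  rewrite -(ev_cst mu (ler0n R #|I|)); apply: ev_le; [exact: bqF hw|exact: bdd_cst|].
  move=> x; rewrite /q -sum1_card natr_sum; apply: ler_sum => i _.
  by have [_ /(_ x)/andP[? ?]] := F_meas hw i; rewrite expr_le1.
pose es := [set inf (En n) | n in setT].
have hes : has_sup es.
  split; first by exists (inf (En 0%N)); exists 0%N.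
  by exists #|I|%:R => _ [n _ <-].
(* Energy gaps 8^-j against the threshold 4^-j in Markov's inequality give exceptional sets of
   measure O(2^-j), while outside them the steps are O(2^-j): both series converge. *)
pose e := sup es; pose del j : R := 8^-1 ^+ j.
have del0 j : 0 < del j by rewrite exprn_gt0 // invr_gt0.
have exN j : exists N, e - del j < inf (En N).
  by have [_ [N _ <-] h] := sup_adherent (del0 j) hes; exists N.
have le_e n : inf (En n) <= e by apply: sup_upper_bound => //; exists n.
have inf_mono m n : (m <= n)%N -> inf (En m) <= inf (En n).
  move=> mn; apply: lb_le_inf => // _ [w hw <-]; apply: ge_inf => //.
  by exists w => //; exact: F_le hw.
have exM j : exists Mw : nat * (I -> X -> R),
    [/\ (j <= Mw.1)%N, e - del j < inf (En Mw.1), F Mw.1 Mw.2 & ev mu (q Mw.2) <= e + del j].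
  have [N hN] := exN j; pose M := maxn N j.
  have hinf : has_inf (En M) by split.
  have [_ [w hw <-] h] := inf_adherent (del0 j) hinf.
  exists (M, w); split=> //=; first exact: leq_maxr.
    by apply: lt_le_trans hN _; apply: inf_mono; exact: leq_maxl.
  by apply: le_trans (ltW h) _; rewrite lerD2r.
pose M j := (sval (cid (exM j))).1; pose W j := (sval (cid (exM j))).2.
have MW j : [/\ (j <= M j)%N, e - del j < inf (En (M j)), F (M j) (W j) & ev mu (q (W j)) <= e + del j].
  exact: (svalP (cid (exM j))).
have FW j : F j (W j) by have [h _ + _] := MW j; exact: F_le.
have mW j i : measurable_fun setT (W j i) by have [] := F_meas (FW j) i.
have W01 j i x : 0 <= W j i x <= 1 by have [] := F_meas (FW j) i.
have step j : ev mu (q (fun i x => (W j i x - W j.+1 i x) / 2)) <= 2 * del j.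
  have [_ i1 f1 e1] := MW j; have [_ i2 f2 e2] := MW j.+1.
  have dd : del j.+1 <= del j by rewrite /del exprS ler_piMl ?exprn_ge0 ?invr_ge0 // invf_le1 // ler1n.
  (* Both near-minimisers, hence also their midpoint, lie in the larger set [F N], whose infimum is
     still at least [e - del j]. *)
  pose N := minn (M j) (M j.+1).
  have iN : e - del j <= inf (En N).
    rewrite /N /minn; case: ifP => _; first exact: ltW.
    by apply: le_trans (ltW i2); rewrite lerD2l lerN2.
  have g1 : F N (W j) by apply: F_le f1; exact: geq_minl.
  have g2 : F N (W j.+1) by apply: F_le f2; exact: geq_minr.
  rewrite (parallelogram g1 g2).
  have : inf (En N) <= ev mu (q (fun i x => (W j i x + W j.+1 i x) / 2)).
    by apply: ge_inf => //; eexists; first exact: (F_mid g1 g2).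
  by move: (ev _ _) (ev _ _) (ev _ _) e1 e2 => a b c; lra.
pose bad j x := 4^-1 ^+ j <= q (fun i x => (W j i x - W j.+1 i x) / 2) x.
have bqd j : bdd (q (fun i x => (W j i x - W j.+1 i x) / 2)).
  apply: bq => [i|i x].
    by apply: measurable_funM; [exact: measurable_funB|exact: measurable_cst].
  have /andP[? ?] := W01 j i x; have /andP[? ?] := W01 j.+1 i x.
  by rewrite ler_norml; apply/andP; split; lra.
have mbad j : mp (bad j).
  by have [m1 _ _] := bqd j; apply: mp_le => //; exact: measurable_cst.
have bad_le j : pr mu (bad j) <= 2 * 2^-1 ^+ j.
  have c0 : 0 < (4^-1 : R) ^+ j by rewrite exprn_gt0 // invr_gt0.
  have := le_trans (ev_markov mu (bqd j) c0) (step j).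
  rewrite -ler_pdivlMl // => /le_trans; apply.
  rewrite le_eqVlt; apply/orP; left; apply/eqP.
  rewrite /del mulrCA; congr (2 * _); rewrite -exprVn invrK -exprMn; congr (_ ^+ j).
  by field.
have tail_le K : pr mu (fun x => exists j, bad (j + K)%N x) <= 4 * 2^-1 ^+ K.
  apply: pr_exists_le => // n.
  suff : pr mu (fun x => exists2 j, (j < n)%N & bad (j + K)%N x) <= 4 * 2^-1 ^+ K * (1 - 2^-1 ^+ n).
    move=> /le_trans; apply; have a0 : 0 <= (2^-1 : R) ^+ K by rewrite exprn_ge0 // invr_ge0.
    have b0 : 0 <= (2^-1 : R) ^+ n by rewrite exprn_ge0 // invr_ge0.
    by rewrite -[leRHS]mulr1 ler_wpM2l ?mulr_ge0 // gerBl.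
  elim: n => [|n IH]; first by rewrite expr0 subrr mulr0 pr_false // => x [].
  have mn : mp (fun x => exists2 j, (j < n)%N & bad (j + K)%N x).
    apply: (@mp_ext _ _ (fun x => exists j, (j < n)%N /\ bad (j + K)%N x)).
      by move=> x; split=> [[j [? ?]]|[j ? ?]]; exists j.
    by apply: mp_exists => j; apply: mp_and => //; exact: mp_cst.
  rewrite (@pr_ext _ _ _ _ _ (fun x => (exists2 j, (j < n)%N & bad (j + K)%N x) \/ bad (n + K)%N x)); last first.
    move=> x; split=> [[j]|[[j jn bj]|bn]].
    - by rewrite ltnS leq_eqVlt => /orP[/eqP->|jn] bj; [right|left; exists j].
    - by exists j => //; exact: leqW.
    - by exists n.
  apply: le_trans (pr_or mu mn (mbad _)) _; apply: le_trans (lerD IH (bad_le _)) _.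
  rewrite exprD exprS; move: (2^-1 ^+ n) (2^-1 ^+ K) => a b.
  by rewrite le_eqVlt; apply/orP; left; apply/eqP; field.
pose Z x := exists K, forall j, ~ bad (j + K)%N x.
have mZ : mp Z by apply: mp_exists => K; apply: mp_forall => j; exact: mp_not.
have Z1 : pr mu (fun x => ~ Z x) = 0.
  apply/eqP; rewrite eq_le pr_ge0 andbT.
  have h K : pr mu (fun x => ~ Z x) <= 4 * 2^-1 ^+ K.
    apply: le_trans (tail_le K); apply: pr_le; first exact: mp_not.
      exact: mp_exists.
    by move=> x; rewrite /Z => /forallNP/(_ K)/existsNP[j /contrapT]; exists j.
  have cg : (fun K => 4 * 2^-1 ^+ K) x @[x --> \oo] --> (0 : R).
    have -> : (0 : R) = 4 * 0 by rewrite mulr0.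
    apply: cvgMr; apply: cvg_expr; rewrite ger0_norm ?invr_ge0 //; lra.
  rewrite -(cvg_lim _ cg) //; apply: limr_ge; last exact: nearW.
  by apply/cvg_ex; exists 0.
have cvgZ x i : Z x -> cvgn (fun n => W n i x).
  move=> [K hK]; apply: (@cvg_of_summable_steps _ _ K) => j; first by have /andP[] := W01 j i x.
  move=> Kj; have := hK (j - K)%N; rewrite subnK // => /negP; rewrite -ltNge => hlt.
  have h2 : ((W j i x - W j.+1 i x) / 2) ^+ 2 <= (2^-1 ^+ j) ^+ 2.
    rewrite -exprM mulnC exprM; have -> : (2^-1 : R) ^+ 2 = 4^-1 by field.
    apply: le_trans (ltW hlt); rewrite /q (bigD1 i) //= lerDl.
    by apply: sumr_ge0 => k _; exact: sqr_ge0.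
  have a0 : 0 <= (2^-1 : R) ^+ j by rewrite exprn_ge0 // invr_ge0.
  move: h2; rewrite -[X in X <= _]real_normK ?num_real // ler_sqr ?nnegrE //.
  by rewrite normrM (@ger0_norm _ (2^-1)) ?invr_ge0 // ler_pdivrMr // mulrC.
exists W, (fun i x => if `[< Z x >] then limn (fun n => W n i x) else 0), Z; split=> //.
- move=> i.
  apply: (@measurable_fun_cvg _ _ _ setT (fun n x => (`[< Z x >])%:R * W n i x)).
    by move=> n; apply: measurable_funM => //; exact: measurable_pred.
  move=> x _; case: asboolP => Zx; last first.
    by under eq_fun do rewrite mul0r; exact: cvg_cst.
  by under eq_fun do rewrite mul1r; exact: cvgZ.
- by rewrite [LHS](prE mu (mp_not mZ)) Z1.
- by move=> x Zx i; rewrite asboolT //; exact: cvgZ.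
Qed.

End QuadraticLimit.

Lemma cvg_finsum (R : realType) (I : Type) (s : seq I) (u : nat -> I -> R) (l : I -> R) :
  (forall i, (fun n => u n i) @ \oo --> l i) ->
  (fun n => \sum_(i <- s) u n i) @ \oo --> \sum_(i <- s) l i.
Proof.
move=> h; elim: s => [|i s IH].
  by rewrite big_nil; under eq_fun do [rewrite big_nil]; exact: cvg_cst.
by rewrite big_cons; under eq_fun do [rewrite big_cons]; exact: (cvgD (h i) IH).
Qed.

HB.instance Definition _ (d : nat) (Delta : finZmodType) := GRing.Zmodule.on (Grp d Delta).
HB.instance Definition _ (d : nat) (Delta : finZmodType) := Countable.on (Grp d Delta).

Section InvariantCore.
Context {dX : measure_display} {X : measurableType dX} {R : realType} {G : countZmodType}.
Variables (mu : probability X R) (act : G -> X -> X).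
Hypotheses (act0 : forall x, act 0 x = x)
  (actD : forall g h x, act (g + h) x = act g (act h x))
  (mact : forall g, measurable_fun setT (act g))
  (pact : forall g (B : set X), measurable B -> mu (act g @^-1` B) = mu B).

Lemma pr_not_forall0 (T : countType) (P : T -> X -> Prop) : (forall t, mp (P t)) ->
  (forall t, pr mu (fun x => ~ P t x) = 0) -> pr mu (fun x => ~ forall t, P t x) = 0.
Proof.
move=> mP P0; apply/eqP; rewrite eq_le pr_ge0 andbT.
pose Q n x := if choice.unpickle n is Some t then ~ P t x else False.
have mQ n : mp (Q n).
  by rewrite /Q; case: choice.unpickle => [t|]; [exact: mp_not|exact: mp_cst].
rewrite (@pr_ext _ _ _ _ _ (fun x => exists n, Q n x)); last first.
  move=> x; split=> [/existsNP[t nP]|[n]].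
    by exists (choice.pickle t); rewrite /Q choice.pickleK.
  by rewrite /Q; case: choice.unpickle => // t nP /(_ t).
apply: pr_exists_le => // n; elim: n => [|n IH]; first by rewrite pr_false // => x [].
have mn : mp (fun x => exists2 j, (j < n)%N & Q j x).
  apply: (@mp_ext _ _ (fun x => exists j, (j < n)%N /\ Q j x)).
    by move=> x; split=> [[j [? ?]]|[j ? ?]]; exists j.
  by apply: mp_exists => j; apply: mp_and => //; exact: mp_cst.
rewrite (@pr_ext _ _ _ _ _ (fun x => (exists2 j, (j < n)%N & Q j x) \/ Q n x)); last first.
  move=> x; split=> [[j]|[[j jn bj]|bn]].
  - by rewrite ltnS leq_eqVlt => /orP[/eqP->|jn] bj; [right|left; exists j].
  - by exists j => //; exact: leqW.
  - by exists n.
apply: le_trans (pr_or mu mn (mQ n)) _; rewrite -[leRHS]addr0; apply: lerD => //.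
suff -> : pr mu (fun x => Q n x) = 0 by exact: lexx.
by rewrite /Q; case: choice.unpickle => [t|]; [exact: P0|by apply: pr_false => x []].
Qed.

(** The intersection of all translates of [Z]; the group is countable. *)
Lemma invariant_core (Z : X -> Prop) : mp Z -> pr mu (fun x => ~ Z x) = 0 ->
  exists Y : X -> Prop, [/\ mp Y, pr mu (fun x => ~ Y x) = 0,
    forall g x, Y x -> Y (act g x) & forall x, Y x -> Z x].
Proof.
move=> mZ Z0; have mZg g : mp (fun x => Z (act g x)) by exact: (mp_comp (mact g) mZ).
exists (fun x => forall g, Z (act g x)); split.
- exact: mp_forall.
- apply: pr_not_forall0 => // g.
  by rewrite -[RHS]Z0 -(pr_act pact g (mp_not mZ)).
- by move=> g x h k; rewrite -actD.
- by move=> x /(_ 0); rewrite act0.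
Qed.

End InvariantCore.

(** * Fractional matchings from Hall's condition *)

Section FractionalMatching.
Context {dX : measure_display} {X : measurableType dX} {R : realType}
  {d : nat} {Delta : finZmodType}.
Local Notation G := (Grp d Delta).
Local Notation V := 'rV[int]_d.
Variables (mu : probability X R) (act : G -> X -> X).
Hypotheses (act0 : forall x, act 0 x = x)
  (actD : forall g h x, act (g + h) x = act g (act h x))
  (mact : forall g, measurable_fun setT (act g))
  (pact : forall g (B : set X), measurable B -> mu (act g @^-1` B) = mu B).
Variables (A B : X -> Prop) (S0 : seq G).
Hypotheses (mA : mp A) (mB : mp B) (prAB : pr mu A = pr mu B)
  (hallS : forall z (s : seq G), uniq s -> (forall u, u \in s -> A (act u z)) ->
    (size s <= size (undup [seq g <- [seq (t + u)%R | u <- s, t <- S0] | `[< B (act g z) >]]))%N).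

Definition gbox (a : int) (N : nat) : seq G := [seq (v, e) | v <- cube d a N, e <- enum Delta].

Lemma mem_gbox a N (g : G) : (g \in gbox a N) = (g.1 \in cube d a N).
Proof.
apply/allpairsP/idP => [[[v e] /= [h _ ->]]//|h].
by exists (g.1, g.2); split=> //=; rewrite ?mem_enum //; case: g h.
Qed.

Lemma uniq_gbox a N : uniq (gbox a N).
Proof. by apply: allpairs_uniq; rewrite ?uniq_cube ?enum_uniq // => -[p q] [r s]. Qed.

Lemma size_gbox a N : size (gbox a N) = (N ^ d * #|Delta|)%N.
Proof. by rewrite size_allpairs size_cube -cardE. Qed.

Let I := seq_sub S0.

Let dec (c : seq (G * G)) (u : G) : G := decode_label 0 c u.

(** A finite code of displacements, relative to the base point [z], matching the points of [A] in a
    cube injectively into [B]. There are countably many codes, so one can be selected measurably. *)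
Let saturates (N : nat) (c : seq (G * G)) (z : X) :=
  (forall u, u \in gbox 0 N -> A (act u z) -> dec c u \in S0 /\ B (act (dec c u + u) z)) /\
  (forall u v, u \in gbox 0 N -> v \in gbox 0 N -> A (act u z) -> A (act v z) ->
     dec c u + u = dec c v + v -> u = v).

Let saturates_ex N z : exists c, saturates N c z.
Proof.
pose l := [seq u <- gbox 0 N | `[< A (act u z) >]].
pose k := undup [seq g <- [seq t + u | u <- l, t <- S0] | `[< B (act g z) >]].
have [||s us sl|m [mi mk]] := @hall_seq _ _ (fun u g : G => g - u \in S0) l k 0.
- by rewrite filter_uniq // uniq_gbox.
- exact: undup_uniq.
- have hA u : u \in s -> A (act u z) by move=> /sl; rewrite mem_filter => /andP[/asboolP].
  apply: leq_trans (hallS us hA) _; rewrite -size_filter; apply: uniq_leq_size; first exact: undup_uniq.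
  move=> g; rewrite mem_undup => h; rewrite mem_filter in h; case/andP: h => Bg /allpairsP[[u t] /= [us2 tS e]].
  rewrite mem_filter; apply/andP; split.
    by apply/hasP; exists u => //=; rewrite e addrK.
  rewrite mem_undup mem_filter Bg; apply/allpairsP; exists (u, t); split=> //; exact: sl.
exists [seq (u, m u - u) | u <- l].
have decE u : u \in gbox 0 N -> A (act u z) -> u \in l /\ dec [seq (u, m u - u) | u <- l] u = m u - u.
  move=> uQ Au; have ul : u \in l by rewrite mem_filter uQ andbT; apply/asboolP.
  by split=> //; rewrite /dec (decode_labelE 0 (fun u => m u - u) ul).
split=> [u uQ Au|u v uQ vQ Au Av].
  have [ul ->] := decE u uQ Au; have [mkk r] := mk u ul; split=> //; rewrite subrK.
  by move: mkk; rewrite mem_undup mem_filter => /andP[/asboolP].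
have [ul ->] := decE u uQ Au; have [vl ->] := decE v vQ Av.
by rewrite !subrK; exact: mi.
Qed.

Let msaturates N c : mp (saturates N c).
Proof.
have mAg u : mp (fun x => A (act u x)) by exact: (mp_comp (mact u) mA).
have mBg u : mp (fun x => B (act u x)) by exact: (mp_comp (mact u) mB).
apply: mp_and.
  apply: mp_forall => u; apply: mp_imp; first exact: mp_cst.
  by apply: mp_imp => //; apply: mp_and => //; exact: mp_cst.
apply: mp_forall => u; apply: mp_forall => v; do 2 (apply: mp_imp; first exact: mp_cst).
by do 2 (apply: mp_imp => //); exact: mp_cst.
Qed.

(* Fractional matchings saturating [A], up to a factor [1 + 1/(n+1)] on [B]. *)
Let near_matching (n : nat) (w : I -> X -> R) :=
  [/\ forall i, measurable_fun setT (w i), forall i x, 0 <= w i x <= 1,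
      forall x, \sum_i w i x = (`[< A x >])%:R &
      forall y, \sum_i w i (act (- val i) y) <= (1 + n.+1%:R^-1) * (`[< B y >])%:R].

Let radius : exists r : nat, forall s, s \in S0 -> forall i, - r%:Z <= (s.1 : V) 0 i <= r%:Z.
Proof.
exists (\max_(s <- S0) \max_(i < d) absz ((s.1 : V) 0%R i))%N => s sS i.
have h1 : (absz ((s.1 : V) 0%R i) <= \max_(i < d) absz ((s.1 : V) 0%R i))%N.
  exact: (@leq_bigmax _ (fun i => absz ((s.1 : V) 0 i))).
have h2 : (\max_(i < d) absz ((s.1 : V) 0%R i) <= \max_(s <- S0) \max_(i < d) absz ((s.1 : V) 0%R i))%N.
  exact: (@leq_bigmax_seq _ S0 xpredT (fun s => \max_(i < d) absz ((s.1 : V) 0%R i))%N s sS isT).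
have := leq_trans h1 h2; move: (\max_(s <- S0) _)%N => m; move: ((s.1 : V) 0 i) => z; lia.
Qed.

(** The Foelner property of cubes: enlarging by [r] on each side multiplies the volume by a factor
    tending to 1. *)
Let box_ratio (r n : nat) : exists N : nat, (0 < N)%N /\
  (((N + 2 * r) ^ d)%:R : R) <= (1 + n.+1%:R^-1) * (N ^ d)%:R.
Proof.
have c1 : (fun N : nat => 1 + (2 * r)%:R * N.+1%:R^-1 : R) @ \oo --> (1 : R).
  have h : (fun N : nat => 1 + (2 * r)%:R * N.+1%:R^-1 : R) @ \oo --> (1 + (2 * r)%:R * 0 : R).
    have ch : (fun N : nat => N.+1%:R^-1 : R) @ \oo --> (0 : R) by exact: cvg_harmonic.
    exact: (cvgD (cvg_cst _) (cvgM (cvg_cst _) ch)).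
  by rewrite mulr0 addr0 in h.
have cv : (fun N : nat => (1 + (2 * r)%:R * N.+1%:R^-1 : R) ^+ d) @ \oo --> (1 : R).
  elim: (d) => [|e IH]; first exact: (@cvg_cst R^o).
  have h := cvgM c1 IH; rewrite mulr1 in h.
  by under eq_fun do [rewrite exprS]; exact: h.
have e0 : (1 : R) < 1 + n.+1%:R^-1 by rewrite ltrDl invr_gt0.
have [N _ hN] := cvgr_lt _ cv _ e0.
exists N.+1; split=> //; have := hN N (leqnn N) => /= h.
have -> : (((N.+1 + 2 * r) ^ d)%:R : R) = (1 + (2 * r)%:R * N.+1%:R^-1) ^+ d * (N.+1 ^ d)%:R.
  rewrite !natrX -exprMn; congr (_ ^+ d); rewrite mulrDl mul1r mulfVK ?natrD //.
by rewrite ler_wpM2r // ltW.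
Qed.

(** A point [x] lies in the cubes based at [act (- u) x] for [u] in [Q]; [w i x] is the proportion
    of these cubes whose matching moves [x] by [val i]. Averaging over all translates removes the
    dependence on a grid of cubes. *)
Let near_matching_ex n : exists w, near_matching n w.
Proof.
have [r hr] := radius; have [N [N0 hN]] := box_ratio r n.
have [sel [msel selP]] := dmeas_select (msaturates N) (saturates_ex N).
pose Q := gbox 0 N; pose q : R := (size Q)%:R.
have Q0 : 0 < q by rewrite ltr0n size_gbox muln_gt0 expn_gt0 N0 /=; apply/card_gt0P; exists 0.
pose hit (i : I) u x := A x /\ dec (sel (act (- u) x)) u = val i.
have mhit i u : mp (hit i u).
  by apply: mp_and => //; apply: (mp_comp (mact (- u)) (msel (fun c => dec c u = val i))).
pose w i x : R := q^-1 * \sum_(u <- Q) (`[< hit i u x >])%:R.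
have sumA x : \sum_i w i x = (`[< A x >])%:R.
  rewrite /w -mulr_sumr exchange_big /=.
  rewrite (eq_big_seq (fun=> (`[< A x >])%:R)) => [|u uQ].
    by rewrite big_const_seq count_predT iter_addr_0 -[_ *+ size _]mulr_natl -/q mulKf // gt_eqF.
  case: (asboolP (A x)) => Ax; last by rewrite big1 // => i _; case: asboolP => // -[].
  have [h _] := selP (act (- u) x); have [] := h u uQ; first by rewrite -actD subrr act0.
  move=> hS _; rewrite (bigD1 (SeqSub hS)) //= asboolT //= big1 ?addr0 // => i /eqP ne.
  by case: asboolP => // -[_ e]; case: ne; apply/val_inj.
exists w; split=> //.
- move=> i; apply: measurable_funM; first exact: measurable_cst.
  by apply: measurable_sum => u; exact: measurable_pred.
- move=> i x; have w0 j : 0 <= w j x.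
    by rewrite mulr_ge0 ?invr_ge0 ?ler0n // sumr_ge0 // => u _; rewrite ler0n.
  rewrite w0 /=; apply: (@le_trans _ _ (\sum_j w j x)).
    by rewrite (bigD1 i) //= lerDl sumr_ge0.
  by rewrite sumA; case: (`[< _ >]); rewrite ?lexx ?ler01.
move=> y; rewrite /w -mulr_sumr.
(* [T] lists the possible positions of [y] relative to the base of a cube that sends a point to it.
   Each position counts at most once, by injectivity of the matching of that cube, and [T] fits in a
   cube slightly larger than [Q]. *)
pose T := undup [seq t + u | u <- Q, t <- S0].
have sT : ((size T)%:R : R) <= (1 + n.+1%:R^-1) * q.
  apply: (@le_trans _ _ ((size (gbox (- r%:Z) (N + 2 * r)))%:R : R)).
    rewrite ler_nat; apply: uniq_leq_size; first exact: undup_uniq.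
    move=> g; rewrite mem_undup => /allpairsP[[u t] /= [uQ tS ->]].
    rewrite mem_gbox; apply/cubeP => i; have := hr t tS i; move: uQ; rewrite mem_gbox => /cubeP/(_ i).
    by rewrite mxE; move: ((u.1 : V) 0 i) ((t.1 : V) 0 i) => a b; lia.
  by rewrite /q !size_gbox !natrM mulrA ler_wpM2r.
have : \sum_i \sum_(u <- Q) ((`[< hit i u (act (- val i) y) >])%:R : R) <= (size T)%:R * (`[< B y >])%:R.
  have -> : (size T)%:R * (`[< B y >])%:R = \sum_(g <- T) ((`[< B y >])%:R : R).
    by rewrite big_const_seq count_predT iter_addr_0 mulr_natl.
  have -> : \sum_i \sum_(u <- Q) ((`[< hit i u (act (- val i) y) >])%:R : R) =
     \sum_(g <- T) \sum_i \sum_(u <- Q) ((g == val i + u)%:R * (`[< hit i u (act (- val i) y) >])%:R).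
    rewrite [RHS]exchange_big /=; apply: eq_bigr => i _; rewrite [RHS]exchange_big /=.
    apply: eq_big_seq => u uQ; rewrite (bigD1_seq (val i + u)) ?undup_uniq //=; last first.
      by rewrite mem_undup; apply/allpairsP; exists (u, val i); split=> //; exact: valP.
    by rewrite eqxx mul1r big1 ?addr0 // => g /negbTE ->; rewrite mul0r.
  apply: ler_sum => g _.
  have base (i : I) (u : G) : g = val i + u -> act (- u) (act (- val i) y) = act (- g) y.
    by move=> ->; rewrite -actD opprD addrC.
  have gz : act g (act (- g) y) = y by rewrite -actD subrr act0.
  have [h1 h2] := selP (act (- g) y); set c := sel _ in h1 h2.
  have hitP (i : I) (u : G) : u \in Q -> g = val i + u -> hit i u (act (- val i) y) ->
      [/\ A (act u (act (- g) y)), dec c u = val i & B y].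
    move=> uQ eg [Ai]; rewrite (base i u eg) => eD.
    have Au : A (act u (act (- g) y)).
      by rewrite -(base i u eg) -actD subrr act0.
    by have [_] := h1 u uQ Au; rewrite -/c eD -eg gz.
  have [[iu [uQ eg hh]]|nex] := pselect (exists iu : I * G,
      [/\ iu.2 \in Q, g = val iu.1 + iu.2 & hit iu.1 iu.2 (act (- val iu.1) y)]); last first.
    rewrite big1 ?ler0n // => i _; rewrite big_seq big1 // => u uQ.
    case: eqP => [eg|_]; last by rewrite mul0r.
    by case: asboolP => [hh|_]; [case: nex; exists (i, u)|rewrite mulr0].
  case: iu uQ eg hh => i u /= uQ eg hh; have [Au eD By] := hitP i u uQ eg hh.
  have uniq_hit (j : I) (v : G) : v \in Q -> g = val j + v -> hit j v (act (- val j) y) -> j = i /\ v = u.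
    move=> vQ eg' hh'; have [Av eD' _] := hitP j v vQ eg' hh'.
    have uv : v = u by apply: h2 => //; rewrite -/c eD eD' -eg -eg'.
    by split=> //; apply/val_inj; rewrite -eD -eD' uv.
  rewrite (asboolT By) (bigD1 i) //= (bigD1_seq u) ?uniq_gbox //= eg eqxx mul1r.
  rewrite [X in _ + X]big1 => [|j ji]; last first.
    rewrite big_seq big1 // => v vQ; case: eqP => [e|_]; last by rewrite mul0r.
    case: asboolP => [hh'|_]; last by rewrite mulr0.
    by have [ej _] := uniq_hit j v vQ (etrans eg e) hh'; rewrite ej eqxx in ji.
  rewrite [X in _ + X + _]big_seq_cond [X in _ + X + _]big1 => [|v /andP[vQ vu]].
    by rewrite !addr0; case: asboolP; rewrite ?lexx ?ler01.
  case: eqP => [e|_]; last by rewrite mul0r.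
  case: asboolP => [hh'|_]; last by rewrite mulr0.
  by have [_ ev'] := uniq_hit i v vQ (etrans eg e) hh'; rewrite ev' eqxx in vu.
move=> h; rewrite ler_pdivrMl //; apply: le_trans h _.
by rewrite mulrCA mulrA ler_wpM2r // mulrC.
Qed.

(** In the limit the mass sent out is the indicator of [A] and the mass received is at most the
    indicator of [B]. Both have the same integral, since the action preserves [mu] and
    [pr mu A = pr mu B], so the inequality is an equality almost everywhere. *)
Lemma measurable_fractional_matching : exists (w : seq_sub S0 -> X -> R) (Z : X -> Prop),
  [/\ mp Z, pr mu (fun x => ~ Z x) = 0, forall g x, Z x -> Z (act g x),
      forall i, measurable_fun setT (w i) /\ (forall x, 0 <= w i x <= 1) &
      forall x, Z x -> \sum_i w i x = (`[< A x >])%:R /\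
        \sum_i w i (act (- val i) x) = (`[< B x >])%:R].
Proof.
have inv0 n : 0 < (n.+1%:R^-1 : R) by rewrite invr_gt0.
have [||||W [w [Z0 [FW mw mZ0 Z00 cvgW]]]] := @quadratic_limit _ _ _ mu I near_matching.
- by move=> n w [h1 h2 _ _] i; split.
- move=> n w [h1 h2 h3 h4]; split=> // y; apply: le_trans (h4 y) _.
  by rewrite ler_wpM2r // lerD2l lef_pV2 ?posrE // ler_nat leqnSn.
- move=> n w w' [h1 h2 h3 h4] [k1 k2 k3 k4]; split.
  + by move=> i; apply: measurable_funM; [exact: measurable_funD|exact: measurable_cst].
  + move=> i x; have /andP[? ?] := h2 i x; have /andP[? ?] := k2 i x; apply/andP; split; lra.
  + by move=> x; rewrite -mulr_suml big_split /= h3 k3; field.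
  + move=> y; rewrite -mulr_suml big_split /=.
    by have := h4 y; have := k4 y; move: (\sum_i _) (\sum_i _) (_ * _) => a b c; lra.
- exact: near_matching_ex.
have Z00' : pr mu (fun x => ~ Z0 x) = 0 by rewrite /pr Z00.
have [Z1 [mZ1 Z10 Z1act Z1Z]] := invariant_core act0 actD mact pact mZ0 Z00'.
have sumA x : Z1 x -> \sum_i w i x = (`[< A x >])%:R.
  move=> Zx; have h : (fun n => \sum_i W n i x) @ \oo --> \sum_i w i x.
    by apply: cvg_finsum => i; exact: cvgW (Z1Z _ Zx) i.
  have e : (fun n => \sum_i W n i x) = (fun=> (`[< A x >])%:R).
    by apply/funext => n; have [_ _ -> _] := FW n.
  by rewrite e in h; apply/esym; apply: (cvg_unique _ (cvg_cst _) h).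
have sumB x : Z1 x -> \sum_i w i (act (- val i) x) <= (`[< B x >])%:R.
  move=> Zx; have h : (fun n => \sum_i W n i (act (- val i) x)) @ \oo --> \sum_i w i (act (- val i) x).
    by apply: (cvg_finsum (u := fun n i => W n i (act (- val i) x))) => i; apply: cvgW; apply: Z1Z; exact: Z1act.
  have k : (fun n : nat => (1 + n.+1%:R^-1) * (`[< B x >])%:R : R) @ \oo --> ((1 + 0) * (`[< B x >])%:R : R).
    have ch : (fun N : nat => N.+1%:R^-1 : R) @ \oo --> (0 : R) by exact: cvg_harmonic.
    exact: (cvgM (cvgD (cvg_cst _) ch) (cvg_cst _)).
  rewrite addr0 mul1r in k.
  by apply: (ler_cvg_to h k); apply: nearW => n; have [_ _ _] := FW n.
have w01 i x : Z1 x -> 0 <= w i x <= 1.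
  move=> Zx; have h := cvgW _ (Z1Z _ Zx) i.
  have k0 : (fun _ : nat => 0 : R) @ \oo --> (0 : R) by exact: cvg_cst.
  have k1 : (fun _ : nat => 1 : R) @ \oo --> (1 : R) by exact: cvg_cst.
  apply/andP; split.
    by apply: (ler_cvg_to k0 h); apply: nearW => n; have [_ /(_ i x)/andP[]] := FW n.
  by apply: (ler_cvg_to h k1); apply: nearW => n; have [_ /(_ i x)/andP[]] := FW n.
(* The limit is controlled only on the invariant conull set [Z1]; the cut-off gives bounds valid
   everywhere, as integration requires. *)
pose w' i x : R := (`[< Z1 x >])%:R * w i x.
have w'01 i x : 0 <= w' i x <= 1.
  by rewrite /w'; case: asboolP => Zx; rewrite ?mul1r ?w01 // mul0r lexx ler01.
have mw' i : measurable_fun setT (w' i) by apply: measurable_funM => //; exact: measurable_pred.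
have bw' i : bdd (w' i).
  by split=> // [x|]; [have /andP[] := w'01 i x|exists 1 => x; have /andP[] := w'01 i x].
have bw'a i : bdd (fun x => w' i (act (- val i) x)).
  split; first exact: (measurableT_comp (mw' i) (mact (- val i))).
    by move=> x; have /andP[] := w'01 i (act (- val i) x).
  by exists 1 => x; have /andP[] := w'01 i (act (- val i) x).
have Z1actP g x : Z1 (act g x) <-> Z1 x.
  split; last exact: Z1act.
  by move=> /(Z1act (- g)); rewrite -actD addNr act0.
have sumA' x : \sum_i w' i x = (`[< A x /\ Z1 x >])%:R.
  rewrite /w'; have [Zx|nZ] := pselect (Z1 x); last first.
    by rewrite big1 => [|i _]; [rewrite asboolF // => -[]|rewrite asboolF // mul0r].
  under eq_bigr do rewrite asboolT // mul1r.
  by rewrite sumA //; congr (_%:R); congr nat_of_bool; apply: asbool_equiv_eq; split=> [|[]].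
pose g1 x := \sum_i w' i (act (- val i) x).
have g1_le x : g1 x <= (`[< B x /\ Z1 x >])%:R.
  rewrite /g1 /w'; have [Zx|nZ] := pselect (Z1 x); last first.
    rewrite big1 => [|i _]; first by rewrite asboolF // => -[].
    by rewrite asboolF ?mul0r // => /Z1actP.
  have e : \sum_(i : I) (`[< Z1 (act (- val i) x) >])%:R * w i (act (- val i) x) = \sum_i w i (act (- val i) x).
    by apply: eq_bigr => i _; rewrite asboolT ?mul1r //; exact/Z1actP.
  rewrite e; apply: le_trans (sumB x Zx) _; rewrite ler_nat.
  by case: asboolP => // Bx; rewrite asboolT.
have mAZ : mp (fun x => A x /\ Z1 x) by exact: mp_and.
have mBZ : mp (fun x => B x /\ Z1 x) by exact: mp_and.
have prZ (P : X -> Prop) : mp P -> pr mu (fun x => P x /\ Z1 x) = pr mu P.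
  move=> mP; rewrite (pr_split mu mP mZ1).
  suff -> : pr mu (fun x => P x /\ ~ Z1 x) = 0 by rewrite addr0.
  apply/eqP; rewrite eq_le pr_ge0 andbT -Z10; apply: pr_le => [||x []//]; last exact: mp_not.
  by apply: mp_and => //; exact: mp_not.
have bg1 : bdd g1 by exact: bdd_sum.
have ev_g1 : ev mu g1 = pr mu B.
  rewrite /g1 ev_sum // -prAB -(prZ _ mA) -ev_pred //.
  rewrite (_ : (fun x => _) = (fun x => \sum_i w' i x)); last by apply/funext => x; rewrite sumA'.
  rewrite ev_sum //; apply: eq_bigr => i _.
  exact: (ev_act (mact _) (pact _) (bw' i)).
pose D x : R := (`[< B x /\ Z1 x >])%:R - g1 x.
have D0 x : 0 <= D x by rewrite subr_ge0.
have bD : bdd D.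
  have [m1 p1 _] := bg1; split=> //.
    by apply: measurable_funB => //; exact: measurable_pred.
  exists 1 => x; rewrite /D lerBlDr; apply: (@le_trans _ _ 1); last by rewrite lerDl.
  by case: (`[< _ >]); rewrite ?lexx ?ler01.
have evD0 : ev mu D = 0.
  have e := evD mu bD bg1; rewrite ev_g1 in e.
  have e2 : ev mu (fun x => D x + g1 x) = pr mu B.
    rewrite (_ : (fun x => _) = (fun x => (`[< B x /\ Z1 x >])%:R)); last first.
      by apply/funext => x; rewrite /D subrK.
    by rewrite ev_pred // prZ.
  by move: e; rewrite e2; lra.
have [mD _ _] := bD.
have mDn n : mp (fun x => ~ (n.+1%:R^-1 <= D x)).
  by apply/mp_not/mp_le => //; exact: measurable_cst.
(* The defect [D] is nonnegative with expectation 0; Markov's inequality is applied at each level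
   [n.+1%:R^-1]. *)
have Dn0 : pr mu (fun x => ~ forall n, ~ (n.+1%:R^-1 <= D x)) = 0.
  apply: pr_not_forall0 => // n.
  rewrite (@pr_ext _ _ _ _ _ (fun x => n.+1%:R^-1 <= D x)); last first.
    by move=> x; split=> [/contrapT|h nh] //; exact: nh.
  apply/eqP; rewrite eq_le pr_ge0 andbT.
  by have := ev_markov mu bD (inv0 n); rewrite evD0 pmulr_rle0.
have [Z2 [mZ2 Z20 Z2act Z2Z]] := invariant_core act0 actD mact pact (mp_forall mDn) Dn0.
exists w', (fun x => Z1 x /\ Z2 x); split.
- exact: mp_and.
- apply/eqP; rewrite eq_le pr_ge0 andbT -[leRHS]addr0 -{1}Z10 -Z20.
  apply: le_trans (pr_or mu (mp_not mZ1) (mp_not mZ2)); apply: pr_le.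
  + by apply/mp_not/mp_and.
  + by apply: mp_or; exact: mp_not.
  by move=> x /not_andP.
- by move=> g x [h1 h2]; split; [exact: Z1act|exact: Z2act].
- by move=> i; split.
move=> x [Z1x Z2x]; split.
  by rewrite sumA'; congr (_%:R); congr nat_of_bool; apply: asbool_equiv_eq; split=> [[]|].
have Dx : D x = 0.
  apply/eqP; rewrite eq_le D0 andbT leNgt; apply/negP => Dx0.
  have [n] := ltr_add_invr Dx0; rewrite add0r => hn.
  by apply: (Z2Z x Z2x n); exact: ltW.
move: Dx; rewrite /D => /eqP; rewrite subr_eq0 => /eqP e; rewrite -[LHS]/(g1 x) -e.
by congr (_%:R); congr nat_of_bool; apply: asbool_equiv_eq; split=> [[]|].
Qed.

End FractionalMatching.

(** * Integral matchings inside a class *)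

Section ClassFlow.
Context {R : realType} {d : nat} {Delta : finZmodType}.
Local Notation V := 'rV[int]_d.
Local Notation G := (Grp d Delta).
Local Notation dirs := (bool * 'I_d)%type.

Definition dir (b : dirs) : V := if b.1 then unitv b.2 else - unitv b.2.
Definition flip (b : dirs) : dirs := (~~ b.1, b.2).

Lemma flipK : involutive flip.
Proof. by case=> b i; rewrite /flip /= negbK. Qed.

Lemma dir_flip b : dir (flip b) = - dir b.
Proof. by case: b => -[] i; rewrite /dir /flip /= ?opprK. Qed.

Lemma dirE b i : dir b 0 i = (if b.1 then 1 else -1) * (i == b.2)%:R.
Proof. by case: b => -[] j; rewrite /dir /= ?mxE ?unitvE ?mul1r // mulN1r. Qed.

Variables (C : seq V) (J : V -> dirs -> R) (a b : G -> bool) (K : V -> V * V) (m M kap : nat).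
Hypotheses (uC : uniq C)
  (J_flip : forall p e, J (p + dir e) (flip e) = - J p e)
  (J_div : forall p, p \in C -> \sum_e J p e = \sum_(z : Delta) ((a (p, z))%:R - (b (p, z))%:R))
  (J_int : forall p e, p \in C -> p + dir e \notin C -> J p e \is a Num.int)
  (J_le : forall p e, J p e <= M%:R)
  (m0 : (0 < m)%N)
  (K_mem : forall p, p \in C -> forall i, (K p).1 0 i <= p 0 i < (K p).2 0 i)
  (K_side : forall p, p \in C -> forall i, m%:Z <= (K p).2 0 i - (K p).1 0 i <= (3 * m)%N%:Z)
  (K_cell : forall p, p \in C -> forall q : V,
     (forall i, (K p).1 0 i <= q 0 i < (K p).2 0 i) -> q \in C /\ K q = K p)
  (kap0 : (0 < kap)%N) (kapM : (2 * d * M * (3 * m) ^ d <= kap * m)%N)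
  (a_dense : forall u : V, (kap <= count (fun g : G => a ((u + g.1)%R, g.2)) (@gbox d Delta 0 m))%N)
  (b_dense : forall u : V, (kap <= count (fun g : G => b ((u + g.1)%R, g.2)) (@gbox d Delta 0 m))%N).

(** Every edge inside [C] is counted from its other end. *)
Let flip_sum (f : V -> dirs -> R) :
  \sum_(p <- C) \sum_e (p + dir e \in C)%:R * f p e =
  \sum_(p <- C) \sum_e (p + dir e \in C)%:R * f (p + dir e) (flip e).
Proof.
have memE (x : R) q : (q \in C)%:R * x = \sum_(p <- C) (p == q)%:R * x.
  case: (boolP (q \in C)) => [qC|qC].
    rewrite (bigD1_seq q) //= eqxx mul1r big1 ?addr0 // => p /negbTE ->.
    by rewrite mul0r.
  rewrite mul0r big_seq big1 // => p pC; case: eqP => [e|_]; last by rewrite mul0r.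
  by rewrite -e pC in qC.
transitivity (\sum_(p <- C) \sum_(q <- C) \sum_e (q == p + dir e)%:R * f p e).
  by apply: eq_bigr => p _; rewrite exchange_big; apply: eq_bigr => e _; rewrite memE.
rewrite exchange_big; apply: eq_bigr => q _ /=.
rewrite exchange_big (reindex_inj (inv_inj flipK)) /=; apply: eq_bigr => e _.
rewrite memE; apply: eq_bigr => p _; rewrite dir_flip eq_sym subr_eq eq_sym.
by case: eqP => [->|_]; rewrite ?mul0r.
Qed.

Let cells t := [seq p <- C | K p == t].
Let pos (x : R) : R := Num.max x 0.

Let posB x : pos x - pos (- x) = x.
Proof.
rewrite /pos; case: (leP x 0) => h.
  by rewrite (max_idPl _) ?oppr_ge0 // sub0r opprK.
by rewrite (max_idPr _) ?oppr_le0 ?ltW // subr0.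
Qed.

Let pos_ge0 x : 0 <= pos x.
Proof. by rewrite /pos le_max lexx orbT. Qed.

Let CD : seq G := [seq (p, z) | p <- C, z <- enum Delta].
Let mem_CD (g : G) : (g \in CD) = (g.1 \in C).
Proof.
apply/allpairsP/idP => [[[v e] /= [h _ ->]]//|h].
by exists (g.1, g.2); split=> //=; rewrite ?mem_enum //; case: g h.
Qed.

Let Al := [seq g <- CD | a g].
Let Bl := [seq g <- CD | b g].
Let nA t : R := (count (fun g => K g.1 == t) Al)%:R.
Let nB t : R := (count (fun g => K g.1 == t) Bl)%:R.

Local Notation slot := (V * dirs * nat)%type.
Let Ed : seq (V * dirs) :=
  [seq e <- [seq (p, e) | p <- C, e <- enum {: dirs}] | (e.1 + dir e.2 \in C) && (K e.1 != K (e.1 + dir e.2))].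
Let OutS : seq slot :=
  [seq (pe, j) | pe <- [seq (p, e) | p <- C, e <- enum {: dirs}], j <- iota 0 M].
(** A slot [(p, e, j)] is the unit number [j] of the flow along the edge [e] at [p], present when
    [j] is below [J p e]. The range [iota 0 M] loses none of them, as [M] bounds the flow. *)
Let outs : seq slot := [seq s <- OutS | (s.1.1 + dir s.1.2 \notin C) && (s.2%:R < J s.1.1 s.1.2)].
Let InS : seq slot :=
  [seq (pe, j) | pe <- [seq (p + dir e, flip e) | p <- C, e <- enum {: dirs}], j <- iota 0 M].
Let ins : seq slot := [seq s <- InS | (s.1.1 \notin C) && (s.2%:R < J s.1.1 s.1.2)].

Let out t : R := \sum_(e <- Ed) (K e.1 == t)%:R * pos (J e.1 e.2) + \sum_(s <- outs) (K s.1.1 == t)%:R.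
Let inn t : R := \sum_(e <- Ed) (K (e.1 + dir e.2) == t)%:R * pos (J e.1 e.2) +
  \sum_(s <- ins) (K (s.1.1 + dir s.1.2) == t)%:R.

(** This is where the integrality of the flow on the boundary of the class enters: the units are as
    many as the flow is large. *)
Let count_units (x : R) : x \is a Num.int -> x <= M%:R ->
  \sum_(j <- iota 0 M) ((j%:R < x)%R%:R : R) = pos x.
Proof.
move=> /intrP[[n|n] ->]; last first.
  move=> _; rewrite big1 => [|j _]; first by rewrite /pos (max_idPr _) // lerz0.
  by rewrite ltNge (le_trans _ (ler0n _ _)) // lerz0.
rewrite -pmulrn ler_nat => nM; rewrite /pos (max_idPl _) ?ler0n //.
under eq_bigr do rewrite ltr_nat.
rewrite -(subnKC nM) iotaD big_cat /= big_seq (eq_bigr (fun=> 1)) => [|j]; last first.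
  by rewrite mem_iota /= add0n => ->.
rewrite -big_seq big_const_seq count_predT size_iota iter_addr_0.
rewrite big_seq big1 ?addr0 // => j; rewrite mem_iota => /andP[h _].
by rewrite ltnNge -[n]add0n h.
Qed.

Let out_expand t : out t = \sum_(p <- C) \sum_e (K p == t)%:R *
  (~~ ((p + dir e \in C) && (K (p + dir e) == t)))%:R * pos (J p e).
Proof.
rewrite /out big_filter big_mkcond big_allpairs /= /outs [X in _ + X]big_filter [X in _ + X]big_mkcond /OutS /=.
rewrite !big_allpairs -big_split /=; apply: eq_big_seq => p pC.
rewrite -big_split /= big_enum /=; apply: eq_bigr => e _.
case: (boolP (p + dir e \in C)) => peC /=.
  rewrite [X in _ + X]big1 ?addr0 //; case: (eqVneq (K p) t) => [->|_]; last by rewrite !mul0r if_same.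
  by rewrite eq_sym; case: (_ == t); rewrite /= ?mulr1 ?mul1r ?mul0r ?mulr0.
rewrite add0r mulr1 -(count_units (J_int pC peC) (J_le _ _)) mulr_sumr; apply: eq_bigr => j _.
by case: ifP; rewrite ?mulr1 ?mulr0.
Qed.

Let inn_expand t : inn t = \sum_(p <- C) \sum_e (K p == t)%:R *
  (~~ ((p + dir e \in C) && (K (p + dir e) == t)))%:R * pos (- J p e).
Proof.
rewrite /inn big_filter big_mkcond big_allpairs /= /ins [X in _ + X]big_filter [X in _ + X]big_mkcond /InS /=.
rewrite big_allpairs big_allpairs_dep /=.
have -> : \sum_(p <- C) \sum_(e <- enum {: dirs})
    (if (p + dir e \in C) && (K p != K (p + dir e)) then (K (p + dir e) == t)%:R * pos (J p e) else 0) =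
  \sum_(p <- C) \sum_(e : dirs) (p + dir e \in C)%:R *
     ((K (p + dir e) != t)%:R * ((K p == t)%:R * pos (- J p e))).
  transitivity (\sum_(p <- C) \sum_(e : dirs) (p + dir e \in C)%:R *
    ((K p != t)%:R * ((K (p + dir e) == t)%:R * pos (J p e)))).
    apply: eq_bigr => p _; rewrite big_enum /=; apply: eq_bigr => e _.
    case: (p + dir e \in C); rewrite ?mul0r // mul1r /=.
    case: (eqVneq (K (p + dir e)) t) => [->|_]; last by rewrite !mul0r mulr0 if_same.
    by case: (K p == t); rewrite /= ?mul1r ?mul0r.
  rewrite flip_sum; apply: eq_bigr => p _; apply: eq_bigr => e _.
  by rewrite J_flip dir_flip addrK.
rewrite -big_split /=; apply: eq_big_seq => p pC.
rewrite big_enum -big_split /=; apply: eq_bigr => e _.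
case: (boolP (p + dir e \in C)) => peC /=.
  rewrite [X in _ + X]big1 ?addr0 // mul1r.
  by case: (K p == t); case: (_ == t); rewrite /= ?mul1r ?mul0r ?mulr1 ?mulr0 ?mul1r.
rewrite mul0r add0r mulr1.
have Ji : - J p e \is a Num.int by rewrite rpredN; exact: J_int.
have JM : - J p e <= M%:R by rewrite -J_flip J_le.
rewrite -(count_units Ji JM) mulr_sumr; apply: eq_bigr => j _.
by rewrite J_flip dir_flip addrK; case: ifP; rewrite ?mulr1 ?mulr0.
Qed.

(** The divergence identity summed over a cell: flow between two points of the cell cancels. *)
Let balance t : nA t - nB t = out t - inn t.
Proof.
have countE (s : pred G) : ((count (fun g => K g.1 == t) [seq g <- CD | s g])%:R : R) =
    \sum_(p <- C) \sum_(z : Delta) (K p == t)%:R * (s (p, z))%:R.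
  rewrite count_filter -sum1_count natr_sum big_mkcond big_allpairs /=; apply: eq_bigr => p _.
  rewrite big_enum /=; apply: eq_bigr => z _.
  by case: (K p == t); case: (s (p, z)); rewrite /= ?mulr1 ?mulr0 ?mul0r.
rewrite /nA /nB !countE -sumrB out_expand inn_expand -sumrB.
have zero : \sum_(p <- C) \sum_e (p + dir e \in C)%:R * ((K p == t)%:R * (K (p + dir e) == t)%:R * J p e) = 0.
  set S := LHS; have : S = - S.
    rewrite {1}/S flip_sum -sumrN; apply: eq_bigr => p _; rewrite -sumrN; apply: eq_bigr => e _.
    by rewrite J_flip dir_flip addrK; ring.
  by move=> /eqP; rewrite -subr_eq0 opprK -mulr2n mulrn_eq0 => /eqP.
rewrite -[LHS]subr0 -[X in _ - X = _]zero -sumrB; apply: eq_big_seq => p pC /=.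
rewrite -[X in X - _ = _]sumrB; under [X in X - _ = _]eq_bigr do rewrite -mulrBr.
rewrite -mulr_sumr -(J_div pC) mulr_sumr -!sumrB; apply: eq_bigr => e _.
rewrite -mulrBr posB; case: (p + dir e \in C) => /=; rewrite ?mul0r ?subr0 ?mulr1 //.
by case: (K (p + dir e) == t); rewrite /= ?mulr1 ?mulr0 ?mul0r ?mul1r ?subrr ?subr0.
Qed.

Let mem_cells p0 q : p0 \in C ->
  (q \in cells (K p0)) <-> (forall i, (K p0).1 0 i <= q 0 i < (K p0).2 0 i).
Proof.
move=> pC; rewrite mem_filter; split=> [/andP[/eqP Kq qC] i|h].
  by have := K_mem qC i; rewrite Kq.
by have [qC ->] := K_cell pC h; rewrite eqxx.
Qed.

Let size_cells p0 : p0 \in C -> (size (cells (K p0)) <= (3 * m) ^ d)%N.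
Proof.
move=> pC; rewrite -(size_cube d 0) -(size_map (fun v => (K p0).1 + v) (cube d 0 (3 * m))).
apply: uniq_leq_size; first exact: filter_uniq.
move=> q /(mem_cells q pC) h; apply/mapP; exists (q - (K p0).1); last by rewrite addrC subrK.
apply/cubeP => i; have := h i; have := K_side pC i; rewrite 2!mxE.
by move: (q 0 i) ((K p0).1 0 i) ((K p0).2 0 i) => x y z; lia.
Qed.

(** The layer of the cell facing direction [e] has [m] disjoint copies inside the cell, obtained by
    pushing it inwards, because the sides are at least [m]. *)
Let boundary_count p0 e : p0 \in C ->
  (count (fun p : V => (p + dir e)%R \notin cells (K p0)) (cells (K p0)) * m <= size (cells (K p0)))%N.
Proof.
move=> pC; set T := cells _; rewrite -size_filter; set L := [seq p <- T | _].
pose W := [seq p - dir e *+ j | p <- L, j <- iota 0 m].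
have -> : (size L * m)%N = size W by rewrite size_allpairs size_iota.
have mulE j i : (dir e *+ j) 0 i = (if e.1 then 1 else -1) * (i == e.2)%:R *+ j.
  by elim: j => [|j IH]; rewrite ?mulr0n ?mxE // !mulrS mxE IH dirE.
have LE p : p \in L -> p 0 e.2 = if e.1 then (K p0).2 0 e.2 - 1 else (K p0).1 0 e.2.
  rewrite mem_filter => /andP[pe /(mem_cells p pC) hp]; apply: contrapT => h.
  move/negP: pe; apply; apply/(mem_cells _ pC) => i; rewrite mxE dirE.
  have := hp i; have [->|_] := eqVneq i e.2; last by case: e.1; rewrite ?mulr0 addr0.
  move: h; move: (p 0 e.2) ((K p0).1 0 e.2) ((K p0).2 0 e.2) => x y z.
  by case: e.1; lia.
have uW : uniq W.
  apply: allpairs_uniq => //; rewrite ?iota_uniq ?filter_uniq // => -[p j] [q k].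
  move=> /allpairsP[[p' j'] /= [pL _ [-> ->]]] /allpairsP[[q' k'] /= [qL _ [-> ->]]] /= eq.
  have jk : j' = k'.
    have := congr1 (fun v : V => v 0 e.2) eq; rewrite !mxE !mulE eqxx !mulr1 (LE _ pL) (LE _ qL).
    by move: ((K p0).1 0 e.2) ((K p0).2 0 e.2) => y z; case: e.1; lia.
  by move: eq; rewrite jk => /addIr ->.
apply: uniq_leq_size => // q /allpairsP[[p j] /= [pL jm ->]].
apply/(mem_cells _ pC) => i; move: jm; rewrite mem_iota add0n => /andP[_ jm].
have := pL; rewrite mem_filter => /andP[_ /(mem_cells p pC)/(_ i)].
rewrite mxE [(- (dir e *+ j)) 0 i]mxE mulE; have := K_side pC i.
have [->|_] := eqVneq i e.2; last by case: e.1; rewrite ?mulr0 mul0rn subr0.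
rewrite (LE _ pL); move: ((K p0).1 0 e.2) ((K p0).2 0 e.2) => y z.
by case: e.1; lia.
Qed.

(** Surface against volume: a cell has at most [(3 * m) ^ d] points, at most one in [m] of them
    faces outwards in each of the [2 * d] directions, and each edge carries at most [M]. The
    hypothesis [kapM] compares this with the number of points available. *)
Let cells_out p0 (f : V -> dirs -> R) : p0 \in C -> (forall p e, f p e <= M%:R) ->
  (\sum_(p <- C) \sum_e (K p == K p0)%:R *
    (~~ ((p + dir e \in C) && (K (p + dir e) == K p0)))%:R * f p e) * m%:R <= (kap * m)%:R.
Proof.
move=> pC fM; apply: (@le_trans _ _ ((2 * d * M * (3 * m) ^ d)%:R)); last by rewrite ler_nat.
apply: (@le_trans _ _ (\sum_(e : dirs) M%:R * (size (cells (K p0)))%:R)); last first.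
  rewrite sumr_const card_prod card_bool card_ord -[_ *+ (2 * d)]mulr_natl -!natrM ler_nat mulnA.
  by rewrite leq_mul2l size_cells // orbT.
rewrite exchange_big mulr_suml /=; apply: ler_sum => e _.
apply: (@le_trans _ _ (M%:R * (count (fun p : V => (p + dir e)%R \notin cells (K p0)) (cells (K p0)))%:R * m%:R)).
  rewrite ler_wpM2r // count_filter -sum1_count natr_sum mulr_sumr [leRHS]big_mkcond /=; apply: ler_sum => p _.
  rewrite mem_filter andbC [in X in _ <= X]andbC.
  case: (K p == K p0); rewrite ?mul0r ?mul1r //=.
  rewrite [(K (p + dir e) == K p0) && _]andbC.
  by case: (~~ _); rewrite ?mul0r // mul1r mulr1 fM.
by rewrite -mulrA ler_wpM2l // -natrM ler_nat boundary_count.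
Qed.

Let J_ge p e : - J p e <= M%:R.
Proof. by rewrite -J_flip J_le. Qed.

Let pos_le x : x <= M%:R -> pos x <= M%:R.
Proof. by move=> h; rewrite /pos ge_max h ler0n. Qed.

Let dense_ge (c : G -> bool) p0 :
  (forall u : V, (kap <= count (fun g : G => c ((u + g.1)%R, g.2)) (@gbox d Delta 0 m))%N) ->
  p0 \in C -> (kap <= count (fun g : G => K g.1 == K p0) [seq g <- CD | c g])%N.
Proof.
move=> hc pC; apply: leq_trans (hc (K p0).1) _.
rewrite -!size_filter -(size_map (fun g : G => ((K p0).1 + g.1, g.2) : G)).
apply: uniq_leq_size.
  rewrite map_inj_uniq ?filter_uniq ?uniq_gbox // => -[v z] [v' z'] /= [/addrI -> ->] //.
move=> g /mapP[h]; rewrite !mem_filter => /andP[ch]; rewrite mem_gbox => /cubeP hb ->.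
have hm i : (K p0).1 0 i <= ((K p0).1 + h.1) 0 i < (K p0).2 0 i.
  rewrite mxE; have := hb i; have := K_side pC i.
  by move: ((h.1 : V) 0 i) ((K p0).1 0 i) ((K p0).2 0 i) => x y z; lia.
have [qC ->] := K_cell pC hm.
by rewrite mem_CD /= eqxx ch qC.
Qed.

Let nA_gt0 p0 : p0 \in C -> 0 < nA (K p0).
Proof. by move=> pC; rewrite ltr0n (leq_trans kap0) // dense_ge. Qed.

Let nB_gt0 p0 : p0 \in C -> 0 < nB (K p0).
Proof. by move=> pC; rewrite ltr0n (leq_trans kap0) // dense_ge. Qed.

Let out_le p0 : p0 \in C -> out (K p0) <= nA (K p0).
Proof.
move=> pC; have m1 : 0 < (m%:R : R) by rewrite ltr0n.
rewrite -(ler_pM2r m1) out_expand; apply: le_trans (cells_out pC _) _.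
  by move=> p e; apply: pos_le.
by rewrite natrM ler_pM2r // ler_nat dense_ge.
Qed.

Let same_cell p q i : p \in C -> q \in C -> K p = K q ->
  - (3 * m)%N%:Z <= p 0 i - q 0 i <= (3 * m)%N%:Z.
Proof.
move=> pC qC e; have := K_mem pC i; have := K_mem qC i; have := K_side pC i; rewrite e.
by move: (p 0 i) (q 0 i) ((K q).1 0 i) ((K q).2 0 i) => x y z t; lia.
Qed.

Definition near (k : nat) (p q : V) : bool := [forall i, - k%:Z <= p 0 i - q 0 i <= k%:Z].

(** Two cells of side at most [3 * m] and an edge between them: [3 * m + 1 + 3 * m <= 7 * m]. *)
Let near_edge p q x y e : p \in C -> q \in C -> x \in C -> y \in C -> y = x + dir e ->
  K p = K x -> K q = K y -> near (7 * m) p q.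
Proof.
move=> pC qC xC yC ye h1 h2; apply/forallP => i.
have := same_cell i pC xC h1; have := same_cell i qC yC h2; rewrite ye mxE dirE.
move: (p 0 i) (q 0 i) (x 0 i) => u v w.
by case: e.1; case: (i == e.2); rewrite ?mulr1 ?mulr0; lia.
Qed.

Let near_cell p q : p \in C -> q \in C -> K p = K q -> near (7 * m) p q.
Proof.
move=> pC qC e; apply/forallP => i; have := same_cell i pC qC e.
by move: (p 0 i) (q 0 i) => u v; lia.
Qed.

Local Notation item := (G + slot)%type.
Let res t := nA t - out t.
(** The flow leaving a cell is taken in equal shares from its points of [A], the flow entering it is
    given in equal shares to its points of [B], and the rest [res] is matched evenly inside the
    cell. By [out_le] the rest is nonnegative, and by [balance] it is the same for [A] and for
    [B]. *)
Let weight (x y : item) : R := match x, y with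
  | inl g, inl h => ((K g.1 == K h.1)%:R * res (K g.1) +
      \sum_(e <- Ed) (K e.1 == K g.1)%:R * (K (e.1 + dir e.2) == K h.1)%:R * pos (J e.1 e.2)) /
      (nA (K g.1) * nB (K h.1))
  | inl g, inr s => (K s.1.1 == K g.1)%:R / nA (K g.1)
  | inr s, inl h => (K (s.1.1 + dir s.1.2) == K h.1)%:R / nB (K h.1)
  | inr _, inr _ => 0 end.
(** A unit entering the class is never matched with a unit leaving it. Hence a matched pair of
    points is separated by at most one class boundary. *)
Let allowed (x y : item) : bool := match x, y with
  | inl g, inl h => near (7 * m) g.1 h.1
  | inl g, inr s => near (7 * m) g.1 s.1.1
  | inr s, inl h => near (7 * m) (s.1.1 + dir s.1.2) h.1
  | inr _, inr _ => false end.
Let lefts : seq item := [seq inl g | g <- Al] ++ [seq inr s | s <- ins].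
Let rights : seq item := [seq inl g | g <- Bl] ++ [seq inr s | s <- outs].

Let EdP e : e \in Ed -> e.1 \in C /\ e.1 + dir e.2 \in C.
Proof.
rewrite mem_filter => /andP[/andP[h _] /allpairsP[[p f] /= [pC _ ef]]].
by split=> //; rewrite ef.
Qed.

Let outsP s : s \in outs <-> [/\ s.1.1 \in C, s.1.1 + dir s.1.2 \notin C, (s.2 < M)%N & s.2%:R < J s.1.1 s.1.2].
Proof.
rewrite mem_filter; split.
  move=> /andP[/andP[h1 h2] /allpairsP[[pe j] /= [/allpairsP[[p e] /= [pC _ pe']] jM es]]].
  by split=> //; rewrite es //= ?pe' //; move: jM; rewrite mem_iota.
case: s => -[p e] j /= [h1 h2 h3 h4]; rewrite h2 h4 /=; apply/allpairsP; exists (p, e, j).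
split=> //=; last by rewrite mem_iota.
by apply/allpairsP; exists (p, e); rewrite mem_enum.
Qed.

Let insP s : s \in ins <-> [/\ s.1.1 \notin C, s.1.1 + dir s.1.2 \in C, (s.2 < M)%N & s.2%:R < J s.1.1 s.1.2].
Proof.
rewrite mem_filter; split.
  move=> /andP[/andP[h1 h2] /allpairsP[[pe j] /= [/allpairsP[[p e] /= [pC _ pe']] jM es]]].
  split=> //; rewrite es //= ?pe' /= ?dir_flip ?addrK //; by move: jM; rewrite mem_iota.
case: s => -[p e] j /= [h1 h2 h3 h4]; rewrite h1 h4 /=; apply/allpairsP; exists (p, e, j).
split=> //=; last by rewrite mem_iota.
by apply/allpairsP; exists (p + dir e, flip e); rewrite mem_enum /= dir_flip addrK flipK.
Qed.

Let memA g : g \in Al = (a g && (g.1 \in C)).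
Proof. by rewrite mem_filter mem_CD. Qed.
Let memB g : g \in Bl = (b g && (g.1 \in C)).
Proof. by rewrite mem_filter mem_CD. Qed.

Let unitB q : q \in C -> \sum_(h <- Bl) (K q == K h.1)%:R / nB (K h.1) = 1.
Proof.
move=> qC; transitivity (\sum_(h <- Bl) (K h.1 == K q)%:R * (nB (K q))^-1).
  by apply: eq_bigr => h _; rewrite eq_sym; case: eqP => [->|_]; rewrite ?mul0r.
rewrite -mulr_suml (_ : \sum_(h <- Bl) _ = nB (K q)) ?mulfV ?gt_eqF ?nB_gt0 //.
by rewrite /nB -sum1_count natr_sum [RHS]big_mkcond; apply: eq_bigr => h _; case: (_ == _).
Qed.

Let unitA q : q \in C -> \sum_(h <- Al) (K q == K h.1)%:R / nA (K h.1) = 1.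
Proof.
move=> qC; transitivity (\sum_(h <- Al) (K h.1 == K q)%:R * (nA (K q))^-1).
  by apply: eq_bigr => h _; rewrite eq_sym; case: eqP => [->|_]; rewrite ?mul0r.
rewrite -mulr_suml (_ : \sum_(h <- Al) _ = nA (K q)) ?mulfV ?gt_eqF ?nA_gt0 //.
by rewrite /nA -sum1_count natr_sum [RHS]big_mkcond; apply: eq_bigr => h _; case: (_ == _).
Qed.

Let weight_row x : x \in lefts -> \sum_(y <- rights) weight x y = 1.
Proof.
rewrite mem_cat big_cat !big_map => /orP[/mapP[g gA ->]|/mapP[s /insP[_ sC _ _] ->]] /=; last first.
  by rewrite unitB // big1 ?addr0.
have := gA; rewrite memA => /andP[_ gC]; have n0 := nA_gt0 gC.
have -> : \sum_(h <- Bl) ((K g.1 == K h.1)%:R * res (K g.1) +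
      \sum_(e <- Ed) (K e.1 == K g.1)%:R * (K (e.1 + dir e.2) == K h.1)%:R * pos (J e.1 e.2)) /
      (nA (K g.1) * nB (K h.1)) =
   (res (K g.1) + \sum_(e <- Ed) (K e.1 == K g.1)%:R * pos (J e.1 e.2)) / nA (K g.1).
  transitivity (\sum_(h <- Bl) (((K g.1 == K h.1)%:R / nB (K h.1)) * (res (K g.1) / nA (K g.1)) +
     \sum_(e <- Ed) ((K (e.1 + dir e.2) == K h.1)%:R / nB (K h.1)) *
        ((K e.1 == K g.1)%:R * pos (J e.1 e.2) / nA (K g.1)))).
    apply: eq_bigr => h _; rewrite invfM [LHS]mulrDl; congr (_ + _); first by ring.
    by rewrite mulr_suml; apply: eq_bigr => e _; ring.
  rewrite big_split /= -mulr_suml unitB // mul1r [RHS]mulrDl; congr (_ + _).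
  rewrite exchange_big mulr_suml /=; apply: eq_big_seq => e /EdP[_ eC].
  by rewrite -mulr_suml unitB // mul1r.
have -> : \sum_(s <- outs) (K s.1.1 == K g.1)%:R / nA (K g.1) =
    (\sum_(s <- outs) (K s.1.1 == K g.1)%:R) / nA (K g.1) by rewrite mulr_suml.
rewrite -mulrDl -addrA -/(out (K g.1)) /res subrK mulfV // gt_eqF //.
Qed.

Let weight_col y : y \in rights -> \sum_(x <- lefts) weight x y = 1.
Proof.
rewrite mem_cat big_cat !big_map => /orP[/mapP[h hB ->]|/mapP[s /outsP[sC _ _ _] ->]] /=; last first.
  by rewrite unitA // big1 ?addr0.
have := hB; rewrite memB => /andP[_ hC]; have n0 := nB_gt0 hC.
have -> : \sum_(g <- Al) ((K g.1 == K h.1)%:R * res (K g.1) +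
      \sum_(e <- Ed) (K e.1 == K g.1)%:R * (K (e.1 + dir e.2) == K h.1)%:R * pos (J e.1 e.2)) /
      (nA (K g.1) * nB (K h.1)) =
   (res (K h.1) + \sum_(e <- Ed) (K (e.1 + dir e.2) == K h.1)%:R * pos (J e.1 e.2)) / nB (K h.1).
  transitivity (\sum_(g <- Al) (((K h.1 == K g.1)%:R / nA (K g.1)) * (res (K h.1) / nB (K h.1)) +
     \sum_(e <- Ed) ((K e.1 == K g.1)%:R / nA (K g.1)) *
        ((K (e.1 + dir e.2) == K h.1)%:R * pos (J e.1 e.2) / nB (K h.1)))).
    apply: eq_bigr => g _; rewrite invfM [LHS]mulrDl; congr (_ + _).
      by rewrite [K h.1 == _]eq_sym; case: eqP => [->|_]; [ring|rewrite !mul0r].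
    by rewrite mulr_suml; apply: eq_bigr => e _; ring.
  rewrite big_split /= -mulr_suml unitA // mul1r [RHS]mulrDl; congr (_ + _).
  rewrite exchange_big mulr_suml /=; apply: eq_big_seq => e /EdP[eC _].
  by rewrite -mulr_suml unitA // mul1r.
have -> : \sum_(s <- ins) (K (s.1.1 + dir s.1.2) == K h.1)%:R / nB (K h.1) =
    (\sum_(s <- ins) (K (s.1.1 + dir s.1.2) == K h.1)%:R) / nB (K h.1) by rewrite mulr_suml.
rewrite -mulrDl -addrA -/(inn (K h.1)) /res.
have -> : nA (K h.1) - out (K h.1) = nB (K h.1) - inn (K h.1).
  by have := balance (K h.1); lra.
by rewrite subrK mulfV // gt_eqF.
Qed.

Let weight_ge0 x y : x \in lefts -> y \in rights -> 0 <= weight x y.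
Proof.
rewrite !mem_cat => /orP[/mapP[g gA ->]|/mapP[s _ ->]] /orP[/mapP[h _ ->]|/mapP[s' _ ->]] //=.
- have := gA; rewrite memA => /andP[_ gC].
  rewrite divr_ge0 ?mulr_ge0 ?ler0n // addr_ge0 ?mulr_ge0 ?ler0n ?subr_ge0 ?out_le //.
  by apply: sumr_ge0 => e _; rewrite !mulr_ge0.
- by rewrite divr_ge0 ?ler0n.
- by rewrite divr_ge0 ?ler0n.
Qed.

Let weight_allowed x y : x \in lefts -> y \in rights -> ~~ allowed x y -> weight x y = 0.
Proof.
rewrite !mem_cat => /orP[/mapP[g gA ->]|/mapP[s sI ->]] /orP[/mapP[h hB ->]|/mapP[s' sO ->]] //= nn.
- have := gA; have := hB; rewrite memA memB => /andP[_ hC] /andP[_ gC].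
  case: eqP => [e|_]; first by rewrite near_cell in nn.
  rewrite mul0r add0r big_seq big1 ?mul0r // => e eE; have [eC eC'] := EdP eE.
  case: eqP => [e1|_]; last by rewrite !mul0r.
  case: eqP => [e2|_]; last by rewrite mulr0 mul0r.
  by rewrite (near_edge gC hC eC eC' erefl) in nn.
- have := gA; rewrite memA => /andP[_ gC]; have /outsP[sC _ _ _] := sO.
  by case: eqP => [e|_]; [rewrite near_cell in nn|rewrite mul0r].
- have := hB; rewrite memB => /andP[_ hC]; have /insP[_ sC _ _] := sI.
  by case: eqP => [e|_]; [rewrite near_cell in nn|rewrite mul0r].
Qed.

(** Obtained by applying [fractional_matching] to [weight]. Units crossing the boundary are named by
    edges of the flow, in the same way from both classes that the edge joins, so that matchings of
    neighbouring classes can be composed along them. *)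
Lemma class_matching : exists (alpha : G -> G + slot) (beta : G -> option slot),
  [/\ forall g, a g -> g.1 \in C -> match alpha g with
        | inl h => [/\ b h, h.1 \in C, near (7 * m) g.1 h.1 & beta h = None]
        | inr s => [/\ s.1.1 \in C, s.1.1 + dir s.1.2 \notin C, s.2%:R < J s.1.1 s.1.2 &
            near (7 * m) g.1 s.1.1] end,
      forall g g', a g -> g.1 \in C -> a g' -> g'.1 \in C -> alpha g = alpha g' -> g = g',
      forall s, s.1.1 \in C -> s.1.1 + dir s.1.2 \notin C -> s.2%:R < J s.1.1 s.1.2 ->
        exists g, [/\ a g, g.1 \in C & alpha g = inr s],
      forall h, b h -> h.1 \in C -> match beta h with
        | None => exists g, [/\ a g, g.1 \in C & alpha g = inl h]
        | Some s => [/\ s.1.1 \notin C, s.1.1 + dir s.1.2 \in C, s.2%:R < J s.1.1 s.1.2 &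
            near (7 * m) (s.1.1 + dir s.1.2) h.1] end &
      forall s, s.1.1 \notin C -> s.1.1 + dir s.1.2 \in C -> s.2%:R < J s.1.1 s.1.2 ->
        exists h, [/\ b h, h.1 \in C, beta h = Some s &
          forall h', b h' -> h'.1 \in C -> beta h' = Some s -> h' = h]].
Proof.
have uCD : uniq CD by apply: allpairs_uniq; rewrite ?enum_uniq // => -[p q] [r s].
have uEd0 : uniq [seq (p, e) | p <- C, e <- enum {: dirs}].
  by apply: allpairs_uniq; rewrite ?enum_uniq // => -[p q] [r s].
have uOut : uniq outs.
  by apply/filter_uniq/allpairs_uniq; rewrite ?iota_uniq // => -[p q] [r s].
have uIn : uniq ins.
  apply/filter_uniq/allpairs_uniq; rewrite ?iota_uniq //; last by move=> -[p q] [r s].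
  apply: allpairs_uniq; rewrite ?enum_uniq // => -[p e] [q f] _ _ eq.
  have ef : e = f by apply: (inv_inj flipK); exact: (congr1 snd eq).
  by have := congr1 fst eq; rewrite /= ef => /addIr ->.
have inl_inj (T S : Type) : injective (@inl T S) by move=> x y [].
have inr_inj (T S : Type) : injective (@inr T S) by move=> x y [].
have ul : uniq lefts.
  rewrite cat_uniq (map_inj_uniq (inl_inj _ _)) (map_inj_uniq (inr_inj _ _)) filter_uniq // uIn andbT /=.
  by apply/hasPn => _ /mapP[s _ ->]; apply/mapP => -[].
have uk : uniq rights.
  rewrite cat_uniq (map_inj_uniq (inl_inj _ _)) (map_inj_uniq (inr_inj _ _)) filter_uniq // uOut andbT /=.
  by apply/hasPn => _ /mapP[s _ ->]; apply/mapP => -[].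
have [f [fi fP fs]] := fractional_matching (inl 0) ul uk weight_ge0 weight_allowed weight_row weight_col.
have nlr (g : G) (s : seq slot) : (inl g : item) \in [seq inr x | x <- s] = false.
  by apply/negbTE/mapP => -[].
have nrl (x : slot) (s : seq G) : (inr x : item) \in [seq inl g | g <- s] = false.
  by apply/negbTE/mapP => -[].
have inLl g : (inl g \in lefts) = (a g && (g.1 \in C)).
  by rewrite mem_cat (mem_map (inl_inj _ _)) memA nlr orbF.
have inLr s : (inr s \in lefts) = (s \in ins).
  by rewrite mem_cat (mem_map (inr_inj _ _)) nrl.
have inRl g : (inl g \in rights) = (b g && (g.1 \in C)).
  by rewrite mem_cat (mem_map (inl_inj _ _)) memB nlr orbF.
have inRr s : (inr s \in rights) = (s \in outs).
  by rewrite mem_cat (mem_map (inr_inj _ _)) nrl.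
(* The entering unit matched with [h], if there is one; otherwise [h] is matched with a point of
   [A]. *)
pose beta h : option slot := ohead [seq s <- ins | f (inr s) == inl h].
have betaS h s : beta h = Some s -> s \in ins /\ f (inr s) = inl h.
  rewrite /beta => e; have : s \in [seq s <- ins | f (inr s) == inl h].
    by case: [seq _ <- _ | _] e => //= s' t [->]; rewrite mem_head.
  by rewrite mem_filter => /andP[/eqP -> ->].
have betaI s h : s \in ins -> f (inr s) = inl h -> beta h = Some s.
  move=> sI e; have : s \in [seq s <- ins | f (inr s) == inl h] by rewrite mem_filter e eqxx.
  case eb : (beta h) => [s'|]; last by move: eb; rewrite /beta; case: [seq _ <- _ | _].
  move=> _; have [s'I e'] := betaS _ _ eb; congr Some.
  by apply: (inr_inj G slot); apply: fi; rewrite ?inLr // e e'.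
have ltM s : s.2%:R < J s.1.1 s.1.2 -> (s.2 < M)%N.
  by move=> h; rewrite -(ltr_nat R); apply: lt_le_trans h (J_le _ _).
exists (fun g => f (inl g)), beta; split.
- move=> g ag gC; have := fP (inl g); rewrite inLl ag gC => /(_ isT)[].
  case e : (f (inl g)) => [h|s] /=; last by rewrite inRr => /outsP[].
  rewrite inRl => /andP[bh hC] nn; split=> //; case eb : (beta h) => [s|//].
  have [sI e'] := betaS _ _ eb.
  by have := fi (inl g) (inr s); rewrite inLl inLr ag gC sI e e' => /(_ isT isT erefl).
- move=> g g' ag gC ag' gC' e.
  by apply: (inl_inj G slot); apply: fi; rewrite ?inLl ?ag ?ag'.
- move=> s h1 h2 h3; have sO : s \in outs by apply/outsP; split=> //; exact: ltM.
  have [|[g|s'] xl e] := fs (inr s); first by rewrite inRr.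
    by move: xl; rewrite inLl => /andP[ag gC]; exists g.
  by have [_] := fP _ xl; rewrite e.
- move=> h bh hC; case eb : (beta h) => [s|].
    have [sI e] := betaS _ _ eb; have /insP[h1 h2 _ h3] := sI; split=> //.
    by have := fP (inr s); rewrite inLr sI e => /(_ isT)[].
  have [|[g|s] xl e] := fs (inl h); first by rewrite inRl bh hC.
    by move: xl; rewrite inLl => /andP[ag gC]; exists g.
  by move: xl; rewrite inLr => sI; rewrite (betaI s h sI e) in eb.
- move=> s h1 h2 h3; have sI : s \in ins by apply/insP; split=> //; exact: ltM.
  have := fP (inr s); rewrite inLr sI => /(_ isT)[].
  case e : (f (inr s)) => [h|s'] //=; rewrite inRl => /andP[bh hC] _.
  exists h; split=> //; first exact: betaI.
  by move=> h' _ _ /betaS[_]; rewrite e => -[].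
Qed.

End ClassFlow.

(** * Flows along nested boxes *)

Section InvariantAlgebra.
Context {dX : measure_display} {X : measurableType dX} {R : realType} {T : Type}.
Variables (tau : T -> X -> X).

(** The quotient of [X] by a finite group is modelled by [X] itself with this smaller sigma-algebra.
    Its measurable predicates and functions are the invariant ones, so anything constructed over it
    is automatically invariant. *)
Definition invariant_sets : set (set X) :=
  [set P | measurable P /\ forall t x, P (tau t x) <-> P x].

Lemma invariant_sigma_algebra : sigma_algebra setT invariant_sets.
Proof.
split.
- by split=> [|t x]; [exact: measurable0|].
- move=> P [mP iP]; split; first by rewrite setTD; exact: measurableC.
  by move=> t x; rewrite setTD /setC /= iP.
- move=> F hF; split; first by apply: bigcup_measurable => k _; have [] := hF k.
  by move=> t x; split=> -[k _ Fk]; exists k => //; have [_ iF] := hF k; exact/(iF t x).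
Qed.

Definition invType := g_sigma_algebraType invariant_sets.

Lemma inv_measurable (P : set X) :
  measurable (P : set invType) <-> measurable P /\ forall t x, P (tau t x) <-> P x.
Proof. by rewrite /measurable /= (sigma_algebra_id invariant_sigma_algebra). Qed.

Lemma inv_mp (P : X -> Prop) :
  mp (P : invType -> Prop) <-> mp P /\ forall t x, P (tau t x) <-> P x.
Proof. exact: (inv_measurable [set x | P x]). Qed.

Lemma inv_measurable_fun (f : X -> R) : measurable_fun setT (f : invType -> R) <->
  measurable_fun setT f /\ forall t x, f (tau t x) = f x.
Proof.
split=> [mf|[mf fi] _ B mB].
  split=> [_ B mB|t x].
    by have /inv_measurable[] := mf measurableT B mB; rewrite !setTI.
  (* The preimage of the point [f x] is an invariant set. *)
  have /inv_measurable[_ /(_ t x)] := mf measurableT [set f x] (measurable_set1 (f x)).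
  by rewrite setTI => -[_ /(_ erefl)].
apply/inv_measurable; split; first exact: mf.
by move=> t x; rewrite setTI /= fi.
Qed.

Lemma inv_id_measurable : measurable_fun setT (idfun : X -> invType).
Proof. by move=> _ B /inv_measurable[mB _]; rewrite setTI. Qed.

(** The image of [mu] under the identity map is its restriction to the invariant sets. *)
Lemma inv_probability (mu : probability X R) :
  exists mu' : probability invType R, forall P : set X, mu' P = mu P.
Proof.
pose i : {mfun X >-> invType} := mfun_Sub (mem_set inv_id_measurable).
exists (distribution mu i) => P; have ie : (i : X -> invType) = idfun by exact: mfun_valP.
by rewrite -[LHS]/(mu (i @^-1` P)) ie preimage_id.
Qed.

End InvariantAlgebra.

Lemma int_row_ind (d : nat) (P : 'rV[int]_d -> Prop) :
  P 0 -> (forall u v, P u -> P v -> P (u + v)) -> (forall u, P u -> P (- u)) ->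
  (forall i, P (unitv i)) -> forall v, P v.
Proof.
move=> P0 PD PN PU v.
have PM a n : P a -> P (a *+ n).
  by move=> pa; elim: n => [|n IH]; rewrite ?mulr0n // mulrS; exact: PD.
have PZ a (k : int) : P a -> P (a *~ k).
  by move=> pa; case: k => n; [exact: PM|rewrite NegzE mulrNz; apply: PN; exact: PM].
have PS (s : seq 'I_d) (c : 'I_d -> int) : P (\sum_(i <- s) unitv i *~ c i).
  by elim: s => [|i s IH]; rewrite ?big_nil ?big_cons //; apply: PD => //; exact: PZ.
rewrite [v]row_sum_delta (_ : \sum_i _ = \sum_i unitv i *~ (v 0 i)); first exact: PS.
by apply: eq_bigr => i _; rewrite -[RHS]scaler_int intz.
Qed.

(** * Coboundaries as divergences of bounded flows *)

Section Coboundary.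
Context {dX : measure_display} {X : measurableType dX} {R : realType} {d : nat}.
Local Notation V := 'rV[int]_d.
Variables (act : V -> X -> X).
Hypotheses (act0 : forall x, act 0 x = x)
  (actD : forall g h x, act (g + h) x = act g (act h x))
  (mact : forall g, measurable_fun setT (act g)).

Definition bounded_measurable (g : X -> R) :=
  measurable_fun setT g /\ exists M : nat, forall x, `|g x| <= M%:R.

Definition bounded_boundary (h : X -> R) := exists phi : 'I_d -> X -> R,
  (forall i, bounded_measurable (phi i)) /\ forall x, divergence act phi x = h x.

Lemma bounded_measurable_act v g : bounded_measurable g -> bounded_measurable (fun x => g (act v x)).
Proof.
move=> [mg [M gM]]; split; first exact: (measurableT_comp mg (mact v)).
by exists M => x; exact: gM.
Qed.

Lemma bounded_measurableD g h :
  bounded_measurable g -> bounded_measurable h -> bounded_measurable (fun x => g x + h x).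
Proof.
move=> [mg [M gM]] [mh [N hN]]; split; first exact: measurable_funD.
by exists (M + N)%N => x; rewrite natrD (le_trans (ler_normD _ _)) // lerD.
Qed.

Lemma bounded_measurableN g : bounded_measurable g -> bounded_measurable (fun x => - g x).
Proof.
move=> [mg [M gM]]; split; first exact: measurableT_comp.
by exists M => x; rewrite normrN.
Qed.

Lemma bounded_measurable0 : bounded_measurable (fun=> 0).
Proof. by split; [exact: measurable_cst|exists 0%N => x; rewrite normr0]. Qed.

Lemma bounded_boundary_ext h k : (forall x, h x = k x) -> bounded_boundary h -> bounded_boundary k.
Proof. by move=> e [phi [b e']]; exists phi; split=> // x; rewrite e' e. Qed.

Lemma bounded_boundary0 : bounded_boundary (fun=> 0).
Proof.
exists (fun _ _ => 0); split=> [i|x]; first exact: bounded_measurable0.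
by rewrite /divergence big1 // => i _; rewrite subrr.
Qed.

Lemma bounded_boundaryD h k :
  bounded_boundary h -> bounded_boundary k -> bounded_boundary (fun x => h x + k x).
Proof.
move=> [phi [bphi ephi]] [psi [bpsi epsi]]; exists (fun i x => phi i x + psi i x); split.
  by move=> i; exact: bounded_measurableD.
move=> x; rewrite -ephi -epsi /divergence -big_split; apply: eq_bigr => i _ /=; ring.
Qed.

Lemma bounded_boundaryN h : bounded_boundary h -> bounded_boundary (fun x => - h x).
Proof.
move=> [phi [bphi ephi]]; exists (fun i x => - phi i x); split.
  by move=> i; exact: bounded_measurableN.
by move=> x; rewrite -ephi /divergence -sumrN; apply: eq_bigr => i _ /=; ring.
Qed.

Lemma bounded_boundary_sum (I : Type) (s : seq I) (h : I -> X -> R) :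
  (forall i, bounded_boundary (h i)) -> bounded_boundary (fun x => \sum_(i <- s) h i x).
Proof.
move=> bh; elim: s => [|i s IH].
  by apply: bounded_boundary_ext bounded_boundary0 => x; rewrite big_nil.
by apply: bounded_boundary_ext (bounded_boundaryD (bh i) IH) => x; rewrite big_cons.
Qed.

(** The vectors [v] with this property form a subgroup, since the difference for a sum telescopes.
    For a unit vector, [g] itself is the flow along that direction. *)
Lemma bounded_coboundary (v : V) g : bounded_measurable g ->
  bounded_boundary (fun x => g x - g (act (- v) x)).
Proof.
pose P v := forall g, bounded_measurable g -> bounded_boundary (fun x => g x - g (act (- v) x)).
have P0 : P 0.
  by move=> h _; apply: bounded_boundary_ext bounded_boundary0 => x; rewrite oppr0 act0 subrr.
have PD a b : P a -> P b -> P (a + b).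
  move=> pa pb h bh.
  apply: bounded_boundary_ext (bounded_boundaryD (pa h bh) (pb _ (bounded_measurable_act (- a) bh))) => x.
  by rewrite -actD opprD; ring.
have PN a : P a -> P (- a).
  move=> pa h bh; apply: bounded_boundary_ext (bounded_boundaryN (pa _ (bounded_measurable_act a bh))) => x.
  by rewrite -actD subrr act0 opprK; ring.
have PU i : P (unitv i).
  move=> h bh; exists (fun j x => if j == i then h x else 0); split.
    by move=> j; case: eqP => _ //; exact: bounded_measurable0.
  move=> x; rewrite /divergence (bigD1 i) //= eqxx big1 ?addr0 // => j /negbTE ->.
  by rewrite subrr.
exact: (int_row_ind P0 PD PN PU).
Qed.

End Coboundary.

Section BoxFlow.
Context {dX : measure_display} {X : measurableType dX} {d : nat}.
Local Notation V := 'rV[int]_d.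

Definition class_relation (act : V -> X -> X) (E : V -> X -> Prop) :=
  [/\ forall v, mp (E v), forall x, E 0 x,
      forall v w x, E v x -> E w (act v x) -> E (w + v) x &
      forall v x, E v x -> E (- v) (act v x)].

Definition tiled (m : nat) (E : V -> X -> Prop) (x : X) :=
  (exists s : seq V, forall v, E v x -> v \in s) /\
  exists K : V -> V * V, forall p, E p x ->
  [/\ forall i, (K p).1 0 i <= p 0 i < (K p).2 0 i,
      forall i, m%:Z <= (K p).2 0 i - (K p).1 0 i <= (3 * m)%N%:Z &
      forall q : V, (forall i, (K p).1 0 i <= q 0 i < (K p).2 0 i) -> E q x /\ K q = K p].

Lemma box_flow (R : realType) (mu : probability X R) (act : V -> X -> X) (f : X -> R)
    (phi : 'I_d -> X -> R) (C : R) (m : nat) :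
  (forall x, act 0 x = x) ->
  (forall g h x, act (g + h) x = act g (act h x)) ->
  (forall g, measurable_fun setT (act g)) ->
  (forall g (B : set X), measurable B -> mu (act g @^-1` B) = mu B) ->
  measurable_fun setT f -> (forall g x, f (act g x) = f x -> g = 0) ->
  (forall i, measurable_fun setT (phi i)) -> (forall i x, `|phi i x| <= C) ->
  (forall x, divergence act phi x \is a Num.int) -> (0 < m)%N ->
  exists (E : V -> X -> Prop) (psi : 'I_d -> X -> R) (Y : X -> Prop),
  [/\ class_relation act E,
      forall i, measurable_fun setT (psi i) /\ forall x, `|psi i x| <= C + d%:R * 2 + 1,
      forall x, divergence act psi x = divergence act phi x /\
        forall i, ~ E (unitv i) x -> psi i x \is a Num.int,
      mp Y /\ mu [set x | ~ Y x] = 0 &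
      forall x, Y x -> (forall g, Y (act g x)) /\ tiled m E x].
Proof.
move=> act0 actD mact pact mf f_sep mphi phiC phi_div m0.
(* The margin [3 * m] is what the frames of the tiling need, and the parameter [m] keeps every box
   at least as large as a tile. *)
have [U [Y [mU Usep [mY Yact] Y0 Ycov]]] := toast act0 actD mact pact mf f_sep (3 * m) m.
have n0 k : (0 < @side d (3 * m) m k)%N by apply: leq_trans (side_ge _ _ _); rewrite addnS.
have nm k : (m <= @side d (3 * m) m k)%N.
  by apply: leq_trans (side_ge _ _ _); rewrite -!addnA leq_addr.
have D0 : (0 < 3 * m)%N by rewrite muln_gt0.
have [psi [h1 h2 h3 h4]] := flow_rounding act0 actD mact n0 D0 mU Usep mphi phiC phi_div.
exists (same_boxes act (@side d (3 * m) m) U), psi, Y; split=> //.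
- split; first exact: mp_same_boxes.
  + exact: same_boxes0.
  + by move=> v w x; exact: same_boxes_trans.
  + by move=> v x; exact: same_boxes_sym.
- by move=> x; split=> // i; exact: h4.
- move=> x Yx; split; first by move=> g; exact: Yact.
  split; first by apply: same_boxes_fin; exact: Ycov.
  by apply: class_tiling (Ycov x Yx); try exact: Usep; try exact: mU.
Qed.

End BoxFlow.

(** * The flow on the orbits of the finite factor *)

Section InvariantBoxFlow.
Context {dX : measure_display} {X : measurableType dX} {R : realType}
  {d : nat} {Delta : finZmodType}.
Local Notation G := (Grp d Delta).
Local Notation V := 'rV[int]_d.
Variables (mu : probability X R) (act : G -> X -> X) (f : X -> R).
Hypotheses (act0 : forall x, act 0 x = x)
  (actD : forall g h x, act (g + h) x = act g (act h x))
  (mact : forall g, measurable_fun setT (act g))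
  (pact : forall g (B : set X), measurable B -> mu (act g @^-1` B) = mu B)
  (act_free : forall g x, act g x = x -> g = 0)
  (mf : measurable_fun setT f) (f_inj : injective f).
Variables (A B Z : X -> Prop) (S0 : seq G) (w : seq_sub S0 -> X -> R).
Hypotheses (mZ : mp Z) (Z0 : pr mu (fun x => ~ Z x) = 0)
  (Zact : forall g x, Z x -> Z (act g x))
  (mw : forall i, measurable_fun setT (w i) /\ (forall x, 0 <= w i x <= 1))
  (wAB : forall x, Z x -> \sum_i w i x = (`[< A x >])%:R /\
        \sum_i w i (act (- val i) x) = (`[< B x >])%:R).

Let tau (z : Delta) (x : X) : X := act ((0, z) : G) x.
Let X' := invType tau.
Let T (v : V) (x : X') : X' := act ((v, 0) : G) x.

Lemma act_pair (v v' : V) (z z' : Delta) x :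
  act ((v, z) : G) (act ((v', z') : G) x) = act ((v + v', z + z') : G) x.
Proof. by rewrite -actD. Qed.

Let T0 x : T 0 x = x. Proof. exact: act0. Qed.

Let TD g h x : T (g + h) x = T g (T h x).
Proof. by rewrite /T act_pair addr0. Qed.

Let Ttau v z x : T v (tau z x) = tau z (T v x).
Proof. by rewrite /T /tau !act_pair !addr0 !add0r. Qed.

Let mT v : measurable_fun setT (T v).
Proof.
move=> _ B' /inv_measurable[mB iB]; rewrite setTI; apply/inv_measurable; split.
  by rewrite -[X in measurable X]setTI; exact: mact.
by move=> z x; rewrite /preimage /= Ttau; exact: iB.
Qed.

(** The maximum over a [Delta]-orbit is invariant, hence measurable on [X']. It is attained, so
    injectivity of [f] and freeness still let it separate the points moved by a nonzero [v]. *)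
Let f' (x : X) : R := \big[Num.max/f x]_z f (tau z x).

Let f'_tau z x : f' (tau z x) = f' x.
Proof.
have le y t : f' (tau t y) <= f' y.
  apply: bigmax_le => [|u _]; first by rewrite (le_bigmax_cond _ (fun z => f (tau z y)) (j := t)).
  rewrite /tau act_pair addr0.
  exact: (le_bigmax_cond _ (fun z => f (tau z y)) (j := u + t)).
apply/eqP; rewrite eq_le le /=; have := le (tau z x) (- z).
suff -> : tau (- z) (tau z x) = x by [].
by rewrite /tau act_pair addNr addr0 act0.
Qed.

Let mf' : measurable_fun setT f'.
Proof.
rewrite /f'; move: (index_enum _) => s; elim: s => [|z s IH].
  by under eq_fun do [rewrite big_nil].
under eq_fun do [rewrite big_cons]; apply: measurable_maxr => //.
exact: (measurableT_comp mf (mact _)).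
Qed.

Let f'_ex x : exists z, f' x = f (tau z x).
Proof.
rewrite /f'; apply: (big_ind (fun r => exists z, r = f (tau z x))) => [|r1 r2 [z1 e1] [z2 e2]|z _].
- by exists 0; rewrite /tau act0.
- by case: (leP r1 r2) => _; [exists z2|exists z1].
- by exists z.
Qed.

Let f'_sep v x : f' (T v x) = f' x -> v = 0.
Proof.
have [z ->] := f'_ex (T v x); have [z' ->] := f'_ex x => /f_inj.
rewrite /tau /T act_pair => e.
have h : act ((v, z - z') : G) (tau z' x) = tau z' x.
  by rewrite /tau act_pair -e subrK add0r !addr0.
by have [] := act_free h.
Qed.

(** The order of quantifiers matters: [M] comes from the fractional matching alone, so [m] can later
    be taken large compared with it. *)
Lemma invariant_box_flow : exists M : nat, forall m, (0 < m)%N ->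
  exists (E : V -> X -> Prop) (psi : 'I_d -> X -> R) (Y : X -> Prop),
  [/\ class_relation (fun v => act ((v, 0) : G)) E /\
        forall v z x, E v (act ((0, z) : G) x) <-> E v x,
      forall i, [/\ measurable_fun setT (psi i), forall x, `|psi i x| <= M%:R &
        forall z x, psi i (act ((0, z) : G) x) = psi i x],
      forall i x, ~ E (unitv i) x -> psi i x \is a Num.int,
      mp Y /\ pr mu (fun x => ~ Y x) = 0 &
      forall x, Y x -> [/\ forall g, Y (act g x), tiled m E x &
        divergence (fun v => act ((v, 0) : G)) psi x =
          \sum_z ((`[< A (act ((0, z) : G) x) >])%:R - (`[< B (act ((0, z) : G) x) >])%:R)]].
Proof.
have [mu' mu'E] := inv_probability tau mu.
have pT v (B' : set X') : measurable B' -> mu' (T v @^-1` B') = mu' B'.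
  by rewrite !mu'E => /inv_measurable[mB _]; exact: pact.
have Zg g x : Z (act g x) <-> Z x.
  by split=> [/(Zact (- g))|]; [rewrite -actD addNr act0|exact: Zact].
pose w' i x : R := (`[< Z x >])%:R * w i x.
have w'01 i x : 0 <= w' i x <= 1.
  by have [_ /(_ x)] := mw i; rewrite /w'; case: asboolP => _; rewrite ?mul1r // mul0r lexx ler01.
have mw' i : measurable_fun setT (w' i).
  by apply: measurable_funM; [exact: measurable_pred|have [] := mw i].
pose g i (x : X') : R := \sum_z w' i (tau z x).
have bg i : bounded_measurable (g i).
  split; first apply/inv_measurable_fun; first split.
  - rewrite /g; have mz z : measurable_fun setT (fun x : X => w' i (tau z x)).
      exact: (measurableT_comp (mw' i) (mact _)).
    exact: (measurable_sum (index_enum Delta) mz).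
  - move=> t x; rewrite /g (reindex_inj (addIr (- t))); apply: eq_bigr => z _.
    by rewrite /tau act_pair addr0 subrK.
  exists #|Delta| => x; rewrite /g (le_trans (ler_norm_sum _ _ _)) //.
  rewrite -sum1_card natr_sum; apply: ler_sum => z _.
  by have /andP[h1 h2] := w'01 i (tau z x); rewrite ger0_norm.
(* After summation over [Delta] the [Delta]-part of the displacement [val i] disappears, and only
   the coboundary along [(val i).1] remains. *)
have [phi [bphi ephi]] := bounded_boundary_sum (index_enum _)
  (fun i => bounded_coboundary T0 TD mT (val i).1 (bg i)).
have act_opp (s : G) z x : act (- s) (tau z x) = act (- s.1, z - s.2) x.
  by case: s => a e; rewrite /tau act_pair addr0 addrC.
have divE x : Z x -> divergence T phi x =
    \sum_z ((`[< A (tau z x) >])%:R - (`[< B (tau z x) >])%:R).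
  move=> Zx; rewrite ephi big_split /= sumrN.
  rewrite [X in X - _]exchange_big /= sumrB; congr (_ - _).
    apply: eq_bigr => z _; have [<- _] := wAB ((Zg (0, z) x).2 Zx).
    by apply: eq_bigr => i _; rewrite /w' asboolT ?mul1r //; exact: Zact.
  rewrite (eq_bigr (fun i => \sum_z w i (act (- val i) (tau z x)))) => [|i _].
    rewrite exchange_big; apply: eq_bigr => z _ /=.
    by have [_ <-] := wAB ((Zg (0, z) x).2 Zx).
  rewrite /g (reindex_inj (addIr (- (val i).2))); apply: eq_bigr => z _.
  rewrite /w' /T /tau act_pair add0r addr0 asboolT ?mul1r; last exact/Zg.
  by rewrite -act_opp.
(* The rounding requires an integral divergence at every point, also off [Z]; there the cut-off
   makes it zero. *)
have div0 x : ~ Z x -> divergence T phi x = 0.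
  move=> nZ; rewrite ephi big1 // => i _.
  rewrite /g !big1 ?subrr // => z _; rewrite /w' asboolF ?mul0r // => h; apply: nZ.
    by move/Zg/Zg: h.
  by move/Zg: h.
have phi_int x : divergence T phi x \is a Num.int.
  have [Zx|/div0 ->] := pselect (Z x); last exact: rpred0.
  by rewrite divE // rpred_sum // => z _; rewrite rpredB // rpred_nat.
have [N hN] := choice (fun i => (bphi i).2).
pose C := (\sum_i N i)%N.
have phiC i x : `|phi i x| <= C%:R.
  by apply: le_trans (hN i x) _; rewrite ler_nat /C (bigD1 i) //= leq_addr.
exists (C + d * 2 + 1)%N => m m0.
have mf2 : measurable_fun setT (f' : X' -> R) by apply/inv_measurable_fun.
have [E [psi [Y [[mE E0 Et Es] hpsi hdiv [mY Y0] hY]]]] :=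
  box_flow T0 TD mT pT mf2 f'_sep (fun i => (bphi i).1) phiC phi_int m0.
have {}mY := (inv_mp tau Y).1 mY.
have Yx z x : Y (tau z x) <-> Y x by exact: mY.2.
exists E, psi, (fun x => Y x /\ Z x); split.
- split; first split=> //.
    by move=> v; have /inv_mp[] := mE v.
  by move=> v z x; have /inv_mp[_] := mE v; exact.
- move=> i; have [/inv_measurable_fun[mpsi ipsi] bpsi] := hpsi i; split=> // x.
  by rewrite !natrD natrM; exact: bpsi.
- by move=> i x; have [_] := hdiv x; exact.
- split; first exact: mp_and mY.1 mZ.
  apply/eqP; rewrite eq_le pr_ge0 andbT -[leRHS]addr0 -{1}Z0.
  have -> : 0 = pr mu (fun x => ~ Y x) by rewrite /pr -mu'E Y0.
  rewrite addrC; apply: le_trans (pr_or mu (mp_not mY.1) (mp_not mZ)); apply: pr_le.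
  + by apply/mp_not/mp_and => //; exact: mY.1.
  + by apply: mp_or; apply: mp_not => //; exact: mY.1.
  by move=> x /not_andP.
- move=> x [Yx1 Zx]; have [Yv tx] := hY x Yx1; split=> //.
    move=> [v z]; split; last exact: Zact.
    have -> : act (v, z) x = tau z (T v x) by rewrite /tau /T act_pair addr0 add0r.
    by apply/Yx; exact: Yv.
  by have [e _] := hdiv x; rewrite -(divE x Zx) -e.
Qed.

End InvariantBoxFlow.

(** * Measurable matchings *)

Section MeasurableMatching.
Context {dX : measure_display} {X : measurableType dX} {R : realType}
  {d : nat} {Delta : finZmodType}.
Local Notation G := (Grp d Delta).
Local Notation V := 'rV[int]_d.
Local Notation dirs := (bool * 'I_d)%type.
Local Notation slot := (V * dirs * nat)%type.
Variables (act : G -> X -> X) (f : X -> R).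
Hypotheses (act0 : forall x, act 0 x = x)
  (actD : forall g h x, act (g + h) x = act g (act h x))
  (mact : forall g, measurable_fun setT (act g))
  (act_free : forall g x, act g x = x -> g = 0)
  (mf : measurable_fun setT f) (f_inj : injective f).
Variables (A B Y : X -> Prop) (E : V -> X -> Prop) (psi : 'I_d -> X -> R) (m M kap : nat).
Hypotheses (mA : mp A) (mB : mp B) (mY : mp Y) (Yact : forall g x, Y x -> Y (act g x))
  (E_class : class_relation (fun v => act ((v, 0) : G)) E)
  (E_Delta : forall v z x, E v (act ((0, z) : G) x) <-> E v x)
  (mpsi : forall i, measurable_fun setT (psi i))
  (psiM : forall i x, `|psi i x| <= M%:R)
  (psi_Delta : forall i z x, psi i (act ((0, z) : G) x) = psi i x)
  (psi_int : forall i x, ~ E (unitv i) x -> psi i x \is a Num.int)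
  (Y_tiled : forall x, Y x -> tiled m E x)
  (psi_div : forall x, Y x -> divergence (fun v => act ((v, 0) : G)) psi x =
     \sum_z ((`[< A (act ((0, z) : G) x) >])%:R - (`[< B (act ((0, z) : G) x) >])%:R))
  (m0 : (0 < m)%N) (kap0 : (0 < kap)%N) (kapM : (2 * d * M * (3 * m) ^ d <= kap * m)%N)
  (A_dense : forall x, Y x -> (kap <= count (fun g => `[< A (act g x) >]) (@gbox d Delta 0 m))%N)
  (B_dense : forall x, Y x -> (kap <= count (fun g => `[< B (act g x) >]) (@gbox d Delta 0 m))%N).

Let split_act (v : V) (z : Delta) x : act ((v, z) : G) x = act ((0, z) : G) (act ((v, 0) : G) x).
Proof. by rewrite act_pair // add0r addr0. Qed.

Let E_act v g x : E v (act g x) <-> E v (act ((g.1, 0) : G) x).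
Proof. by case: g => a z /=; rewrite split_act; exact: E_Delta. Qed.

Let mE v : mp (E v). Proof. by case: E_class. Qed.

Let E0 x : E 0 x. Proof. by case: E_class. Qed.

Let E_trans (g h : G) x : E g.1 x -> E h.1 (act g x) -> E (h + g).1 x.
Proof. by move=> Eg /E_act Eh; case: E_class => _ _ t _; exact: t. Qed.

Let E_sym (g : G) x : E g.1 x -> E (- g).1 (act g x).
Proof. by move=> Eg; apply/E_act; case: E_class => _ _ _; exact. Qed.

Let E_diff (g h : G) x : E g.1 x -> E h.1 x -> E (h - g).1 (act g x).
Proof.
by move=> Eg Eh; apply: E_trans; [exact: E_sym|rewrite -actD addNr act0].
Qed.

Let E_back (g h : G) x : E g.1 x -> E (h - g).1 (act g x) -> E h.1 x.
Proof. by move=> Eg Eh; rewrite -[h](subrK g); exact: E_trans. Qed.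

Definition edge_flow (x : X) (e : dirs) : R :=
  if e.1 then psi e.2 x else - psi e.2 (act ((- unitv e.2, 0) : G) x).
Local Notation J := edge_flow.

Let mJ e : measurable_fun setT (J ^~ e).
Proof.
case: e => -[] i; rewrite /edge_flow /=; first exact: mpsi.
by apply: measurableT_comp => //; exact: (measurableT_comp (mpsi i) (mact _)).
Qed.

Let psi_act i g x : psi i (act g x) = psi i (act ((g.1, 0) : G) x).
Proof. by case: g => a z /=; rewrite split_act psi_Delta. Qed.

Let J_act g x e : J (act g x) e = J (act ((g.1, 0) : G) x) e.
Proof.
rewrite /edge_flow psi_act -!actD; case: e.1 => //; congr (- _).
by rewrite psi_act [RHS]psi_act.
Qed.

Let J_flip x p e : J (act ((p + dir e, 0) : G) x) (flip e) = - J (act ((p, 0) : G) x) e.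
Proof.
case: e => -[] i; rewrite /edge_flow /dir /flip /=.
  by rewrite act_pair // addr0 addrC addrK.
by rewrite opprK act_pair // addr0 addrC.
Qed.

Let J_int x e : ~ E (dir e) x -> J x e \is a Num.int.
Proof.
case: e => -[] i; rewrite /edge_flow /dir /= => nE; first exact: psi_int.
rewrite rpredN; apply: psi_int => h; apply: nE.
have := @E_sym ((unitv i, 0) : G) _ h; rewrite /= act_pair // addr0 subrr.
by rewrite -[X in act X x]/(0 : G) act0.
Qed.

Let J_le x e : J x e <= M%:R.
Proof.
by case: e => -[] i; rewrite /edge_flow /=; apply: le_trans (ler_norm _) _; rewrite ?normrN; exact: psiM.
Qed.

Let J_div x : \sum_e J x e = divergence (fun v => act ((v, 0) : G)) psi x.
Proof.
rewrite (eq_bigr (fun e : dirs => J x (e.1, e.2))) => [|[]//].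
rewrite -(pair_bigA _ (fun b i => J x (b, i))) /= exchange_big /divergence.
by apply: eq_bigr => i _; rewrite big_bool.
Qed.

Local Notation label := ((G + slot) * option slot)%type.

(** Renames a target given relative to [act g x] as one relative to [x]. *)
Let shift (g : G) (t : G + slot) : G + slot :=
  match t with inl h => inl (h + g) | inr s => inr (s.1.1 + g.1, s.1.2, s.2) end.

(* Targets and slots are named relative to the point that carries the label. *)
Definition matching_at (x : X) (lam : G -> label) : Prop :=
 [/\ A x -> match (lam 0).1 with
       | inl k => [/\ B (act k x), E k.1 x, near (7 * m) 0 k.1 & (lam k).2 = None]
       | inr s => [/\ E s.1.1 x, ~ E (s.1.1 + dir s.1.2) x,
           s.2%:R < J (act ((s.1.1, 0) : G) x) s.1.2 & near (7 * m) 0 s.1.1] end,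
     forall g, A x -> A (act g x) -> E g.1 x -> (lam 0).1 = shift g (lam g).1 -> g = 0,
     forall e (j : nat), ~ E (dir e) x -> j%:R < J x e ->
       exists g, [/\ A (act g x), E g.1 x & (lam g).1 = inr (- g.1, e, j)],
     B x -> match (lam 0).2 with
       | None => exists g, [/\ A (act g x), E g.1 x & (lam g).1 = inl (- g)]
       | Some s => [/\ ~ E s.1.1 x, E (s.1.1 + dir s.1.2) x,
           s.2%:R < J (act ((s.1.1, 0) : G) x) s.1.2 & near (7 * m) (s.1.1 + dir s.1.2) 0] end &
     forall e (j : nat), ~ E (- dir e) x -> j%:R < J (act ((- dir e, 0) : G) x) e ->
       exists g, [/\ B (act g x), E g.1 x, (lam g).2 = Some (- dir e - g.1, e, j) &
         forall g', B (act g' x) -> E g'.1 x -> (lam g').2 = Some (- dir e - g'.1, e, j) -> g' = g]].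

Let matching_at_local x lam lam' : (forall g, E g.1 x -> lam g = lam' g) ->
  matching_at x lam -> matching_at x lam'.
Proof.
move=> e [h1 h2 h3 h4 h5]; have e0 : lam 0 = lam' 0 by apply: e; exact: E0.
split.
- by move=> /h1; rewrite e0; case: (lam' 0).1 => // k [? Ek ? <-]; rewrite e.
- by move=> g Ax Ag Eg; rewrite -e0 -e //; exact: h2.
- by move=> b j nE jJ; have [g [Ag Eg lg]] := h3 b j nE jJ; exists g; rewrite -e.
- move=> /h4; rewrite e0; case: (lam' 0).2 => // -[g [Ag Eg lg]].
  by exists g; rewrite -e.
- move=> b j nE jJ; have [g [Bg Eg lg gu]] := h5 b j nE jJ; exists g; split=> //.
    by rewrite -e.
  by move=> g' Bg' Eg'; rewrite -e //; exact: gu.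
Qed.

Let m_matching_at lam : mp (fun x => matching_at x lam).
Proof.
have mAg g : mp (fun x => A (act g x)) by exact: (mp_comp (mact g) mA).
have mBg g : mp (fun x => B (act g x)) by exact: (mp_comp (mact g) mB).
have mJlt (j : nat) e : mp (fun x => j%:R < J x e) by apply: mp_lt => //; exact: measurable_cst.
have mJg g (j : nat) e : mp (fun x => j%:R < J (act g x) e).
  exact: (mp_comp (mact g) (mJlt j e)).
have and3 (P Q S U : X -> Prop) : mp P -> mp Q -> mp S -> mp U ->
    mp (fun x => [/\ P x, Q x, S x & U x]).
  move=> mP mQ mS mU; apply: (@mp_ext _ _ (fun x => (P x /\ Q x) /\ (S x /\ U x))).
    by move=> x; split=> [[[? ?] [? ?]]|[? ? ? ?]].
  by apply: mp_and; apply: mp_and.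
have and2 (P Q S : X -> Prop) : mp P -> mp Q -> mp S -> mp (fun x => [/\ P x, Q x & S x]).
  move=> mP mQ mS; apply: (@mp_ext _ _ (fun x => P x /\ (Q x /\ S x))).
    by move=> x; split=> [[? [? ?]]|[? ? ?]].
  by apply: mp_and => //; apply: mp_and.
have and4 (P Q S U W : X -> Prop) : mp P -> mp Q -> mp S -> mp U -> mp W ->
    mp (fun x => [/\ P x, Q x, S x, U x & W x]).
  move=> mP mQ mS mU mW; apply: (@mp_ext _ _ (fun x => (P x /\ Q x) /\ [/\ S x, U x & W x])).
    by move=> x; split=> [[[? ?] [? ? ?]]|[? ? ? ? ?]].
  by apply: mp_and; [exact: mp_and|exact: and2].
apply: and4.
- apply: mp_imp => //; case: (lam 0).1 => [k|s]; apply: and3 => //; try exact: mp_cst.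
  exact: mp_not.
- by apply: mp_forall => g; do 3 (apply: mp_imp => //); exact: mp_cst.
- apply: mp_forall => e; apply: mp_forall => j; apply: mp_imp; first exact: mp_not.
  by apply: mp_imp => //; apply: mp_exists => g; apply: and2 => //; exact: mp_cst.
- apply: mp_imp => //; case: (lam 0).2 => [s|].
    by apply: and3 => //; [exact: mp_not|exact: mp_cst].
  by apply: mp_exists => g; apply: and2 => //; exact: mp_cst.
- apply: mp_forall => e; apply: mp_forall => j; apply: mp_imp; first exact: mp_not.
  apply: mp_imp => //; apply: mp_exists => g; apply: and3 => //; first exact: mp_cst.
  apply: mp_forall => g'; do 2 (apply: mp_imp => //); apply: mp_imp; exact: mp_cst.
Qed.

Let sub_addK (W : zmodType) (p q r : W) : p - (q + r) + q = p - r.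
Proof. by rewrite opprD addrA addrAC subrK. Qed.

Let nearB k (p q r : V) : near k (p - r) (q - r) = near k p q.
Proof.
apply: eq_forallb => i; rewrite !mxE; move: (p 0 i) (q 0 i) (r 0 i) => a b c.
by rewrite opprD opprK addrA addrAC subrK.
Qed.

(** The class matching is computed in coordinates based at [x] and then renamed relative to each
    point. Relative names do not depend on the base point, so the same labelling is correct seen
    from every point of the class. *)
Let matching_ex x : Y x ->
  exists lam : G -> label, forall g, E g.1 x -> matching_at (act g x) (fun k => lam (k + g)).
Proof.
move=> Yx; have [[s hs] [K hK]] := Y_tiled Yx.
pose C := undup [seq v <- s | `[< E v x >]].
have memC v : (v \in C) <-> E v x.
  rewrite mem_undup mem_filter; split=> [/andP[/asboolP]//|Ev].
  by rewrite hs // andbT; apply/asboolP.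
pose a (g : G) := `[< A (act g x) >]; pose b (g : G) := `[< B (act g x) >].
pose Jx p e := J (act ((p, 0) : G) x) e.
have E_at p v : E v (act ((p, 0) : G) x) -> E p x -> E (p + v) x.
  move=> Ev Ep; rewrite addrC.
  by have := @E_trans ((p, 0) : G) ((v, 0) : G) x Ep Ev; rewrite /= .
have act_uv u v z : act ((v, z) : G) (act ((u, 0) : G) x) = act ((u + v, z) : G) x.
  by rewrite act_pair // addr0 addrC.
have [|||||||||||||alpha [beta [h1 h2 h3 h4 h5]]] := @class_matching R d Delta C Jx a b K m M kap.
- exact: undup_uniq.
- by move=> p e; exact: J_flip.
- move=> p /memC Ep; rewrite J_div psi_div; last exact: Yact.
  by apply: eq_bigr => z _; rewrite -!split_act.
- by move=> p e /memC Ep nE; apply: J_int => h; move/negP: nE; apply; apply/memC; exact: E_at.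
- by move=> p e; exact: J_le.
- exact: m0.
- by move=> p /memC Ep; have [] := hK p Ep.
- by move=> p /memC Ep; have [] := hK p Ep.
- by move=> p /memC Ep; have [_ _ h] := hK p Ep => q /h[/memC].
- exact: kap0.
- exact: kapM.
- move=> u; have := A_dense (Yact ((u, 0) : G) Yx); congr (_ <= _)%N.
  by apply: eq_count => -[v z]; rewrite /a -act_uv.
- move=> u; have := B_dense (Yact ((u, 0) : G) Yx); congr (_ <= _)%N.
  by apply: eq_count => -[v z]; rewrite /b -act_uv.
pose rel (g : G) (s : slot) : slot := (s.1.1 - g.1, s.1.2, s.2).
pose lam (g : G) : label := (match alpha g with inl h => inl (h - g) | inr s => inr (rel g s) end,
  match beta g with None => None | Some s => Some (rel g s) end).
exists lam => g Eg; have gC := (memC g.1).2 Eg.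
have act_sub h : act (h - g) (act g x) = act h x by rewrite -actD subrK.
have E_in p : p \in C -> E (p - g.1) (act g x).
  by move=> /memC Ep; exact: (@E_diff g ((p, 0) : G) x Eg Ep).
have E_out p : E (p - g.1) (act g x) -> p \in C.
  by move=> h; apply/memC; exact: (@E_back g ((p, 0) : G) x Eg h).
have J_rel p e : J (act ((p - g.1, 0) : G) (act g x)) e = Jx p e.
  by rewrite -actD J_act /= subrK.
have rel_eq (g' : G) t s' : rel g t = ((rel (g' + g) s').1.1 + g'.1, (rel (g' + g) s').1.2, (rel (g' + g) s').2) ->
    t = s'.
  case: t s' => [[p e] j] [[p' e'] j'] [+ -> ->].
  by rewrite sub_addK => /addIr ->.
split.
- move=> Ag; have := h1 g; rewrite /a asboolT // => /(_ isT gC); rewrite add0r /lam.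
  case: (alpha g) => [h|t] /= [].
    move=> /asboolP Bh hC nr bN; split; rewrite ?act_sub ?subrK ?bN //; first exact: E_in.
    by rewrite -(nearB _ _ _ g.1) subrr in nr.
  move=> tC tnC tJ nr; split=> //; first exact: E_in.
  + by rewrite addrAC => /E_out; exact/negP.
  + by rewrite J_rel.
  + by rewrite -(nearB _ _ _ g.1) subrr in nr.
- move=> g' Ag Ag' Eg' e; suff : g = g' + g.
    by move/esym/eqP; rewrite -subr_eq0 addrK => /eqP.
  apply: h2; rewrite /a ?actD ?asboolT //.
    by apply/memC; exact: E_trans.
  move: e; rewrite add0r /lam; case: (alpha g) => [h|t]; case: (alpha (g' + g)) => [h'|t'] //=.
    by rewrite sub_addK => /(congr1 (fun t : G + slot => if t is inl k then k + g else 0)); rewrite !subrK => ->.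
  by move=> [hp he hj]; congr inr; apply: (rel_eq g'); rewrite /rel hp he hj.
- move=> e j nE jJ.
  have [|||g' [Ag' g'C ag']] := h3 (g.1, e, j).
  + exact: gC.
  + by apply/negP => /= /E_in; rewrite addrC addKr.
  + by rewrite /= /Jx -J_act.
  exists (g' - g); rewrite act_sub; split; [exact/asboolP|exact: E_in|].
  by rewrite /lam /= subrK ag' /rel opprB.
- move=> Bg; have := h4 g; rewrite /b asboolT // => /(_ isT gC); rewrite add0r /lam /=.
  case: (beta g) => [t|].
    move=> [tnC tC tJ nr]; split.
    + by move/E_out; exact/negP.
    + by rewrite addrAC; exact: E_in.
    + by rewrite J_rel.
    + by rewrite -(nearB _ _ _ g.1) subrr -addrAC in nr.
  move=> [g' [Ag' g'C ag']]; exists (g' - g); rewrite act_sub; split; [exact/asboolP|exact: E_in|].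
  by rewrite /= subrK ag' opprB.
- move=> e j nE jJ.
  have [|||h [Bh hC bh hu]] := h5 (g.1 - dir e, e, j).
  + by apply/negP => /= /E_in; rewrite addrC addKr.
  + by rewrite /= subrK.
  + by rewrite /= -J_rel addrAC subrr add0r.
  exists (h - g); rewrite act_sub; split; [exact/asboolP|exact: E_in| |].
    by rewrite /lam /= subrK bh /rel /= opprB addrCA addrA.
  move=> g' Bg' Eg' lg'; apply/eqP; rewrite eq_sym subr_eq eq_sym; apply/eqP; apply: hu.
  + by rewrite /b actD; apply/asboolP.
  + by apply/memC; exact: E_trans.
  move: lg'; rewrite /lam /=; case: (beta (g' + g)) => // -[[p e'] j'] [e1 -> ->]; congr (Some (_, _, _)).
  by rewrite -[p](subrK (g'.1 + g.1)) e1 addrA subrK addrC.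
Qed.

(** A point of [A] has its target in its own class, or it is given a unit of flow crossing to the
    next class, where exactly one point of [B] receives that unit. Uniqueness of the receiver and of
    the sender makes the composed map a bijection. *)
Lemma measurable_matching : exists (o : X -> G) (W : seq G),
  [/\ dmeas o,
      forall x, Y x -> A x -> B (act (o x) x) /\ o x \in W,
      forall x g, Y x -> A x -> A (act g x) -> act (o (act g x)) (act g x) = act (o x) x -> g = 0 &
      forall y, Y y -> B y -> exists g, A (act g y) /\ act (o (act g y)) (act g y) = y].
Proof.
have f_sep (g : G) x : f (act g x) = f x -> g = 0 by move=> /f_inj; exact: act_free.
have E_fin x : Y x -> exists s : seq G, forall g, E g.1 x -> g \in s.
  move=> Yx; have [[s hs] _] := Y_tiled Yx; exists [seq (v, z) | v <- s, z <- enum Delta].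
  move=> [v z] /hs vs; apply/allpairsP; exists (v, z); split=> //.
  by rewrite mem_enum.
pose l0 : label := (inl 0, None).
pose P x (lam : G -> label) := forall g, E g.1 x -> matching_at (act g x) (fun k => lam (k + g)).
have mP c : mp (fun x => P x (decode_label l0 c)).
  apply: mp_forall => g; apply: mp_imp => //.
  exact: (mp_comp (mact g) (m_matching_at (fun k => decode_label l0 c (k + g)))).
have P_local x lam lam' : (forall g, E g.1 x -> lam g = lam' g) -> P x lam -> P x lam'.
  move=> e Pl g Eg; apply: matching_at_local (Pl g Eg) => k Ek; apply: e.
  exact: E_trans.
have [h [mh hP]] := class_labelling act0 actD mact mf f_sep (fun g => mE g.1) E0 E_trans E_sym
  mY Yact E_fin mP P_local matching_ex.
have {}hP x : Y x -> matching_at x (fun k => h (act k x)).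
  move=> Yx; have [v [Ev Pv]] := hP x Yx; have := Pv (- v) (E_sym Ev).
  rewrite -actD addNr act0; apply: matching_at_local => g _ /=.
  by rewrite subrK.
pose al x := (h x).1; pose be x := (h x).2.
(* In the second case the unit [s], named relative to [x], must be the entering unit of [act k x],
   hence the subtraction of [k.1]. *)
pose Rel (k : G) x := al x = inl k \/
  exists s : slot, [/\ al x = inr s, B (act k x) & be (act k x) = Some (s.1.1 - k.1, s.1.2, s.2)].
have mRel k : mp (Rel k).
  apply: mp_or; first exact: (mh (fun l => l.1 = inl k)).
  apply: mp_exists => s; apply: (@mp_ext _ _ (fun x => al x = inr s /\ (B (act k x) /\
      be (act k x) = Some (s.1.1 - k.1, s.1.2, s.2)))).
    by move=> x; split=> [[? [? ?]]|[? ? ?]].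
  apply: mp_and; first exact: (mh (fun l => l.1 = inr s)).
  apply: mp_and; first exact: (mp_comp (mact k) mB).
  exact: (mp_comp (mact k) (mh (fun l => l.2 = Some (s.1.1 - k.1, s.1.2, s.2)))).
have E_flip (p : V) e x : E (p + dir e) x -> E (- dir e) (act ((p + dir e, 0) : G) x) -> E p x.
  move=> E1 E2; have := @E_trans ((p + dir e, 0) : G) ((- dir e, 0) : G) x E1 E2.
  by rewrite /= addrC addrK.
have E_cross1 (p : V) e x : E p x -> E (- dir e) (act ((p + dir e, 0) : G) x) -> E (p + dir e) x.
  move=> Ep /(@E_sym ((- dir e, 0) : G)); rewrite /= opprK act_pair // addr0 addrC addrK => Ed.
  by rewrite addrC; exact: (@E_trans ((p, 0) : G) ((dir e, 0) : G) x Ep Ed).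
have E_cross2 (p : V) e x : E (p + dir e) x -> E (dir e) (act ((p, 0) : G) x) -> E p x.
  move=> Ep /(@E_sym ((dir e, 0) : G)); rewrite /= act_pair // addr0 addrC.
  exact: E_flip.
have J_back p e x : J (act ((- dir e, 0) : G) (act ((p + dir e, 0) : G) x)) e = J (act ((p, 0) : G) x) e.
  by rewrite act_pair // addr0 addrC addrK.
have H1 x : Y x -> A x -> match al x with
    | inl k => [/\ B (act k x), E k.1 x, near (7 * m) 0 k.1 & be (act k x) = None]
    | inr s => [/\ E s.1.1 x, ~ E (s.1.1 + dir s.1.2) x,
           s.2%:R < J (act ((s.1.1, 0) : G) x) s.1.2 & near (7 * m) 0 s.1.1] end.
  by move=> Yx Ax; have [+ _ _ _ _] := hP x Yx => /(_ Ax); rewrite act0.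
have H4 x : Y x -> B x -> match be x with
    | None => exists g, [/\ A (act g x), E g.1 x & al (act g x) = inl (- g)]
    | Some s => [/\ ~ E s.1.1 x, E (s.1.1 + dir s.1.2) x,
           s.2%:R < J (act ((s.1.1, 0) : G) x) s.1.2 & near (7 * m) (s.1.1 + dir s.1.2) 0] end.
  by move=> Yx Bx; have [_ _ _ + _] := hP x Yx => /(_ Bx); rewrite act0.
have slot_in x p b j : Y x -> A x -> al x = inr (p, b, j) ->
    let y := act ((p + dir b, 0) : G) x in
    exists2 g, [/\ B (act g y), E g.1 y & be (act g y) = Some (- dir b - g.1, b, j)] &
      forall g', B (act g' y) -> E g'.1 y -> be (act g' y) = Some (- dir b - g'.1, b, j) -> g' = g.
  move=> Yx Ax e; have := H1 x Yx Ax; rewrite e /= => -[Ep nE jJ _].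
  have [_ _ _ _ h5] := hP _ (Yact ((p + dir b, 0) : G) Yx).
  have [||g [Bg Eg bg gu]] := h5 b j; last by exists g.
    by move=> /(E_cross1 _ _ _ Ep).
  by rewrite J_back.
have sub3 (W : zmodType) (p q r : W) : p - (q + (p + r)) = - r - q.
  by rewrite [q + _]addrC opprD opprD !addrA subrr add0r.
have Rel_in x : Y x -> A x -> exists k, Rel k x.
  move=> Yx Ax; case e : (al x) => [k|[[p b] j]]; first by exists k; left.
  have [g [Bg Eg bg] _] := slot_in x p b j Yx Ax e.
  exists (g + (p + dir b, 0)); right; exists (p, b, j); rewrite actD; split=> //.
  by rewrite bg /= sub3.
have Rel_B k x : Y x -> A x -> Rel k x -> B (act k x).
  move=> Yx Ax [e|[s [_ Bk _]]] //.
  by have := H1 x Yx Ax; rewrite e => -[].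
have dir_le (b : dirs) (i : 'I_d) : -1 <= dir b 0 i <= 1.
  by rewrite dirE; case: b.1; case: (i == b.2).
(* Two moves of at most [7 * m] and one edge stay below [20 * m] in each coordinate. *)
have Rel_win k x : Y x -> A x -> Rel k x -> k \in @gbox d Delta (- (20 * m)%N%:Z) (40 * m).
  move=> Yx Ax; rewrite mem_gbox => -[e|[[[p b] j] [e Bk bk]]]; apply/cubeP => i.
    have := H1 x Yx Ax; rewrite e => -[_ _ /forallP/(_ i) + _].
    rewrite mxE; move: (k.1 0 i) => c; lia.
  have := H1 x Yx Ax; rewrite e => -[_ _ _ /forallP/(_ i)].
  have := H4 (act k x) (Yact k Yx) Bk; rewrite bk /= => -[_ _ _ /forallP/(_ i)].
  rewrite !mxE; have := dir_le b i; move: (dir b 0 i) (p 0 i) (k.1 0 i) => q1 q2 q3; lia.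
have Rel_inl_inr k x k' x' s : Y x -> A x -> al x = inl k -> act k x = act k' x' ->
    be (act k' x') <> Some s.
  by move=> Yx Ax e <-; have := H1 x Yx Ax; rewrite e => -[_ _ _ ->].
(* For a crossing unit this is the uniqueness of its receiver in the class beyond the edge. *)
have Rel_fun k k' x : Y x -> A x -> Rel k x -> Rel k' x -> k = k'.
  move=> Yx Ax [e|[[[p b] j] [e Bk bk]]] [e'|[s' [e' Bk' bk']]].
  - by move: e'; rewrite e => /(congr1 (fun t : G + slot => if t is inl k then k else 0)).
  - by rewrite e in e'.
  - by rewrite e in e'.
  have := slot_in x p b j Yx Ax e; set y := act _ x => /= -[g _ gu].
  have es : s' = (p, b, j) by rewrite e in e'; case: e'.
  have at_y (q : G) : act (q - (p + dir b, 0)) y = act q x by rewrite /y -actD subrK.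
  have main (q : G) : B (act q x) -> be (act q x) = Some (p - q.1, b, j) -> q - (p + dir b, 0) = g.
    move=> Bq bq; apply: gu; rewrite ?at_y //.
      have := H4 _ (Yact q Yx) Bq; rewrite bq /= => -[_ Eq _ _].
      have := @E_sym ((p - q.1 + dir b, 0) : G) _ Eq.
      rewrite -actD => /E_act /=; rewrite [p - q.1 + _]addrAC subrK.
      by rewrite -[X in E X]/(- (p + dir b - q.1)) opprB.
    rewrite bq /=; congr (Some (_, _, _)); rewrite -[RHS]/(- dir b - (q.1 - (p + dir b))).
    by rewrite opprB addrA (addrC p (dir b)) addKr.
  by rewrite es in bk'; have := main k Bk bk; rewrite -(main k' Bk' bk') => /addIr.
have Rel_inj k k' x g : Y x -> A x -> A (act g x) -> Rel k x -> Rel k' (act g x) ->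
    act k' (act g x) = act k x -> g = 0.
  move=> Yx Ax Ag Rk Rk' exy; have Yg : Y (act g x) by exact: Yact.
  have kg : k' + g = k.
    apply/eqP; rewrite -subr_eq0; apply/eqP; apply: (act_free (x := act k x)).
    by rewrite -actD subrK actD.
  (* Within a class, points of [A] with the same target coincide. It remains to see that both points
     lie in one class: they share either a target in their class or the tail of the edge that they
     use. *)
  suff [Eg e] : E g.1 x /\ al x = shift g (al (act g x)).
    by have [_ h2 _ _ _] := hP x Yx; apply: h2 => //; rewrite act0.
  case: Rk Rk' => [e|[[[p b] j] [e Bk bk]]] [e'|[[[p' b'] j'] [e' Bk' bk']]].
  - rewrite e e' /= kg; split=> //.
    have := H1 x Yx Ax; rewrite e => -[_ Ek _ _].
    have := H1 _ Yg Ag; rewrite e' => -[_ /E_sym Ek' _ _]; rewrite exy in Ek'.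
    by have := E_trans Ek Ek'; rewrite -kg addKr.
  - by case: (Rel_inl_inr k x k' (act g x) _ Yx Ax e (esym exy) bk').
  - by case: (Rel_inl_inr k' (act g x) k x _ Yg Ag e' exy bk).
  move: bk' bk; rewrite exy => -> /= [ep eb ej].
  have pE : p' + g.1 = p.
    rewrite -[p](subrK k.1) -ep -kg -[(k' + g).1]/(k'.1 + g.1).
    by rewrite addrA subrK.
  rewrite e e' /= pE eb ej; split=> //.
  have := H1 x Yx Ax; rewrite e => -[/= Ep _ _ _].
  have := H1 _ Yg Ag; rewrite e' => -[/= Ep' _ _ _].
  have := @E_sym ((p', 0) : G) _ Ep'; rewrite -actD => /E_act /=; rewrite pE => Eq.
  have := @E_trans ((p, 0) : G) ((- p', 0) : G) x Ep Eq.
  by rewrite /= -pE addKr.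
have [||o [mo oP]] := @dmeas_select _ X _ (fun (k : G) x => A x /\ Y x -> Rel k x).
- by move=> k; apply: mp_imp => //; exact: mp_and.
- move=> x; have [[Ax Yx]|nAY] := pselect (A x /\ Y x); last by exists 0.
  by have [k Rk] := Rel_in x Yx Ax; exists k.
have {}oP x : Y x -> A x -> Rel (o x) x by move=> Yx Ax; exact: oP.
exists o, (@gbox d Delta (- (20 * m)%N%:Z) (40 * m)); split=> //.
- by move=> x Yx Ax; split; [apply: Rel_B => //|apply: (Rel_win _ x) => //]; exact: oP.
- move=> x g Yx Ax Ag; apply: (Rel_inj _ _ x g Yx Ax Ag); first exact: oP.
  by apply: oP => //; exact: Yact.
move=> y Yy By; suff [g [Ag Rg]] : exists g, A (act g y) /\ Rel (- g) (act g y).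
  exists g; split=> //; have Yg : Y (act g y) by exact: Yact.
  by rewrite (Rel_fun _ _ _ Yg Ag (oP _ Yg Ag) Rg) -actD addNr act0.
have := H4 y Yy By; case e : (be y) => [[[p b] j]|]; last first.
  by move=> [g [Ag _ ag]]; exists g; split=> //; left.
(* A unit entering the class of [y] leaves the class of the tail [p] of its edge, whose matching
   provides the point of [A] that sends it. *)
move=> /= [nE Ep jJ _]; have [_ _ h3 _ _] := hP _ (Yact ((p, 0) : G) Yy).
have [|g [Ag Eg ag]] := h3 b j _ jJ; first by move=> /(E_cross2 _ _ _ Ep).
exists (g + (p, 0)); rewrite actD; split=> //; right; exists (- g.1, b, j); split=> //.
  by rewrite -!actD -addrA addNr act0.
rewrite -!actD -addrA addNr act0 e /=.
by rewrite opprK addKr.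
Qed.

End MeasurableMatching.

(** * Hall condition and equidecompositions *)

Section CompletedMeasure.
Context {dX : measure_display} {X : measurableType dX} {R : realType}
  {d : nat} {Delta : finZmodType}.
Local Notation G := (Grp d Delta).
Variables (mu : probability X R) (act : G -> X -> X).
Hypotheses (act0 : forall x, act 0 x = x)
  (actD : forall g h x, act (g + h) x = act g (act h x))
  (mact : forall g, measurable_fun setT (act g))
  (pact : forall g (B : set X), measurable B -> mu (act g @^-1` B) = mu B)
  (act_free : forall g x, act g x = x -> g = 0).

(** Invariance is included so that what holds on [Y] holds along entire orbits. *)
Definition conull (Y : X -> Prop) :=
  [/\ mp Y, pr mu (fun x => ~ Y x) = 0 & forall g x, Y x -> Y (act g x)].

Lemma conull_and Y Z : conull Y -> conull Z -> conull (fun x => Y x /\ Z x).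
Proof.
move=> [mY Y0 Yact] [mZ Z0 Zact]; split.
- exact: mp_and.
- apply/eqP; rewrite eq_le pr_ge0 andbT -[leRHS]addr0 -{1}Y0 -Z0.
  apply: le_trans (pr_or mu (mp_not mY) (mp_not mZ)); apply: pr_le.
  + by apply/mp_not/mp_and.
  + by apply: mp_or; exact: mp_not.
  by move=> x /not_andP.
- by move=> g x [Yx Zx]; split; [exact: Yact|exact: Zact].
Qed.

Lemma negligible_conull N : mu.-negligible N -> exists2 Y, conull Y & forall x, Y x -> ~ N x.
Proof.
move=> [M [mM M0 NM]].
have [||Y [mY Y0 Yact YM]] := @invariant_core _ X R G mu act act0 actD mact pact (fun x => ~ M x).
- exact: mp_not.
- rewrite (@pr_ext _ _ _ mu _ M) => [|x]; last by split=> [/contrapT//|Mx nM].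
  by rewrite /pr -[X in mu X]/M M0.
by exists Y => // x /YM nM /NM.
Qed.

Lemma conull_negligible Y N : conull Y -> (forall x, Y x -> ~ N x) -> mu.-negligible N.
Proof.
move=> [mY Y0 _] h; exists [set x | ~ Y x]; split; first exact: mp_not.
  by rewrite (prE mu (mp_not mY)) Y0.
by move=> x Nx /= Yx; exact: (h x Yx).
Qed.

Lemma mu_measurable_conull A : mu_measurable mu A ->
  exists A' Y, [/\ mp A', conull Y & forall x, Y x -> (A x <-> A' x)].
Proof.
move=> [B [mB /negligible_conull[Y cY hY]]]; exists B, Y; split=> // x /hY h.
split=> ax; apply: contrapT => nx; apply: h; [by left|by right].
Qed.

(** Adding the null set of points outside [Y] to [A'] gives a measurable cover of [A], and adding it
    to any measurable cover of [A] gives one of [A']. *)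
Lemma mu_cE A A' Y : mp A' -> conull Y -> (forall x, Y x -> (A x <-> A' x)) ->
  mu_c mu A = (pr mu A')%:E.
Proof.
move=> mA' [mY Y0 _] h; rewrite /mu_c -prE //; apply/eqP; rewrite eq_le; apply/andP; split.
  have mD : mp (fun x => A' x \/ ~ Y x) by apply: mp_or => //; exact: mp_not.
  have -> : mu [set x | A' x] = mu [set x | A' x \/ ~ Y x].
    rewrite !prE //; congr (_%:E); apply/eqP; rewrite eq_le; apply/andP; split.
      by apply: pr_le => // x; left.
    by apply: le_trans (pr_or mu mA' (mp_not mY)) _; rewrite Y0 addr0.
  apply: ereal_inf_lbound; exists [set x | A' x \/ ~ Y x] => //; split=> // x Ax /=.
  by have [Yx|] := pselect (Y x); [left; exact/h|right].
apply: le_ereal_inf_tmp => _ [B [mB AB] <-].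
have mB' : mp B by [].
rewrite -[X in (_ <= mu X)%E]/[set x | B x] !prE // lee_fin.
apply: (@le_trans _ _ (pr mu (fun x => B x \/ ~ Y x))).
  apply: pr_le => //; first by apply: mp_or => //; exact: mp_not.
  by move=> x A'x; have [Yx|] := pselect (Y x); [left; apply: AB; exact/h|right].
by apply: le_trans (pr_or mu mB' (mp_not mY)) _; rewrite Y0 addr0.
Qed.

Lemma seq_card (T : choiceType) (s : seq T) : uniq s -> ([set` s] #= `I_(size s))%card.
Proof.
move=> us; have -> : [set` s] = [set` [fset x in s]%fset].
  by apply/seteqP; split=> x /=; rewrite inE.
by apply/card_eq_fsetP; rewrite card_fseq undup_id.
Qed.

Lemma card_le_inj (T U : Type) (P : set T) (Q : set U) (h : T -> U) :
  (forall x, P x -> Q (h x)) -> (forall x y, P x -> P y -> h x = h y -> x = y) -> (P #<= Q)%card.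
Proof.
move=> hQ hi; have e : (h @` P #= P)%card.
  by apply: inj_card_eq => x y /set_mem Px /set_mem Py; exact: hi.
rewrite -(card_le_eql e); apply: subset_card_le => _ [x Px <-]; exact: hQ.
Qed.

(** Freeness turns points of the orbit into group elements. The side is [n.+1] because [box n]
    includes both 0 and [n]. *)
Lemma boxorb_count (A : set X) n x :
  (#|` fset_set (A `&` boxorb act n x)|)%:R =
    (count (fun g => `[< A (act g x) >]) (@gbox d Delta 0 n.+1))%:R :> R.
Proof.
pose s := [seq act g x | g <- [seq g <- @gbox d Delta 0 n.+1 | `[< A (act g x) >]]].
have inj : injective (fun g : G => act g x).
  move=> g h e; apply/eqP; rewrite -subr_eq0; apply/eqP; apply: (act_free (x := act h x)).
  by rewrite -actD subrK.
have -> : A `&` boxorb act n x = [set` s].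
  apply/seteqP; split=> y /=.
    move=> [Ay [g gb gy]]; apply/mapP; exists g => //; rewrite mem_filter; apply/andP; split.
      by apply/asboolP; rewrite gy.
    by rewrite mem_gbox; apply/cubeP => i; have := gb i; move: ((g.1 : 'rV[int]_d) 0 i) => k; lia.
  move=> /mapP[g]; rewrite mem_filter mem_gbox => /andP[/asboolP Ag /cubeP gb] ->; split=> //.
  by exists g => // i; have := gb i; move: ((g.1 : 'rV[int]_d) 0 i) => k; lia.
rewrite (card_fset_set (seq_card _)); last by rewrite map_inj_uniq // filter_uniq // uniq_gbox.
by rewrite size_map size_filter.
Qed.

End CompletedMeasure.

(** * The implications between the three conditions *)

Section Equivalence.
Context {dX : measure_display} {X : measurableType dX} {R : realType}
  {d : nat} {Delta : finZmodType}.
Local Notation G := (Grp d Delta).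
Variables (mu : probability X R) (act : G -> X -> X).
Hypotheses (act0 : forall x, act 0 x = x)
  (actD : forall g h x, act (g + h) x = act g (act h x))
  (mact : forall g, measurable_fun setT (act g))
  (pact : forall g (B : set X), measurable B -> mu (act g @^-1` B) = mu B)
  (act_free : forall g x, act g x = x -> g = 0).

Let act_inj g : injective (act g).
Proof. by move=> x y e; rewrite -(act0 x) -(act0 y) -(addNr g) !actD e. Qed.

(** Moving each point by the element of its piece is injective, since the image pieces are disjoint
    and every [act g] is injective. *)
Lemma card_le_pieces (A B : set X) n As Bs gam S (F : set X) :
  (forall i, (i < n)%N -> Bs i `<=` B /\ act (gam i) @` As i = Bs i) ->
  (forall i j, (i < n)%N -> (j < n)%N -> i <> j -> Bs i `&` Bs j = set0) ->
  (forall i, (i < n)%N -> gam i \in S) ->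
  (forall x, F x -> A x -> exists2 i, (i < n)%N & As i x) ->
  (F `&` A #<= ball1 act S F `&` B)%card.
Proof.
move=> hp hd hS hF.
have ek x : exists i, F x -> A x -> (i < n)%N /\ As i x.
  have [[Fx Ax]|nFA] := pselect (F x /\ A x).
    by have [i ip Ai] := hF x Fx Ax; exists i.
  by exists 0%N => Fx Ax; case: nFA.
have [k hk] := boolp.choice ek.
have hB x : F x -> A x -> Bs (k x) (act (gam (k x)) x).
  by move=> Fx Ax; have [kn Ak] := hk x Fx Ax; have [_ <-] := hp _ kn; exists x.
apply: (card_le_inj (h := fun x => act (gam (k x)) x)).
  move=> x [Fx Ax]; have [kn _] := hk x Fx Ax; split; last by have [BB _] := hp _ kn; exact/BB/hB.
  by exists x => //; right; exists (gam (k x)) => //; exact: hS.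
move=> x y [Fx Ax] [Fy Ay] e; have [kx _] := hk x Fx Ax; have [ky _] := hk y Fy Ay.
have [kk|nk] := pselect (k x = k y); first by move: e; rewrite kk => /act_inj.
have : (Bs (k x) `&` Bs (k y)) (act (gam (k x)) x) by split; [exact: hB|rewrite e; exact: hB].
by rewrite (hd _ _ kx ky nk).
Qed.

(** The Hall condition asks for a generating set, whereas an equidecomposition provides only a
    finite list of elements; the standard generators and all inverses are added. *)
Lemma sym_gen_set_extend (T : seq G) : exists S, sym_gen_set S /\ {subset T <= S}.
Proof.
pose S1 : seq G := [seq (unitv i, 0) | i <- enum 'I_d] ++ [seq (0, z) | z <- enum Delta] ++ T.
pose S := S1 ++ [seq - s | s <- S1].
have S_in s : s \in S1 -> s \in S by move=> h; rewrite mem_cat h.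
have S_opp s : s \in S -> - s \in S.
  rewrite /S mem_cat => /orP[h|/mapP[t tS ->]]; last by rewrite opprK; exact: S_in.
  by rewrite mem_cat; apply/orP; right; exact: map_f.
exists S; split; last by move=> t tT; apply: S_in; rewrite !mem_cat tT !orbT.
split=> //; pose gen (g : G) := exists l : seq G, all (fun s => s \in S) l /\ g = \sum_(s <- l) s.
have gen_in s : s \in S -> gen s by move=> sS; exists [:: s]; rewrite /= sS big_seq1.
have genD g h : gen g -> gen h -> gen (g + h).
  by move=> [l [al ->]] [k [ak ->]]; exists (l ++ k); rewrite all_cat al ak big_cat.
have genN g : gen g -> gen (- g).
  move=> [l [al ->]]; exists [seq - s | s <- l]; rewrite big_map -sumrN; split=> //.
  by rewrite all_map; apply: sub_all al => s /=; exact: S_opp.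
have genV (v : 'rV[int]_d) : gen (v, 0).
  apply: (int_row_ind (P := fun v => gen (v, 0))).
  - by exists [::]; rewrite big_nil.
  - move=> u w gu gw; have -> : (u + w, 0) = ((u, 0) : G) + (w, 0) by congr (_, _); rewrite addr0.
    exact: genD.
  - move=> u gu; have -> : (- u, 0) = - ((u, 0) : G) by congr (_, _); rewrite oppr0.
    exact: genN.
  - by move=> i; apply/gen_in/S_in; rewrite mem_cat map_f // mem_enum.
move=> [v z]; have -> : (v, z) = ((v, 0) : G) + (0, z).
  by congr (_, _); rewrite ?addr0 ?add0r.
apply: genD => //; apply/gen_in/S_in; rewrite !mem_cat; apply/orP; right; apply/orP; left.
by apply: map_f; rewrite mem_enum.
Qed.

Lemma equidecomposable_hall (A B : set X) :
  equidecomposable_ae mu act false A B -> hall_ae mu act A B.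
Proof.
move=> [n [As [Bs [gam [hp hd nA nB]]]]].
have [S [gS subS]] := sym_gen_set_extend ([seq gam i | i <- iota 0 n] ++ [seq - gam i | i <- iota 0 n]).
exists S; split=> //.
have [Y1 cY1 hY1] := negligible_conull act0 actD mact pact nA.
have [Y2 cY2 hY2] := negligible_conull act0 actD mact pact nB.
have cY := conull_and cY1 cY2; have [_ _ Yact] := cY.
apply: (conull_negligible cY) => x Yx; apply=> F finF Forb.
have FY y : F y -> Y1 y /\ Y2 y by move=> /Forb[g _ <-]; exact: Yact.
have gamS i : (i < n)%N -> gam i \in S /\ - gam i \in S.
  by move=> ip; split; apply: subS; rewrite mem_cat; apply/orP; [left|right]; apply: map_f; rewrite mem_iota.
split.
  apply: (@card_le_pieces A B n As Bs gam).
  - by move=> i /hp[].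
  - by move=> i j ip jp ij; have [] := hd i j ip jp ij.
  - by move=> i /gamS[].
  by move=> y Fy Ay; have /not_andP[//|/contrapT[i ip Ai]] := hY1 y (FY y Fy).1; exists i.
apply: (@card_le_pieces B A n Bs As (fun i => - gam i)).
- move=> i /hp[AA _ <- _]; split=> //; apply/seteqP; split=> y.
    by move=> [_ [x' Ax <-] <-]; rewrite -actD addNr act0.
  by move=> Ay; exists (act (gam i) y); [exists y|rewrite -actD addNr act0].
- by move=> i j ip jp ij; have [] := hd i j ip jp ij.
- by move=> i /gamS[].
by move=> y Fy By; have /not_andP[//|/contrapT[i ip Bi]] := hY2 y (FY y Fy).2; exists i.
Qed.

(** Once the discrepancy is at most [a / 2], every box has density at least [a / 2]. The conull set
    may depend on [m], because [m] will be fixed. *)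
Lemma equidistributed_dense (A : set X) (a : R) : 0 < a -> mu_c mu A = a%:E ->
  equidistributed mu act A -> exists N : nat, forall m, (N <= m)%N -> exists Y, conull mu act Y /\
    forall x, Y x -> a / 2 * (m ^ d)%:R <= (count (fun g => `[< A (act g x) >]) (@gbox d Delta 0 m))%:R.
Proof.
move=> a0 ea [_ [c hc]]; pose N := Num.bound (2 * `|c| / a).
(* Side [n.+2] belongs to the index [n.+1] of the discrepancy bound, which must be positive. *)
exists N.+2 => -[//|[//|n]]; rewrite !ltnS => Nn.
have [Y cY hY] := negligible_conull act0 actD mact pact (hc n.+1 isT).
exists Y; split=> // x /hY /contrapT /=; rewrite ea boxorb_count // -[boxorb act n.+1 x]setTI boxorb_count //.
rewrite (@eq_count _ (fun g : G => `[< setT (act g x) >]) xpredT) => [|g /=]; last exact: asboolT.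
rewrite count_predT size_gbox lee_fin => /ler_normlP[+ _]; set k := count _ _.
have F0 : 0 < ((n.+2 ^ d * #|Delta|)%:R : R).
  by rewrite ltr0n muln_gt0 expn_gt0 /=; apply/card_gt0P; exists 0.
rewrite opprB lerBlDr => h.
have cn : c / n.+1%:R <= a / 2.
  rewrite ler_pdivrMr ?ltr0n //; apply: le_trans (ler_norm c) _.
  have : 2 * `|c| / a < N%:R by apply: archi_boundP; rewrite divr_ge0 ?mulr_ge0 // ltW.
  rewrite ltr_pdivrMr // => h2; have h3 : (N%:R : R) <= n.+1%:R by rewrite ler_nat leqW.
  move: h2 h3; move: (N%:R : R) (n.+1%:R : R) (`|c|) => u v w h2 h3.
  have := ler_wpM2l (ltW a0) h3; move: (mulrC u a) h2 => ->; lra.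
have : a / 2 <= k%:R / (n.+2 ^ d * #|Delta|)%:R.
  by move: h cn; move: (_ / _) (c / _) => u v; lra.
rewrite ler_pdivlMr // => h2; apply: le_trans h2.
apply: ler_wpM2l; first by rewrite divr_ge0 // ltW.
rewrite ler_nat leq_pmulr //.
by apply/card_gt0P; exists 0.
Qed.

Let act_sep x : injective (fun g : G => act g x).
Proof.
move=> g h e; apply/eqP; rewrite -subr_eq0; apply/eqP; apply: (act_free (x := act h x)).
by rewrite -actD subrK.
Qed.

(** The Hall inequality is rewritten as a count of group elements; 0 joins [S] because the 1-ball
    contains [F]. *)
Lemma hall_seq_count (A B : X -> Prop) (S : seq G) z (s : seq G) : uniq s ->
  (forall F : set X, finite_set F -> F `<=` Defs.orbit act z -> (F `&` A #<= ball1 act S F `&` B)%card) ->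
  (forall u, u \in s -> A (act u z)) ->
  (size s <= size (undup [seq g <- [seq (t + u)%R | u <- s, t <- undup (0%R :: S)] | `[< B (act g z) >]]))%N.
Proof.
move=> us hall sA; set L := undup _.
pose F := [set` [seq act u z | u <- s]].
have FA : F `<=` A by move=> x /= /mapP[u us' ->]; exact: sA.
have : (F `&` A #<= ball1 act S F `&` B)%card.
  apply: hall; first exact: finite_seq.
  by move=> x /= /mapP[u _ ->]; exists u.
have -> : F `&` A = F by apply/setIidPl.
move=> h; rewrite -card_le_II -(size_map (fun g => act g z) s) -(size_map (fun g => act g z) L).
have uF : uniq [seq act u z | u <- s] by rewrite map_inj_uniq.
have uL : uniq [seq act u z | u <- L] by rewrite map_inj_uniq // undup_uniq.
rewrite -(card_le_eql (seq_card uF)) -(card_le_eqr (seq_card uL)).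
apply: card_le_trans h _; apply: subset_card_le => y /= [[_ /= /mapP[u us' ->] hy] By].
have yL (t : G) : t \in undup (0%R :: S) -> y = act (t + u) z -> y \in [seq act u z | u <- L].
  move=> tS ey; rewrite ey map_f // mem_undup mem_filter -ey asboolT //=.
  by apply/allpairsP; exists (u, t).
case: hy => [e|[t tS e]]; [apply: (yL 0)|apply: (yL t)]; rewrite ?mem_undup ?inE ?eqxx ?tS ?orbT //.
  by rewrite add0r.
by rewrite actD.
Qed.

(** The fractional matching, the flow and the class matchings are assembled here. The pieces are the
    sets of points moved by a given group element. *)
Lemma hall_equidecomposable (A B : set X) (f : X -> R) :
  injective f -> measurable_fun setT f ->
  equidistributed mu act A -> equidistributed mu act B ->
  mu_c mu A = mu_c mu B -> (0 < mu_c mu A)%E ->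
  hall_ae mu act A B -> equidecomposable_ae mu act true A B.
Proof.
move=> f_inj mf eA eB eAB A0 [S [_ hS]].
have [A' [Y1 [mA' cY1 hA]]] := mu_measurable_conull act0 actD mact pact eA.1.
have [B' [Y2 [mB' cY2 hB]]] := mu_measurable_conull act0 actD mact pact eB.1.
have [YS cYS hYS] := negligible_conull act0 actD mact pact hS.
pose Y x := (Y1 x /\ Y2 x) /\ YS x.
have cY : conull mu act Y by apply: conull_and => //; exact: conull_and.
have [mY _ Yact] := cY.
have Yg g x : Y (act g x) -> Y x by move=> /(Yact (- g)); rewrite -actD addNr act0.
(* Borel versions of [A] and [B]. Intersecting with the invariant set [Y] makes the Hall inequality
   hold at every base point: a single point of [A2] in the orbit puts the whole orbit into [Y]. *)
pose A2 x := A' x /\ Y x; pose B2 x := B' x /\ Y x.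
have mA2 : mp A2 by exact: mp_and.
have mB2 : mp B2 by exact: mp_and.
have A2E x : Y x -> (A x <-> A2 x).
  by move=> Yx; have [[Y1x _] _] := Yx; split=> [/(hA x Y1x)|[/(hA x Y1x)]].
have B2E x : Y x -> (B x <-> B2 x).
  by move=> Yx; have [[_ Y2x] _] := Yx; split=> [/(hB x Y2x)|[/(hB x Y2x)]].
have muA := mu_cE mA2 cY A2E; have muB := mu_cE mB2 cY B2E.
have prAB : pr mu A2 = pr mu B2 by apply: EFin_inj; rewrite -muA -muB.
have a0 : 0 < pr mu A2 by rewrite muA lte_fin in A0.
have hall2 z (s : seq G) : uniq s -> (forall u, u \in s -> A2 (act u z)) ->
  (size s <= size (undup [seq g <- [seq (t + u)%R | u <- s, t <- undup (0%R :: S)] | `[< B2 (act g z) >]]))%N.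
  move=> us sA; case: s us sA => [//|u0 s] us sA.
  have Yz : Y z by have [_ /Yg] := sA u0 (mem_head _ _).
  have [_ YSz] := Yz; apply: (@hall_seq_count A2 B2) => // F finF Forb.
  have FY x : F x -> Y x by move=> /Forb[g _ <-]; exact: Yact.
  have /contrapT/(_ F finF Forb)[h _] := hYS z YSz.
  have -> : F `&` A2 = F `&` A by apply/seteqP; split=> x [Fx ?]; split=> //; apply/(A2E x (FY x Fx)).
  apply: card_le_trans h _; apply: subset_card_le => y [bF By]; split=> //; apply/B2E => //.
  by case: bF => x Fx [->|[t _ ->]]; [exact: FY|apply: Yact; exact: FY].
have [w [Z [mZ Z0 Zact mw wAB]]] := measurable_fractional_matching act0 actD mact pact mA2 mB2 prAB hall2.
have [M hM] := invariant_box_flow act0 actD mact pact act_free mf f_inj mZ Z0 Zact mw wAB.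
have [NA hNA] := equidistributed_dense a0 muA eA.
have [NB hNB] := equidistributed_dense a0 (etrans (esym eAB) muA) eB.
(* Chosen so that [1 / q] is below half the measure of [A2]. *)
pose q := (Num.bound (2 / pr mu A2)).+1.
(* Large enough for both density statements, and at least [2 * d * M * 3 ^ d * q], so that a tile
   with [m ^ d / q] points outweighs the flow through its sides. *)
pose m := (NA + NB + 2 * d * M * 3 ^ d * q + 1)%N.
have m0 : (0 < m)%N by rewrite /m addn1.
have [|YA [cYA hYA]] := hNA m; first by rewrite /m; lia.
have [|YB [cYB hYB]] := hNB m; first by rewrite /m; lia.
have [E [psi [Y3 [[Ec EDelta] hpsi psi_int [mY3 Y30] hY3]]]] := hM m m0.
have cY3 : conull mu act Y3 by split=> // g x /hY3[].
pose W x := (Y x /\ Y3 x) /\ (YA x /\ YB x).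
have cW : conull mu act W by apply: conull_and; exact: conull_and.
have [mW _ Wact] := cW.
(* The ceiling of [m ^ d / q], a lower bound for the number of points of [A] and of [B] in each cube
   of side [m]. *)
pose kap := ((m ^ d + q.-1) %/ q)%N.
have kap1 : (m ^ d <= kap * q)%N.
  rewrite /kap; have := divn_eq (m ^ d + q.-1) q; have := @ltn_pmod (m ^ d + q.-1) q isT.
  by rewrite /q; lia.
have kap_le (k : nat) : pr mu A2 / 2 * (m ^ d)%:R <= k%:R -> (kap <= k)%N.
  move=> h; rewrite /kap -ltnS ltn_divLR //.
  have : (m ^ d <= k * q)%N.
    rewrite -(ler_nat R) natrM; have : 2 / pr mu A2 < q%:R.
      apply: lt_le_trans (archi_boundP _) _; first by rewrite divr_ge0 // ltW.
      by rewrite ler_nat.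
    rewrite ltr_pdivrMr // => h2.
    have k0 : (0 : R) <= (m ^ d)%:R by rewrite ler0n.
    have q0 : (0 : R) <= q%:R by rewrite ler0n.
    move: h h2 k0 q0; move: ((m ^ d)%:R : R) (k%:R : R) (q%:R : R) (pr mu A2) => u v t a h h2 k0 q0.
    have := ler_wpM2r q0 h; have := ler_wpM2l k0 (ltW h2); lra.
  by rewrite mulSn /q; lia.
have kap0 : (0 < kap)%N.
  by rewrite lt0n; apply/eqP => e; move: kap1; rewrite e leqn0 expn_eq0; case: (m) m0.
have kapM : (2 * d * M * (3 * m) ^ d <= kap * m)%N.
  have : (2 * d * M * 3 ^ d * q * m ^ d <= m * (kap * q))%N.
    by apply: leq_mul => //; rewrite /m; lia.
  move=> h; rewrite expnMn -(leq_pmul2r (isT : (0 < q)%N)).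
  have -> : (2 * d * M * (3 ^ d * m ^ d) * q = 2 * d * M * 3 ^ d * q * m ^ d)%N by rewrite mulnA mulnAC.
  by have -> : (kap * m * q = m * (kap * q))%N by rewrite mulnAC mulnC.
have dense (P P' : X -> Prop) YP : (forall x, Y x -> (P x <-> P' x)) ->
    (forall x, YP x -> pr mu A2 / 2 * (m ^ d)%:R <=
       (count (fun g => `[< P (act g x) >]) (@gbox d Delta 0 m))%:R) ->
    forall x, Y x -> YP x -> (kap <= count (fun g => `[< P' (act g x) >]) (@gbox d Delta 0 m))%N.
  move=> e h x Yx YPx; apply: kap_le; apply: le_trans (h x YPx) _.
  rewrite ler_nat; apply: sub_count => g /asboolP Pg; apply/asboolP/e => //.
  exact: Yact.
have [ o [V [mo oA o_inj o_surj]]] := measurable_matching act0 actD mact act_free mf f_inj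
  mA2 mB2 mW Wact Ec EDelta (fun i => let: And3 h _ _ := hpsi i in h)
  (fun i => let: And3 _ h _ := hpsi i in h) (fun i => let: And3 _ _ h := hpsi i in h) psi_int
  (fun x (Wx : W x) => let: And3 _ h _ := hY3 x Wx.1.2 in h)
  (fun x (Wx : W x) => let: And3 _ _ h := hY3 x Wx.1.2 in h) m0 kap0 kapM
  (fun x (Wx : W x) => dense A A2 YA A2E hYA x Wx.1.1 Wx.2.1)
  (fun x (Wx : W x) => dense B B2 YB B2E hYB x Wx.1.1 Wx.2.2).
pose L := undup V; pose gam i := nth 0 L i.
pose As i : set X := [set x | (A2 x /\ W x) /\ o x = gam i].
have mAs i : measurable (As i).
  by apply: mp_and; [exact: mp_and|exact: (mo (fun g => g = gam i))].
have gam_inj i j : (i < size L)%N -> (j < size L)%N -> gam i = gam j -> i = j.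
  by move=> iL jL /eqP; rewrite nth_uniq ?undup_uniq // => /eqP.
exists (size L), As, (fun i => act (gam i) @` As i), gam; split.
- move=> i iL; split=> //.
  + by move=> x [[Ax [[Yx _] _]] _]; exact/A2E.
  + move=> _ [x [[Ax Wx] ox] <-]; have [[Yx _] _] := Wx.
    by apply/(B2E _ (Yact _ _ Yx)); have [+ _] := oA x Wx Ax; rewrite ox.
  have meas (P : set X) : measurable P -> mu_measurable mu P.
    by move=> mP; exists P; split=> //; rewrite setDv setU0; exact: negligible_set0.
  move=> _; split; apply: meas => //.
  have -> : act (gam i) @` As i = [set x | As i (act (- gam i) x)].
    apply/seteqP; split=> [_ [x Ax <-] /=|x /= Ax]; first by rewrite -actD addNr act0.
    by exists (act (- gam i) x) => //; rewrite -actD subrr act0.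
  exact: (mp_comp (mact (- gam i)) (mAs i)).
- move=> i j iL jL ij; split; apply/seteqP; split=> // x.
    by move=> [[_ ei] [_ ej]]; apply: ij; apply: gam_inj => //; rewrite -ei -ej.
  (* A common point of two image pieces has one source only, by [o_inj]. *)
  move=> [[y [[Ay Wy] oy] yx] [z [[Az Wz] oz] zx]]; apply: ij; apply: gam_inj => //.
  have zE : z = act (gam i - gam j) y.
    by rewrite addrC actD yx -zx -actD addNr act0.
  have := o_inj y (gam i - gam j) Wy Ay; rewrite -zE oz oy zx yx => /(_ Az erefl)/eqP.
  by rewrite subr_eq0 => /eqP.
- apply: (conull_negligible cW) => x Wx [Ax nx]; apply: nx.
  have A2x : A2 x by apply/A2E => //; have [[]] := Wx.
  have [_ oV] := oA x Wx A2x.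
  by exists (index (o x) L); rewrite /= ?index_mem ?mem_undup //; split=> //; rewrite /gam nth_index // mem_undup.
- apply: (conull_negligible cW) => y Wy [By ny]; apply: ny.
  have B2y : B2 y by apply/B2E => //; have [[]] := Wy.
  have [g [Ag og]] := o_surj y Wy B2y; set x := act g y in Ag og.
  have Wx : W x by exact: Wact.
  have [_ oV] := oA x Wx Ag.
  have ox : gam (index (o x) L) = o x by rewrite /gam nth_index // mem_undup.
  exists (index (o x) L); first by rewrite /= index_mem mem_undup.
  by exists x; [split|rewrite ox].
Qed.

End Equivalence.

Theorem theorem1 (dX : measure_display) (X : measurableType dX) (R : realType)
  (d : nat) (Delta : finZmodType) (mu : probability X R)
  (act : Grp d Delta -> X -> X) (A B : set X) :
  @standard_borel dX X R ->
  free_pmp_action mu act ->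
  equidistributed mu act A -> equidistributed mu act B ->
  mu_c mu A = mu_c mu B -> (0 < mu_c mu A)%E ->
  [/\ hall_ae mu act A B <-> equidecomposable_ae mu act true A B,
      equidecomposable_ae mu act true A B <-> equidecomposable_ae mu act false A B &
      hall_ae mu act A B <-> equidecomposable_ae mu act false A B].
Proof.
move=> [f [f_inj [mf _]]] [act0 actD mact pact act_free] eA eB eAB A0.
have h12 := hall_equidecomposable act0 actD mact pact act_free f_inj mf eA eB eAB A0.
have h23 : equidecomposable_ae mu act true A B -> equidecomposable_ae mu act false A B.
  move=> [n [As [Bs [gam [hp hd nA nB]]]]]; exists n, As, Bs, gam; split=> //.
  by move=> i /hp[? ? ? _].
have h31 := @equidecomposable_hall _ _ _ _ _ _ _ act0 actD mact pact A B.
by split; split=> // h; [exact/h31/h23|exact/h12/h31|exact/h23/h12].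
Qed.
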